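(* Let $G$ be a locally compact Polish abelian group, let $(X,\mathcal B,m)$ be a standard probability space, and let $T:G\to NST(X)$ be a non-singular, properly ergodic $G$-action. Let $(Y,\mathcal C,\nu)$ be a standard probability space, let $S:G\to PPT(Y)$ be an ergodic probability preserving $G$-action, and let $\sigma_0$ be the spectral type (a measure on $\hat G$, defined up to equivalence of measures) of the reduced Koopman representation induced by $S$. Let $e(T)\subseteq\hat G$ be the set of eigenvalues of $T$. Then the following are equivalent: (1) the product action $T\times S$ of $G$ on $(X\times Y,\mathcal B\times\mathcal C,m\times\nu)$, $(T\times S)_g(x,y)=(T_gx,S_gy)$, is ergodic; (2) $\sigma_0(e(T))=0$.
   Context: $PPT(Y)$ is the group of invertible probability preserving transformations of $(Y,\mathcal C,\nu)$. $NST(X)$ is the group of invertible non-singular transformations of $(X,\mathcal B,m)$ (measurable $f$ with $m(C)=0\iff m(f^{-1}C)=0$), with the Polish topology pulled back from the weak operator topology via $T\mapsto U_T$, where $U_Tf=\sqrt{\frac{d(m\circ T)}{dm}}\,f\circ T$ on $L_2(X,\mathcal B,m)$. A non-singular action of $G$ is a continuous homomorphism $T:G\to NST(X)$; a probability preserving action is a continuous homomorphism $S:G\to PPT(Y)$. An action $T$ is ergodic if every $A\in\mathcal B$ with $m(T_gA\bigtriangleup A)=0$ for all $g\in G$ satisfies $m(A)=0$ or $m(X\setminus A)=0$. It is properly ergodic if it is ergodic and every orbit $\{T_gx: g\in G\}$ has measure zero. $\hat G$ is the dual group of $G$ (continuous homomorphisms $\chi:G\to S^1$). An eigenvalue of $T$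 is a $\chi\in\hat G$ for which there is a non-zero $f\in L_2(X,\mathcal B,m)$ such that, for every $g\in G$, $f\circ T_g=\chi(g)f$ $m$-almost everywhere; $e(T)$ is the set of eigenvalues (it is known to be a Borel set when $T$ is ergodic). The reduced Koopman representation of $S$ is $U_gf=f\circ S_g$ on $L_2(Y,\mathcal C,\nu)_0=\{f\in L_2(Y,\mathcal C,\nu):\int f\,d\nu=0\}$. By the spectral theorem there is a projection-valued spectral measure $E$ on $\hat G$ with $U_g=\int_{\hat G}\chi(-g)\,dE(\chi)$. The spectral type $\sigma_0$ is the measure on $\hat G$, unique up to equivalence, with $\sigma_0(A)=0\iff E(A)=0$ (the maximal spectral type; all measures $m_{\alpha,\beta}(A)=\langle E(A)\alpha,\beta\rangle$ are absolutely continuous with respect to it). *)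

(* Defs.v *)
From HB Require Import structures.
From mathcomp Require Import all_boot all_order all_algebra.
From mathcomp Require Import all_classical all_reals all_analysis.
From mathcomp Require Import complex.

Set Implicit Arguments.
Unset Strict Implicit.
Unset Printing Implicit Defensive.

Import Order.TTheory GRing.Theory Num.Theory.
Import numFieldNormedType.Exports.

Local Open Scope classical_set_scope.
Local Open Scope ring_scope.

Section polish_and_standard.
Context (R : realType).

Definition complete_separable_metric (X : Type) (dist : X -> X -> R) : Prop :=
  [/\ (forall x y, 0 <= dist x y) /\ (forall x y, dist x y = 0 <-> x = y),
      forall x y, dist x y = dist y x,
      forall x y z, dist x z <= dist x y + dist y z,
      forall u : nat -> X,
        (forall e : R, 0 < e -> exists N : nat, forall i j : nat,
           (N <= i)%N -> (N <= j)%N -> dist (u i) (u j) < e) ->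
        exists l, (fun n => dist (u n) l) @ \oo --> (0 : R)
    & exists2 D : set X, countable D &
        forall x (e : R), 0 < e -> exists2 y, D y & dist x y < e].

Definition metric_open (X : Type) (dist : X -> X -> R) : set (set X) :=
  [set U | forall x, U x ->
     exists2 e : R, 0 < e & [set y | dist x y < e] `<=` U].

Definition polish (X : topologicalType) : Prop :=
  exists2 dist : X -> X -> R,
    complete_separable_metric dist & @open X = metric_open dist.

Definition standard_borel d (X : measurableType d) : Prop :=
  exists2 dist : X -> X -> R,
    complete_separable_metric dist &
    @measurable d X = <<s metric_open dist >>.

End polish_and_standard.

(* [R[i]^o] is [R[i]] with the topology given by its norm; [R[i]] itself
   carries no topology in the library. *)
Section complex_L2.
Context (R : realType) d (X : measurableType d).

(* [mu] is a bare set function so that the integral also makes sense for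
   [A |-> <E A f, f>] below. *)
Definition Cintegral (mu : set X -> \bar R) (f : X -> R[i]^o) : R[i]^o :=
  (fine (\int[mu]_x (complex.Re (f x))%:E)%E +i*
   fine (\int[mu]_x (complex.Im (f x))%:E)%E)%C.

Definition L2 (mu : {measure set X -> \bar R}) : set (X -> R[i]^o) :=
  [set f : X -> R[i]^o |
             [/\ measurable_fun setT (fun x => complex.Re (f x) : R),
               measurable_fun setT (fun x => complex.Im (f x) : R)
             & (\int[mu]_x (complex.Re (f x) ^+ 2 +
                            complex.Im (f x) ^+ 2)%:E < +oo)%E]].

Definition inner (mu : {measure set X -> \bar R}) (f h : X -> R[i]^o) : R[i]^o :=
  Cintegral mu (fun x => f x * conjc (h x)).

Definition L20 (mu : {measure set X -> \bar R}) : set (X -> R[i]^o) :=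
  [set f | L2 mu f /\ Cintegral mu f = 0].

End complex_L2.

(* Elements of L2 are represented by functions, and elements of NST(X) by
   bijections; equality in either is equality almost everywhere.  In particular
   actions below are homomorphisms modulo null sets, while the orbits are those
   of the chosen representatives. *)
Section nonsingular.
Context (R : realType) d (X : measurableType d).

Record nst (m : probability X R) := Nst {
  nst_fun :> X -> X ;
  nst_inv : X -> X ;
  nst_funK : cancel nst_fun nst_inv ;
  nst_invK : cancel nst_inv nst_fun ;
  nst_measurable_fun : measurable_fun setT nst_fun ;
  nst_measurable_inv : measurable_fun setT nst_inv ;
  nst_null : forall A, measurable A -> m A = 0%E <-> m (nst_fun @^-1` A) = 0%E
}.

Context (m : probability X R).

Definition comp_measure (T : nst m) : set X -> \bar R := fun A => m (T @` A).

Section comp_measure_charge.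
Local Open Scope ereal_scope.
Variable T : nst m.

Let image_nst A : T @` A = nst_inv T @^-1` A.
Proof.
apply/seteqP; split => [_ [x Ax <-]|y Ay] /=; first by rewrite nst_funK.
by exists (nst_inv T y) => //; rewrite nst_invK.
Qed.

Let measurable_image_nst A : measurable A -> measurable (T @` A).
Proof.
by move=> mA; rewrite image_nst -[X in measurable X]setTI;
  apply: nst_measurable_inv.
Qed.

Let comp_measure0 : comp_measure T set0 = 0.
Proof. by rewrite /comp_measure image_set0 measure0. Qed.

Let comp_measure_finite A : measurable A -> comp_measure T A \is a fin_num.
Proof. by move=> mA; apply/fin_num_measure/measurable_image_nst. Qed.

Let comp_measure_sigma_additive : semi_sigma_additive (comp_measure T).
Proof.
move=> F mF tF mUF; rewrite /comp_measure image_bigcup.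
apply: measure_semi_sigma_additive.
- by move=> n; apply: measurable_image_nst.
- apply/trivIsetP => /= i j _ _ ij; rewrite !image_nst -preimage_setI.
  by move/trivIsetP : tF => /(_ _ _ _ _ ij) ->//; rewrite preimage_set0.
- by rewrite -image_bigcup; apply: measurable_image_nst.
Qed.

HB.instance Definition _ := isCharge.Build _ _ _ (comp_measure T)
  comp_measure0 comp_measure_finite comp_measure_sigma_additive.

End comp_measure_charge.

Local Open Scope charge_scope.

Definition nst_unitary (T : nst m) (f : X -> R[i]^o) : X -> R[i]^o :=
  fun x => (Num.sqrt (fine ('d (comp_measure T) '/d m x)))%:C%C * f (T x).

End nonsingular.

Section actions.
Context (R : realType) (G : topologicalZmodType).

Section one_space.
Context d (X : measurableType d).

(* The second clause is continuity for the topology of NST(X) pulled back from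
   the weak operator topology. *)
Definition nonsingular_action (m : probability X R) (T : G -> nst m) : Prop :=
  (forall g h, {ae m, forall x, T (g + h) x = T g (T h x)}) /\
  (forall f h, L2 m f -> L2 m h ->
     continuous (fun g => inner m (nst_unitary (T g) f) h)).

(* The topology of PPT(Y) is the one inherited from NST(Y). *)
Definition probability_preserving_action
    (m : probability X R) (S : G -> nst m) : Prop :=
  nonsingular_action S /\
  forall g A, measurable A -> m (S g @^-1` A) = m A.

Definition ergodic (mu : set X -> \bar R) (T : G -> X -> X) : Prop :=
  forall A, measurable A ->
    (forall g, mu ((T g @` A) `+` A) = 0%E) ->
    mu A = 0%E \/ mu (~` A) = 0%E.

(* An orbit need not be measurable a priori, hence [negligible]. *)
Definition properly_ergodic (m : probability X R) (T : G -> X -> X) : Prop :=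
  ergodic m T /\ forall x, m.-negligible [set T g x | g in [set: G]].

End one_space.

Definition is_character (chi : G -> R[i]^o) : Prop :=
  [/\ continuous chi, forall g, `|chi g| = 1
    & forall g h, chi (g + h) = chi g * chi h].

Record dual := Dual {
  dual_fun :> G -> R[i]^o ;
  dual_character : is_character dual_fun
}.

Lemma is_character1 : is_character (fun=> 1).
Proof.
split=> [g|g|g h]; [exact: cst_continuous|exact: normr1|by rewrite mulr1].
Qed.

HB.instance Definition _ := gen_eqMixin dual.
HB.instance Definition _ := gen_choiceMixin dual.
HB.instance Definition _ := isPointed.Build dual (Dual is_character1).
HB.instance Definition _ := Topological.copy dual
  (@initial_topology dual {compact-open, G -> R[i]^o} dual_fun).

Definition borel_dual := g_sigma_algebraType (@open dual).
HB.instance Definition _ := Measurable.on borel_dual.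

Definition eigenvalues d (X : measurableType d) (m : probability X R)
    (T : G -> X -> X) : set dual :=
  [set chi | exists f : X -> R[i]^o,
     [/\ L2 m f, ~ {ae m, forall x, f x = 0}
       & forall g, {ae m, forall x, f (T g x) = chi g * f x}]].

Section spectral.
Context d (Y : measurableType d) (nu : probability Y R).

Definition projection_valued_measure
    (E : set borel_dual -> (Y -> R[i]^o) -> (Y -> R[i]^o)) : Prop :=
  [/\ forall A, measurable A ->
        [/\ forall f, L20 nu f -> L20 nu (E A f),
            forall f h, L20 nu f -> L20 nu h ->
              {ae nu, forall y, f y = h y} ->
              {ae nu, forall y, E A f y = E A h y}
          & forall (a : R[i]) f h, L20 nu f -> L20 nu h ->
              {ae nu, forall y,
                E A (fun z => a * f z + h z) y = a * E A f y + E A h y}],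
      forall A, measurable A ->
        (forall f, L20 nu f -> {ae nu, forall y, E A (E A f) y = E A f y}) /\
        (forall f h, L20 nu f -> L20 nu h ->
           inner nu (E A f) h = inner nu f (E A h)),
      forall f, L20 nu f ->
        {ae nu, forall y, E set0 f y = 0} /\ {ae nu, forall y, E setT f y = f y},
      forall A B, measurable A -> measurable B -> forall f, L20 nu f ->
        {ae nu, forall y, E (A `&` B) f y = E A (E B f) y}
    & forall F : nat -> set borel_dual,
        (forall n, measurable (F n)) -> trivIset setT F ->
        forall f h, L20 nu f -> L20 nu h ->
        (fun n => \sum_(0 <= k < n) inner nu (E (F k) f) h) @ \oo -->
          inner nu (E (\bigcup_n F n) f) h].

(* Integral of [phi] against the complex measure [A |-> <E A f, h>], which the
   polarization identity writes as a combination of the four positive measures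
   [A |-> <E A u, u>], [u = f + 'i ^+ k h]. *)
Definition spectral_integral
    (E : set borel_dual -> (Y -> R[i]^o) -> (Y -> R[i]^o))
    (phi : borel_dual -> R[i]^o) (f h : Y -> R[i]^o) : R[i]^o :=
  4^-1 * \sum_(k < 4) ('i%C : R[i]) ^+ k *
    let u := fun y => f y + ('i%C : R[i]) ^+ k * h y in
    Cintegral (fun A => (complex.Re (inner nu (E A u) u))%:E) phi.

Definition is_spectral_measure (S : G -> Y -> Y)
    (E : set borel_dual -> (Y -> R[i]^o) -> (Y -> R[i]^o)) : Prop :=
  projection_valued_measure E /\
  forall g f h, L20 nu f -> L20 nu h ->
    inner nu (f \o S g) h =
    spectral_integral E (fun chi : dual => chi (- g)) f h.

Definition is_spectral_type (S : G -> Y -> Y)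
    (sigma0 : {measure set borel_dual -> \bar R}) : Prop :=
  exists2 E, is_spectral_measure S E &
    forall A, measurable A ->
      (sigma0 A = 0%E <->
       forall f, L20 nu f -> {ae nu, forall y, E A f y = 0}).

End spectral.
End actions.

(* Main.v *)
Require Import Defs.
From HB Require Import structures.
From mathcomp Require Import all_boot all_order all_algebra.
From mathcomp Require Import all_classical all_reals all_analysis.
From mathcomp Require Import complex measurable_realfun ring lra.

(** The set e(T) is a countable union of sets of characters that have an
    eigenfunction of bounded L2 norm whose real part has integral 1 over a fixed
    set [C]; by weak compactness each of these sets is closed.

    Ergodicity implies nullity: suppose that [E P h] is not 0 for one of these
    closed sets [P].  Cut the dual into finitely many cells [V k] on which
    finitely many evaluations of characters are almost constant, choose
    eigenfunctions [f k] with eigenvalue in [V k], and form the almost invariant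
    functions sum_k (f k)(x) (E (V k `&` P) h)(y).  A weak limit is invariant
    under the product action, and its means over the sets [C `*` D] recover
    [E P h], so it is not constant.

    Nullity implies ergodicity: let [A] be invariant under the product action,
    neither null nor conull, let [F x] be the section of [A] at [x] minus its
    mean, and let [w] be a nonzero average of the [F x].  For a small cell [V]
    the function x |-> <F x, E V w> / |E V w|^2 is an almost eigenfunction,
    bounded in L2 as long as the energy of [F] in [V] is controlled by that of
    [w].  The energies of [F] add up to at most 1, so the cells without this
    control carry at most half of the spectral mass of [w].  Hence some character
    outside e(T) lies in good cells of arbitrarily fine partitions, and a weak
    limit of their almost eigenfunctions makes it an eigenvalue. *)

Set Implicit Arguments.
Unset Strict Implicit.
Unset Printing Implicit Defensive.

Import Order.TTheory GRing.Theory Num.Theory.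
Import numFieldNormedType.Exports.

Local Open Scope classical_set_scope.
Local Open Scope ring_scope.

(** Two properties are easily lost in weak limits. A weak limit of nonzero functions can vanish:
    hence means over [C] are normalised to 1, a condition that is weakly continuous and keeps the
    limit nonzero. And composition with a merely non-singular map need not preserve L2: hence
    invariance is tested only on sets where the density of the transformation is bounded, and these
    exhaust the space.

    No bound depends on the number of cells: distinct cells have orthogonal spectral ranges, which
    the Koopman operators respect, so squared norms add up to the squared norm of a single vector.

    The two directions treat [G] differently. From ergodicity, approximations are indexed by finite
    subsets of [G], so that the limit is invariant under every element. From nullity, a character
    must be found that is good infinitely often; this uses countable additivity, hence a sequence of
    partitions. They control only a dense sequence of [G], and [eigen_dense] extends the eigenvalue
    equation by continuity of the action. *)

Notation "'Int' mu f" := (Rintegral mu setT f)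
  (at level 10, mu at level 8, f at level 8, only parsing).

Definition intg (R : realType) d (X : measurableType d)
    (mu : {measure set X -> \bar R}) (f : X -> R) : Prop :=
  mu.-integrable setT (EFin \o f).

(** Measurability of [f] is asked separately, since integrability of the square does not control the
    sign of [f]. *)
Definition sqi (R : realType) d (X : measurableType d)
    (mu : {measure set X -> \bar R}) (f : X -> R) : Prop :=
  measurable_fun setT f /\ intg mu (fun x => f x ^+ 2).

(** * Real integrals against a probability measure *)

Section integrals.
Context (R : realType) d (X : measurableType d) (m : probability X R).
Implicit Types (f g h : X -> R) (A : set X).

Lemma measurable_fun_indic A : measurable A ->
  measurable_fun setT (\1_A : X -> R).
Proof. by move/measurable_indicP; apply. Qed.

Lemma normr_indic_le1 A x : `|\1_A x| <= 1 :> R.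
Proof. by rewrite indicE; case: (x \in A); rewrite ?normr1 ?normr0. Qed.

Lemma measurable_sublevel f (c : R) : measurable_fun setT f ->
  measurable [set x | f x <= c].
Proof.
move=> mf; rewrite -[X in measurable X]setTI.
exact: (measurable_fun_le measurableT mf (measurable_cst c)).
Qed.

Lemma intg_measurable f : intg m f -> measurable_fun setT f.
Proof. by move/measurable_int/measurable_EFinP. Qed.

Lemma EFin_Int f : intg m f -> (Int m f)%:E = (\int[m]_x (f x)%:E)%E.
Proof. by move=> mf; rewrite fineK//; exact: integrable_fin_num. Qed.

Lemma intgD f g : intg m f -> intg m g -> intg m (fun x => f x + g x).
Proof. by move=> mf mg; have := integrableD measurableT mf mg. Qed.

Lemma intgB f g : intg m f -> intg m g -> intg m (fun x => f x - g x).
Proof. by move=> mf mg; have := integrableB measurableT mf mg. Qed.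

Lemma intgZ k f : intg m f -> intg m (fun x => k * f x).
Proof. by move=> mf; have := integrableZl measurableT k mf. Qed.

Lemma intg_le f g : measurable_fun setT f -> intg m g ->
  (forall x, `|f x| <= g x) -> intg m f.
Proof.
move=> mf ig fg; apply: le_integrable ig => //; first exact/measurable_EFinP.
move=> x _ /=; rewrite lee_fin (le_trans (fg x))//; exact: ler_norm.
Qed.

Lemma intg_cst k : intg m (fun=> k).
Proof. exact: finite_measure_integrable_cst. Qed.

Lemma intg_bounded f M : measurable_fun setT f ->
  (forall x, `|f x| <= M) -> intg m f.
Proof. by move=> mf; apply: intg_le => //; exact: intg_cst. Qed.

Lemma intg_norm f : intg m f -> intg m (fun x => `|f x|).
Proof. by move=> mf; have := integrable_norm mf. Qed.

Lemma intgM_bounded f g M : intg m f -> measurable_fun setT g ->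
  (forall x, `|g x| <= M) -> intg m (fun x => f x * g x).
Proof.
move=> mf mg gM; apply: (@intg_le _ (fun x => M * `|f x|)).
- exact: measurable_funM (intg_measurable mf) mg.
- exact/intgZ/intg_norm.
- by move=> x; rewrite normrM mulrC ler_wpM2r.
Qed.

Lemma intgM_indic f A : intg m f -> measurable A ->
  intg m (fun x => f x * \1_A x).
Proof.
move=> mf mA; apply: (@intgM_bounded _ _ 1 mf); first exact: measurable_fun_indic.
by move=> x; exact: normr_indic_le1.
Qed.

Lemma IntD f g : intg m f -> intg m g ->
  Int m (fun x => f x + g x) = Int m f + Int m g.
Proof. by move=> mf mg; exact: RintegralD. Qed.

Lemma IntB f g : intg m f -> intg m g ->
  Int m (fun x => f x - g x) = Int m f - Int m g.
Proof. by move=> mf mg; exact: RintegralB. Qed.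

Lemma IntZ k f : intg m f -> Int m (fun x => k * f x) = k * Int m f.
Proof. by move=> mf; exact: RintegralZl. Qed.

Lemma Int_cst k : Int m (fun=> k) = k.
Proof. by rewrite Rintegral_cst// [X in fine X]probability_setT mulr1. Qed.

Lemma Int_indic A : measurable A -> Int m (fun x => \1_A x) = fine (m A).
Proof. by move=> mA; rewrite /Rintegral integral_indic// setIT. Qed.

Lemma le_Int f g : intg m f -> intg m g -> (forall x, f x <= g x) ->
  Int m f <= Int m g.
Proof. by move=> mf mg fg; apply: le_Rintegral. Qed.

Lemma Int_ge0 f : (forall x, 0 <= f x) -> 0 <= Int m f.
Proof. by move=> f0; apply: Rintegral_ge0. Qed.

Lemma ler_norm_Int f : intg m f -> `|Int m f| <= Int m (fun x => `|f x|).
Proof. by move=> mf; apply: le_normr_Rintegral. Qed.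

Lemma intg_sum I (s : seq I) (F : I -> X -> R) : (forall i, intg m (F i)) ->
  intg m (fun x => \sum_(i <- s) F i x).
Proof.
move=> mF; elim: s => [|i s ih].
  by under eq_fun do rewrite big_nil; exact: intg_cst.
by under eq_fun do rewrite big_cons; exact: intgD.
Qed.

Lemma Int_sum I (s : seq I) (F : I -> X -> R) : (forall i, intg m (F i)) ->
  Int m (fun x => \sum_(i <- s) F i x) = \sum_(i <- s) Int m (F i).
Proof.
move=> mF; elim: s => [|i s ih].
  by rewrite big_nil; under eq_fun do rewrite big_nil; rewrite Int_cst.
under eq_fun do rewrite big_cons.
by rewrite big_cons IntD// ?ih//; exact: intg_sum.
Qed.

Lemma Int_ae f g : measurable_fun setT f -> measurable_fun setT g ->
  {ae m, forall x, f x = g x} -> Int m f = Int m g.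
Proof.
move=> mf mg fg; rewrite /Rintegral (@ae_eq_integral _ _ _ m setT (fun x => (f x)%:E) (fun x => (g x)%:E))//;
  try exact/measurable_EFinP.
by move: fg; apply: filterS => x -> _.
Qed.

Lemma Int_eq0 f : intg m f -> (forall x, 0 <= f x) -> Int m f = 0 ->
  {ae m, forall x, f x = 0}.
Proof.
move=> mf f0 If; have := EFin_Int mf; rewrite If => /esym fi.
have : (\int[m]_x `|(f x)%:E| = 0)%E.
  by rewrite -[RHS]fi; apply: eq_integral => x _; rewrite gee0_abs// lee_fin.
have mEf : measurable_fun setT (EFin \o f) by apply: measurable_int mf.
move/(ae_eq_integral_abs m measurableT mEf).
by apply: filterS => x /(_ I) [].
Qed.

Lemma Int_eq0_sets f : intg m f ->
  (forall A, measurable A -> Int m (fun x => f x * \1_A x) = 0) ->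
  {ae m, forall x, f x = 0}.
Proof.
move=> mf f0.
have : ae_eq m setT (EFin \o f) (cst 0%E).
  apply: integral_ae_eq => // E _ mE; rewrite integral0.
  transitivity (Int m (fun x => f x * \1_E x))%:E; last by rewrite f0.
  rewrite EFin_Int; last exact: intgM_indic.
  rewrite integral_mkcond; apply: eq_integral => x _.
  by rewrite /patch indicE; case: (x \in E); rewrite ?mulr1 ?mulr0.
by apply: filterS => x /(_ I) [].
Qed.

Lemma dominated_Int (F : nat -> X -> R) f g :
  (forall n, measurable_fun setT (F n)) -> measurable_fun setT f -> intg m g ->
  (forall x, (fun n => F n x) @ \oo --> f x) ->
  (forall n x, `|F n x| <= g x) ->
  (fun n => Int m (F n)) @ \oo --> Int m f.
Proof.
move=> mF mf mg Ff Fg.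
have [||iF _ lim] := @dominated_convergence _ _ _ m setT measurableT
  (fun n x => (F n x)%:E) (EFin \o f) (EFin \o g)
  (fun n => (measurable_EFinP _ _).2 (mF n)) ((measurable_EFinP _ _).2 mf)
  _ mg _.
- by apply: aeW => x _ /=; apply: cvg_EFin; [exact: nearW | exact: Ff].
- by apply: aeW => x n _; rewrite /= lee_fin.
apply: fine_cvg; rewrite [X in _ --> X]fineK//.
exact: integrable_fin_num.
Qed.

(** Dominated convergence with bound [|f|]. As [f] may change sign, this is the additivity of a
    signed set function; it is the union step of the Dynkin-class arguments below. *)
Lemma Int_bigcup_cvg f (F : nat -> set X) : intg m f ->
  (forall k, measurable (F k)) -> trivIset setT F ->
  (fun n => \sum_(k <- iota 0 n) Int m (fun x => f x * \1_(F k) x)) @ \oo -->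
  Int m (fun x => f x * \1_(\bigcup_k F k) x).
Proof.
move=> If mF tF.
have mn n : measurable (\big[setU/set0]_(k < n) F k) by exact: bigsetU_measurable.
have sumE : (fun n => \sum_(k <- iota 0 n) Int m (fun x => f x * \1_(F k) x)) =
    (fun n => Int m (fun x => f x * \1_(\big[setU/set0]_(k < n) F k) x)).
  apply/funext => n; rewrite -Int_sum; last by move=> k; exact: intgM_indic.
  congr Rintegral; apply/funext => x; rewrite -mulr_sumr; congr (_ * _).
  elim: n => [|n ih]; first by rewrite big_ord0 big_nil indicE in_set0.
  rewrite -[in LHS]addn1 iotaD big_ord_recr big_cat/= big_seq1 add0n ih.
  have dis : \big[setU/set0]_(k < n) F k `&` F n = set0.
    by apply: (@trivIset_bigsetUI _ predT) => //; exact: sub_trivIset tF.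
  rewrite !indicE in_setU.
  case: (boolP (x \in F n)) => h1; case: (boolP (x \in \big[setU/set0]_(k < n) F k)) => h2;
    rewrite /= ?addr0 ?add0r//.
  have : (\big[setU/set0]_(k < n) F k `&` F n) x by split; rewrite -in_setE.
  by rewrite dis.
rewrite sumE; apply: (@dominated_Int _ _ (fun x => `|f x|)).
- by move=> n; exact: intg_measurable (intgM_indic If (mn n)).
- have mU := bigcupT_measurable F mF; exact: intg_measurable (intgM_indic If mU).
- exact: intg_norm.
- move=> x; apply: cvgM; first exact: cvg_cst.
  have [[k _ Fkx]|nUx] := pselect ((\bigcup_k F k) x).
    apply: cvg_near_cst; exists k.+1 => // n /= kn.
    by rewrite !indicE !mem_set//; [exists k|rewrite -bigcup_mkord; exists k].
  apply: cvg_near_cst; apply: nearW => n.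
  rewrite !indicE !memNset//.
  by apply: contra_not nUx; rewrite -bigcup_mkord => -[k _ Fk]; exists k.
- by move=> n x; rewrite normrM ler_piMr// normr_indic_le1.
Qed.

(** Integrability is part of the conclusion: this serves to show that a density known only to be in
    L1 is in fact in L2. *)
Lemma monotone_truncation_intg f M : measurable_fun setT f ->
  (forall x, 0 <= f x) ->
  (forall k : nat, Int m (fun x => f x * \1_[set y | f y <= k%:R] x) <= M) ->
  intg m f /\ Int m f <= M.
Proof.
move=> mf f0 fM.
pose F (k : nat) x := (f x * \1_[set y | f y <= k%:R] x)%:E.
have mS (k : nat) : measurable [set y | f y <= k%:R] by exact: measurable_sublevel.
have mF k : measurable_fun setT (F k).
  by apply/measurable_EFinP/measurable_funM => //; exact: measurable_fun_indic.
have iF (k : nat) : intg m (fun x => f x * \1_[set y | f y <= k%:R] x).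
  apply: (@intg_bounded _ k%:R); first exact/measurable_EFinP/mF.
  move=> x; rewrite indicE; case: (boolP (x \in _)); rewrite ?mulr1 ?mulr0 ?normr0//.
  by rewrite inE /= ger0_norm.
have ndF x : {homo F ^~ x : a b / (a <= b)%N >-> (a <= b)%E}.
  move=> a b ab; rewrite lee_fin ler_wpM2l// !indicE ler_nat.
  case: (boolP (x \in _)) => //; rewrite inE /= => fa.
  by rewrite mem_set//=; apply: le_trans fa _; rewrite ler_nat.
have F0 k x : setT x -> (0 <= F k x)%E by move=> _; rewrite lee_fin mulr_ge0.
have := @cvg_monotone_convergence _ _ _ m setT measurableT F mF F0 (fun x _ => ndF x).
have -> : (fun x => limn (F^~ x)) = EFin \o f.
  apply/funext => x; apply/cvg_lim => //; apply: cvg_near_cst.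
  near=> k; rewrite /F indicE mem_set ?mulr1//=.
  near: k; exact: nbhs_infty_ger.
move=> cv.
have le : (\int[m]_x (f x)%:E <= M%:E)%E.
  apply: (@cvge_le _ _ _ _ _ _ _ _ cv); apply: nearW => k.
  by rewrite -EFin_Int// lee_fin.
have i : intg m f.
  apply/integrableP; split; first exact/measurable_EFinP.
  under eq_integral do rewrite gee0_abs ?lee_fin//.
  exact: le_lt_trans le (ltry _).
by split => //; rewrite -lee_fin EFin_Int.
Unshelve. all: by end_near. Qed.

End integrals.

(** * Real square-integrable functions *)

Section square_integrable.
Context (R : realType) d (X : measurableType d) (m : probability X R).
Implicit Types (f g h : X -> R) (A : set X).

Lemma sqi_mul f g : sqi m f -> sqi m g -> intg m (fun x => f x * g x).
Proof.
move=> [mf sf] [mg sg]; apply: (@intg_le _ _ _ _ _ (fun x => f x ^+ 2 + g x ^+ 2)).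
- exact: measurable_funM.
- exact: intgD.
- move=> x; rewrite normrM -(real_normK (num_real (f x))).
  rewrite -(real_normK (num_real (g x))).
  move: `|f x| `|g x| (normr_ge0 (f x)) (normr_ge0 (g x)) => a b a0 b0.
  have : 0 <= (a - b) ^+ 2 by exact: sqr_ge0.
  nra.
Qed.

Lemma sqi_bounded f M : measurable_fun setT f -> (forall x, `|f x| <= M) ->
  sqi m f.
Proof.
move=> mf fM; split => //; apply: (@intg_bounded _ _ _ _ _ (M ^+ 2)).
  exact: measurable_funX.
by move=> x; rewrite normrX lerXn2r// nnegrE// (le_trans _ (fM x)).
Qed.

Lemma sqi_cst k : sqi m (fun=> k).
Proof. by apply: (@sqi_bounded _ `|k|). Qed.

Lemma sqi_indic A : measurable A -> sqi m (\1_A).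
Proof.
move=> mA; apply: (@sqi_bounded _ 1); first exact: measurable_fun_indic.
by move=> x; exact: normr_indic_le1.
Qed.

Lemma sqi_intg f : sqi m f -> intg m f.
Proof.
move=> sf; have := sqi_mul sf (sqi_cst 1).
by under eq_fun do rewrite mulr1.
Qed.

Lemma sqiZ k f : sqi m f -> sqi m (fun x => k * f x).
Proof.
move=> [mf sf]; split; first exact: measurable_funM.
by under eq_fun do rewrite exprMn; exact: intgZ.
Qed.

Lemma sqiN f : sqi m f -> sqi m (fun x => - f x).
Proof. by move=> /(sqiZ (-1)); under eq_fun do rewrite mulN1r. Qed.

Lemma sqiD f g : sqi m f -> sqi m g -> sqi m (fun x => f x + g x).
Proof.
move=> sf sg; have [mf if_] := sf; have [mg ig] := sg.
split; first exact: measurable_funD.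
under eq_fun do rewrite sqrrD -mulr_natl.
by apply: intgD => //; apply: intgD => //; apply: intgZ; exact: sqi_mul.
Qed.

Lemma sqiB f g : sqi m f -> sqi m g -> sqi m (fun x => f x - g x).
Proof. by move=> sf sg; exact: sqiD sf (sqiN sg). Qed.

Lemma sqiM_bounded f g M : sqi m f -> measurable_fun setT g ->
  (forall x, `|g x| <= M) -> sqi m (fun x => f x * g x).
Proof.
move=> [mf sf] mg gM; split; first exact: measurable_funM.
under eq_fun do rewrite exprMn.
apply: (@intgM_bounded _ _ _ _ _ _ (M ^+ 2)) => //; first exact: measurable_funX.
by move=> x; rewrite normrX lerXn2r// nnegrE// (le_trans _ (gM x)).
Qed.

Lemma sqiM_indic f A : sqi m f -> measurable A ->
  sqi m (fun x => f x * \1_A x).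
Proof.
move=> sf mA; apply: (@sqiM_bounded _ _ 1 sf); first exact: measurable_fun_indic.
by move=> x; exact: normr_indic_le1.
Qed.

Lemma discriminant_le (a b c : R) : 0 <= c ->
  (forall t, 0 <= a + t * b *+ 2 + t ^+ 2 * c) -> b ^+ 2 <= a * c.
Proof.
move=> c0 q; have [c00|cn0] := eqVneq c 0.
  have [->|b0] := eqVneq b 0; first by rewrite expr0n/= c00 mulr0.
  (* With [c = 0] the polynomial is affine, and at this point its value is -1. *)
  have := q (- (a + 1) / (b *+ 2)).
  rewrite c00 mulr0 addr0 -mulrnAr divfK ?mulrn_eq0// => h.
  by exfalso; move: h; lra.
have cp : 0 < c by rewrite lt_neqAle eq_sym cn0.
have := q (- b / c).
have -> : a + - b / c * b *+ 2 + (- b / c) ^+ 2 * c = (a * c - b ^+ 2) / c.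
  by field.
by rewrite pmulr_lge0 ?invr_gt0// subr_ge0.
Qed.

Lemma Int_CauchySchwarz f g : sqi m f -> sqi m g ->
  Int m (fun x => f x * g x) ^+ 2 <=
  Int m (fun x => f x ^+ 2) * Int m (fun x => g x ^+ 2).
Proof.
move=> sf sg; apply: discriminant_le.
  by apply: Int_ge0 => x; exact: sqr_ge0.
move=> t; have fg := sqi_mul sf sg.
have [_ if_] := sf; have [_ ig] := sg.
rewrite -IntZ// -mulr_natl -IntZ; last exact: intgZ.
rewrite -IntZ// -IntD//; last exact/intgZ/intgZ.
rewrite -IntD//; [|by apply: intgD => //; exact/intgZ/intgZ|exact: intgZ].
apply: Int_ge0 => x; have -> : f x ^+ 2 + 2 * (t * (f x * g x)) + t ^+ 2 * g x ^+ 2 =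
  (f x + t * g x) ^+ 2 by ring.
exact: sqr_ge0.
Qed.

Lemma sqr_Int_le f : sqi m f -> Int m f ^+ 2 <= Int m (fun x => f x ^+ 2).
Proof.
move=> sf; have := Int_CauchySchwarz sf (sqi_cst 1).
under eq_fun do rewrite mulr1.
by under [X in _ * Rintegral _ _ X]eq_fun do rewrite expr1n; rewrite Int_cst mulr1.
Qed.

End square_integrable.

(** * Weak compactness of balls of L2 *)

Lemma ultrafilter_fmap (S T : Type) (u : S -> T) (U : set_system S) :
  UltraFilter U -> UltraFilter (u @ U).
Proof.
move=> UF; split=> [|G GF UG]; first exact: fmap_proper_filter.
apply/seteqP; split=> [A GA|//].
have [//|UnA] := in_ultra_setVsetC (u @^-1` A) UF.
exfalso; apply: (@filter_not_empty _ G _); rewrite -(setICr A).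
by apply: filterI => //; apply: UG.
Qed.

(** Ultrafilters replace the extraction of subsequences: a single [U] makes all bounded real
    families converge simultaneously. *)
Lemma ultrafilter_cvg_real (R : realType) (J : Type) (U : set_system J)
    (UF : UltraFilter U) (u : J -> R) (M : R) :
  (forall i, `|u i| <= M) -> exists l : R, u @ U --> l.
Proof.
move=> uM.
have : compact `[-M, M]%classic by exact: segment_compact.
rewrite compact_ultra => /(_ (u @ U)) h.
have [||l [_ ul]] := h; last by exists l.
- exact: ultrafilter_fmap.
- apply: (@filterS _ U _ setT _ _ filterT) => i _ /=.
  by rewrite in_itv/= -ler_norml; exact: uM.
Qed.

Section weak_limit.
Import HBNNSimple.
Context (R : realType) d (X : measurableType d) (m : probability X R).
Context (J : Type) (U : set_system J) (UF : UltraFilter U).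
Context (g : J -> X -> R) (M : R).
Hypothesis sg : forall i, sqi m (g i).
Hypothesis gM : forall i, Int m (fun x => g i x ^+ 2) <= M.

Let M0 : 0 <= M.
Proof.
have [i _] : exists i : J, True.
  by apply: contrapT => /forallNP h; apply: (@filter_not_empty _ U _);
    apply: (filterS _ filterT) => i _; exact: (h i).
by apply: le_trans (gM i); apply: Int_ge0 => x; exact: sqr_ge0.
Qed.

Let pairing_le i phi : sqi m phi ->
  `|Int m (fun x => g i x * phi x)| ^+ 2 <= M * Int m (fun x => phi x ^+ 2).
Proof.
move=> sphi; rewrite real_normK ?num_real//.
apply: le_trans (Int_CauchySchwarz (sg i) sphi) _.
by apply: ler_wpM2r => //; apply: Int_ge0 => x; exact: sqr_ge0.
Qed.

Let pairing_cvg phi : sqi m phi ->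
  exists l : R, (fun i => Int m (fun x => g i x * phi x)) @ U --> l.
Proof.
move=> sphi; apply: (@ultrafilter_cvg_real _ _ _ _ _ (M * Int m (fun x => phi x ^+ 2) + 1)).
move=> i; have := pairing_le i sphi.
by move: `|_| (normr_ge0 (Int m (fun x => g i x * phi x))) => a a0 h; nra.
Qed.

(** The limit functional, to be represented as integration against a function. Its values on
    indicators form a charge dominated by [m], whose Radon-Nikodym density is the weak limit. *)
Definition weak_pairing (phi : X -> R) : R :=
  lim ((fun i => Int m (fun x => g i x * phi x)) @ U).

Let weak_pairingP phi : sqi m phi ->
  (fun i => Int m (fun x => g i x * phi x)) @ U --> weak_pairing phi.
Proof.
by move=> /pairing_cvg[l hl]; rewrite /weak_pairing (cvg_lim _ hl).
Qed.

Let weak_pairingD phi psi : sqi m phi -> sqi m psi ->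
  weak_pairing (fun x => phi x + psi x) = weak_pairing phi + weak_pairing psi.
Proof.
move=> sphi spsi; rewrite /weak_pairing.
have -> : (fun i => Int m (fun x => g i x * (phi x + psi x))) = (fun i =>
    Int m (fun x => g i x * phi x) + Int m (fun x => g i x * psi x)).
  apply/funext => i; rewrite -IntD; try exact: sqi_mul.
  by congr Rintegral; apply/funext => x; rewrite mulrDr.
apply/cvg_lim => //.
exact: cvgD (weak_pairingP sphi) (weak_pairingP spsi).
Qed.

Let weak_pairingZ k phi : sqi m phi ->
  weak_pairing (fun x => k * phi x) = k * weak_pairing phi.
Proof.
move=> sphi; rewrite /weak_pairing.
have -> : (fun i => Int m (fun x => g i x * (k * phi x))) =
    (fun i => k * Int m (fun x => g i x * phi x)).
  apply/funext => i; rewrite -IntZ; last exact: sqi_mul.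
  by congr Rintegral; apply/funext => x; rewrite mulrCA.
apply/cvg_lim => //.
exact: cvgM (cvg_cst k) (weak_pairingP sphi).
Qed.

Let weak_pairing_le phi : sqi m phi ->
  `|weak_pairing phi| ^+ 2 <= M * Int m (fun x => phi x ^+ 2).
Proof.
move=> sphi; have /cvg_norm h := weak_pairingP sphi.
have h2 := cvgM h h.
rewrite expr2; apply: (cvgr_to_le (h2 _)).
by apply: nearW => i /=; rewrite -expr2 pairing_le.
Qed.

Let lim_charge (A : set X) : \bar R :=
  if pselect (measurable A) then (weak_pairing (\1_A))%:E else 0%E.

Let lim_chargeE A : measurable A -> lim_charge A = (weak_pairing (\1_A))%:E.
Proof. by rewrite /lim_charge; case: pselect. Qed.

Let lim_charge_le A : measurable A ->
  `|weak_pairing (\1_A)| ^+ 2 <= M * fine (m A).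
Proof.
move=> mA; apply: le_trans (weak_pairing_le (sqi_indic m mA)) _.
rewrite -(Int_indic m mA) ler_wpM2l// le_eqVlt; apply/orP; left; apply/eqP.
congr Rintegral; apply/funext => x.
by rewrite indicE; case: (x \in A); rewrite ?expr1n ?expr0n.
Qed.

Let lim_chargeU A B : measurable A -> measurable B -> A `&` B = set0 ->
  weak_pairing (\1_(A `|` B)) = weak_pairing (\1_A) + weak_pairing (\1_B).
Proof.
move=> mA mB AB; rewrite -weak_pairingD; try exact: sqi_indic.
congr weak_pairing; apply/funext => x; rewrite !indicE in_setU.
case: (boolP (x \in A)) => xA; case: (boolP (x \in B)) => xB;
  rewrite /= ?addr0 ?add0r//.
have : (A `&` B) x by split; rewrite -in_setE.
by rewrite AB.
Qed.

Let weak_pairing0 : weak_pairing (\1_set0) = 0.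
Proof.
have := lim_chargeU (@measurable0 _ X) (@measurable0 _ X) (setI0 _).
by rewrite setU0 => /eqP; rewrite -subr_eq0 opprD addrA subrr sub0r oppr_eq0 => /eqP.
Qed.

Let lim_charge0 : lim_charge set0 = 0%E.
Proof. by rewrite lim_chargeE// weak_pairing0. Qed.

Let lim_charge_finite A : measurable A -> lim_charge A \is a fin_num.
Proof. by move=> mA; rewrite lim_chargeE. Qed.

(** Additivity survives the limit along [U] because of a bound uniform in the index: the squared
    charge of a tail of the union is at most [M] times its measure, which tends to 0. *)
Let lim_charge_sigma_additive : semi_sigma_additive lim_charge.
Proof.
move=> F mF tF mUF.
have mV n : measurable (\big[setU/set0]_(k < n) F k) by exact: bigsetU_measurable.
have mW n : measurable ((\bigcup_k F k) `\` \big[setU/set0]_(k < n) F k).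
  exact: measurableD.
have sumE n : (\sum_(0 <= k < n) lim_charge (F k) =
    (weak_pairing (\1_(\big[setU/set0]_(k < n) F k)))%:E)%E.
  elim: n => [|n ih]; first by rewrite big_geq// big_ord0 weak_pairing0.
  rewrite big_nat_recr//= ih lim_chargeE// big_ord_recr/= lim_chargeU//; first exact: mV.
  by rewrite (@trivIset_bigsetUI _ predT)//; exact: sub_trivIset tF.
have splitE n : weak_pairing (\1_(\bigcup_k F k)) =
    weak_pairing (\1_(\big[setU/set0]_(k < n) F k)) +
    weak_pairing (\1_((\bigcup_k F k) `\` \big[setU/set0]_(k < n) F k)).
  rewrite -lim_chargeU; [|exact: mV|exact: mW|by rewrite setDIK].
  by rewrite setDUK//; exact: bigsetU_bigcup.
under eq_fun do rewrite sumE.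
rewrite lim_chargeE//; apply: cvg_EFin; first exact: nearW.
apply/subr_cvg0.
have mlim : (fun n => M * fine (m ((\bigcup_k F k) `\` \big[setU/set0]_(k < n) F k))) @ \oo --> (0 : R).
  rewrite -[X in _ --> X](mulr0 M); apply: cvgM; first exact: cvg_cst.
  have fV A : measurable A -> m A \is a fin_num by move=> ?; exact: fin_num_measure.
  have mWE n : fine (m ((\bigcup_k F k) `\` \big[setU/set0]_(k < n) F k)) =
      fine (m (\bigcup_k F k)) - fine (\sum_(0 <= k < n) m (F k)).
    rewrite -fineB ?fV//; last by apply/sum_fin_numP => i _ _; exact: fV.
    congr fine; rewrite measureD// ?ltey_eq ?fV//.
    rewrite setIidr; last exact: bigsetU_bigcup.
    by rewrite measure_semi_additive_ord_I ?big_mkord//; exact: sub_trivIset tF.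
  have sumlim : (fun n => fine (\sum_(0 <= k < n) m (F k))) @ \oo -->
      fine (m (\bigcup_k F k)).
    apply: fine_cvg; rewrite fineK ?fV//.
    exact: measure_semi_sigma_additive.
  rewrite (funext mWE); have := cvgB (cvg_cst (fine (m (\bigcup_k F k)))) sumlim.
  by rewrite subrr; apply.
apply/cvgr0Pnorm_lt => e e0.
have e20 : 0 < e ^+ 2 by rewrite exprn_gt0.
have := mlim; move/cvgr0Pnorm_lt => /(_ _ e20); apply: filterS => n hn.
rewrite (splitE n) opprD addrA subrr add0r normrN.
rewrite -(@ltr_pXn2r _ 2)// ?nnegrE//; last exact: ltW.
apply: le_lt_trans (lim_charge_le (mW n)) _.
by apply: le_lt_trans hn; exact: ler_norm.
Qed.

HB.instance Definition _ := isCharge.Build _ _ _ lim_charge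
  lim_charge0 lim_charge_finite lim_charge_sigma_additive.

Let lim_charge_dominates : lim_charge `<< m.
Proof.
apply/null_content_dominatesP => A mA mA0; rewrite lim_chargeE//.
have := lim_charge_le mA; rewrite mA0 mulr0 => h.
have : `|weak_pairing (\1_A)| ^+ 2 = 0 by apply/eqP; rewrite eq_le h sqr_ge0.
by move/eqP; rewrite sqrf_eq0 normr_eq0 => /eqP ->.
Qed.

Let density : exists2 gl : X -> R, intg m gl &
  forall A, measurable A -> weak_pairing (\1_A) = Int m (fun x => gl x * \1_A x).
Proof.
pose f := Radon_Nikodym lim_charge m.
have fE x : (fine (f x))%:E = f x by rewrite fineK//; exact: Radon_Nikodym_fin_num.
have EE : EFin \o (fun x => fine (f x)) = f by apply/funext => x /=; rewrite fE.
exists (fun x => fine (f x)).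
  by rewrite /intg EE; exact: Radon_Nikodym_integrable.
move=> A mA; apply: EFin_inj; rewrite -lim_chargeE//.
rewrite EFin_Int; last first.
  by apply: intgM_indic => //; rewrite /intg EE; exact: Radon_Nikodym_integrable.
rewrite (Radon_Nikodym_integral lim_charge_dominates mA) integral_mkcond.
apply: eq_integral => x _; rewrite -/f /patch indicE.
by case: (x \in A); rewrite ?mulr1 ?mulr0//= fE.
Qed.

(** At this stage [gl] is only integrable, so the two sides pass to the limit along simple functions
    for different reasons: the right by dominated convergence, the left by the L2 bound on the
    functional. *)
Let density_bounded (gl : X -> R) : intg m gl ->
  (forall A, measurable A -> weak_pairing (\1_A) = Int m (fun x => gl x * \1_A x)) ->
  forall (phi : X -> R) K, measurable_fun setT phi -> (forall x, 0 <= phi x <= K) ->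
  weak_pairing phi = Int m (fun x => gl x * phi x).
Proof.
move=> igl glE phi K mphi phiK.
pose h n : {nnsfun X >-> R} :=
  nnsfun_approx measurableT ((measurable_EFinP _ _).2 mphi) n.
have phi0 x : setT x -> (0 <= (EFin \o phi) x)%E.
  by move=> _; rewrite lee_fin; case/andP: (phiK x).
have hcvg x : (fun n => h n x) @ \oo --> phi x.
  have := cvg_nnsfun_approx measurableT ((measurable_EFinP _ _).2 mphi) phi0 (x := x) I.
  by move/fine_cvg.
have hle n x : h n x <= phi x.
  have nd : nondecreasing_seq (fun n => h n x).
    by move=> a b ab; exact/lefP/nd_nnsfun_approx.
  have hl : limn (fun n => h n x) = phi x by apply/cvg_lim => //; exact: hcvg.
  by rewrite -hl; apply: nondecreasing_cvgn_le => //; exact: cvgP (hcvg x).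
have mh n : measurable_fun setT (h n) by exact: measurable_funPT.
have hK n x : `|h n x| <= K.
  by rewrite ger0_norm// (le_trans (hle n x))//; case/andP: (phiK x).
have sh n : sqi m (h n) by apply: (@sqi_bounded _ _ _ _ _ K) => // x.
have phiK' x : `|phi x| <= K by case/andP: (phiK x) => p0 pK; rewrite ger0_norm.
have sphi : sqi m phi by apply: (@sqi_bounded _ _ _ _ _ K).
have hE n : weak_pairing (h n) = Int m (fun x => gl x * h n x).
  have mS y : measurable (h n @^-1` [set y]).
    exact: measurable_funPTI.
  have EW (r : seq R) : weak_pairing (fun x => \sum_(y <- r) y * \1_(h n @^-1` [set y]) x)
     = Int m (fun x => gl x * (\sum_(y <- r) y * \1_(h n @^-1` [set y]) x)).
    have sq (r' : seq R) : sqi m (fun x => \sum_(y <- r') y * \1_(h n @^-1` [set y]) x).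
      elim: r' => [|y r' ih].
        by under eq_fun do rewrite big_nil; exact: sqi_cst.
      by under eq_fun do rewrite big_cons; apply: sqiD => //; exact/sqiZ/sqi_indic.
    elim: r => [|y r ih].
      under eq_fun do rewrite big_nil.
      under [X in _ = Rintegral _ _ X]eq_fun do rewrite big_nil mulr0.
      rewrite Int_cst; have -> : (fun=> 0) = \1_set0 :> (X -> R).
        by apply/funext => x; rewrite indic0.
      exact: weak_pairing0.
    under eq_fun do rewrite big_cons.
    rewrite weak_pairingD ?weak_pairingZ//; [|exact: sqi_indic|exact/sqiZ/sqi_indic].
    rewrite glE// ih.
    have bq (r' : seq R) : exists K', forall x,
        `|\sum_(y <- r') y * \1_(h n @^-1` [set y]) x| <= K'.
      elim: r' => [|z r' [K' hK']].
        by exists 0 => x; rewrite big_nil normr0.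
      exists (`|z| + K') => x; rewrite big_cons.
      apply: le_trans (ler_normD _ _) _; apply: lerD => //.
      rewrite indicE normrM; case: (_ \in _); rewrite ?normr1 ?mulr1//.
      by rewrite normr0 mulr0.
    have [K' hK'] := bq r.
    have [mr _] := sq r.
    rewrite -IntZ; last exact: intgM_indic.
    rewrite -IntD; [|apply: intgZ; exact: intgM_indic|exact: intgM_bounded hK'].
    congr Rintegral; apply/funext => x; rewrite big_cons; ring.
  have -> : (h n : X -> R) = (fun x => \sum_(y <- finmap.enum_fset (fset_set (range (h n)))) y * \1_(h n @^-1` [set y]) x).
    by apply/funext => x; rewrite [LHS]fimfunE fsbig_finite.
  exact: EW.
have lim1 : (fun n => Int m (fun x => gl x * h n x)) @ \oo --> Int m (fun x => gl x * phi x).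
  apply: (@dominated_Int _ _ _ _ _ _ (fun x => K * `|gl x|)).
  - by move=> n; apply: measurable_funM => //; exact: intg_measurable igl.
  - by apply: measurable_funM => //; exact: intg_measurable igl.
  - exact/intgZ/intg_norm.
  - by move=> x; apply: cvgM => //; exact: cvg_cst.
  - by move=> n x; rewrite normrM mulrC ler_wpM2r.
have lim2 : (fun n => Int m (fun x => (phi x - h n x) ^+ 2)) @ \oo --> (0 : R).
  rewrite -[X in _ --> X](Int_cst m 0).
  apply: (@dominated_Int _ _ _ _ _ _ (fun x => K ^+ 2)).
  - by move=> n; apply: measurable_funX; exact: measurable_funB.
  - exact: measurable_cst.
  - exact: intg_cst.
  - move=> x; have hx : (fun n => phi x - h n x) @ \oo --> (0 : R).
      by rewrite -(subrr (phi x)); apply: cvgB => //; exact: cvg_cst.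
    by rewrite -[X in _ --> X](mulr0 0); apply: cvgM.
  - move=> n x; rewrite normrX lerXn2r// ?nnegrE//.
      by rewrite (le_trans _ (hK n x)).
    have := hle n x; have := phiK x; have : 0 <= h n x by [].
    by rewrite ler_norml; lra.
have lim3 : (fun n => weak_pairing (h n)) @ \oo --> weak_pairing phi.
  apply/subr_cvg0/cvgr0Pnorm_lt => e e0.
  have e20 : 0 < e ^+ 2 by rewrite exprn_gt0.
  have lim2' : (fun n => M * Int m (fun x => (phi x - h n x) ^+ 2)) @ \oo --> (0 : R).
    by rewrite -[X in _ --> X](mulr0 M); apply: cvgM => //; exact: cvg_cst.
  have := lim2'; move=> /cvgr0Pnorm_lt => /(_ _ e20); apply: filterS => n hn.
  have -> : weak_pairing (h n) - weak_pairing phi =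
      - weak_pairing (fun x => phi x - h n x).
    have -> : (fun x => phi x - h n x) = (fun x => phi x + (-1) * h n x).
      by apply/funext => x; rewrite mulN1r.
    by rewrite weak_pairingD ?weak_pairingZ//; [ring|exact: sqiZ].
  rewrite normrN -(@ltr_pXn2r _ 2)// ?nnegrE//; last exact: ltW.
  apply: le_lt_trans (weak_pairing_le (sqiB sphi (sh n))) _.
  by apply: le_lt_trans hn; exact: ler_norm.
move: lim3; rewrite (funext hE) => lim3.
exact: cvg_unique lim3 lim1.
Qed.

Theorem weak_limit_exists : exists gl : X -> R,
  [/\ sqi m gl, Int m (fun x => gl x ^+ 2) <= M &
   forall (phi : X -> R) K, measurable_fun setT phi -> (forall x, `|phi x| <= K) ->
   (fun i => Int m (fun x => g i x * phi x)) @ U --> Int m (fun x => gl x * phi x)].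
Proof.
have [gl igl glE] := density.
have pE (phi : X -> R) K : measurable_fun setT phi -> (forall x, `|phi x| <= K) ->
    weak_pairing phi = Int m (fun x => gl x * phi x).
  move=> mphi phiK0; wlog K0 : K phiK0 / 0 <= K.
    move=> /(_ `|K|); apply=> // x; exact: le_trans (phiK0 x) (ler_norm _).
  have phiK := phiK0.
  (* The nonnegative case is applied to [phi + K] and to the constant [K], and subtracted. *)
  have mphiK : measurable_fun setT (fun x => phi x + K) by exact: measurable_funD.
  have := density_bounded igl glE (phi := fun x => phi x + K) (K := K + K) mphiK.
  have -> : weak_pairing (fun x => phi x + K) = weak_pairing phi + weak_pairing (fun=> K).
    by apply: weak_pairingD; [exact: sqi_bounded phiK|exact: sqi_cst].
  rewrite (density_bounded igl glE (phi := fun=> K) (K := K))//; last first.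
    by move=> x; rewrite K0 lexx.
  have -> : Int m (fun x => gl x * (phi x + K)) =
      Int m (fun x => gl x * phi x) + Int m (fun x => gl x * K).
    rewrite -IntD; [|exact: intgM_bounded phiK|].
      by congr Rintegral; apply/funext => x; rewrite mulrDr.
    by under eq_fun do rewrite mulrC; exact: intgZ.
  move=> h; apply/(addIr _ (h _)) => x.
  by have := phiK x; rewrite ler_norml; lra.
have mgl := intg_measurable igl.
have [//|||ig2 g2M] := @monotone_truncation_intg _ _ _ m (fun x => gl x ^+ 2) M.
- exact: measurable_funX.
- by move=> x; exact: sqr_ge0.
- move=> k; set S := [set y | _].
  have mS : measurable S.
    exact: (measurable_sublevel _ (measurable_funX 2 mgl)).
  (* Testing against a truncation of [gl] itself: the integral [I] of [phi ^+ 2] equals the pairing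
     with [phi], so [I ^+ 2 <= M * I] and [I <= M]. *)
  pose phi x := gl x * \1_S x.
  have mphi : measurable_fun setT phi.
    by apply: measurable_funM => //; exact: measurable_fun_indic.
  have phiK x : `|phi x| <= k%:R + 1.
    rewrite /phi indicE; case: (boolP (x \in S)); rewrite ?mulr0 ?normr0 ?mulr1// inE /S/=.
    have k0 : (0 : R) <= k%:R by [].
    by rewrite -(real_normK (num_real (gl x))); move: `|gl x| (normr_ge0 (gl x)) => a a0; nra.
  have E : Int m (fun x => phi x ^+ 2) = weak_pairing phi.
    rewrite (pE _ _ mphi phiK); congr Rintegral; apply/funext => x.
    by rewrite /phi indicE; case: (x \in S) => /=; ring.
  have -> : Int m (fun x => gl x ^+ 2 * \1_S x) = weak_pairing phi.
    rewrite -E; congr Rintegral; apply/funext => x.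
    by rewrite /phi indicE; case: (x \in S) => /=; ring.
  have := weak_pairing_le (sqi_bounded m mphi phiK).
  have : 0 <= weak_pairing phi by rewrite -E; apply: Int_ge0 => x; exact: sqr_ge0.
  rewrite E real_normK ?num_real//; move: (weak_pairing phi) M0 => a; nra.
exists gl; split => // phi K mphi phiK; rewrite -(pE _ _ mphi phiK).
exact/weak_pairingP/sqi_bounded.
Qed.

End weak_limit.

(** * Non-singular maps: invariant functions and densities *)

Section nonsingular_transformations.
Context (R : realType) d (X : measurableType d) (m : probability X R).
Implicit Types (T : nst m) (f : X -> R) (A : set X).

Lemma measurable_preimage_fun T A : measurable A -> measurable (T @^-1` A).
Proof. by move=> mA; rewrite -[X in measurable X]setTI; exact: nst_measurable_fun. Qed.

Lemma measurable_preimage_inv T A : measurable A -> measurable (nst_inv T @^-1` A).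
Proof. by move=> mA; rewrite -[X in measurable X]setTI; exact: nst_measurable_inv. Qed.

Lemma nst_imageE T A : T @` A = nst_inv T @^-1` A.
Proof.
apply/seteqP; split => [_ [x Ax <-]|y Ay] /=; first by rewrite nst_funK.
by exists (nst_inv T y) => //; rewrite nst_invK.
Qed.

Lemma measurable_comp_nst T f : measurable_fun setT f ->
  measurable_fun setT (fun x => f (T x)).
Proof. by move=> mf; apply: measurableT_comp => //; exact: nst_measurable_fun. Qed.

Lemma ae_nst T (P : X -> Prop) :
  {ae m, forall x, P x} -> {ae m, forall x, P (T x)}.
Proof.
move=> [A [mA A0 PA]]; exists (T @^-1` A); split.
- exact: measurable_preimage_fun.
- exact/(nst_null T mA).
- by move=> x /= nP; apply: PA.
Qed.

Lemma ae_exists (P : X -> Prop) : {ae m, forall x, P x} -> exists x, P x.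
Proof.
move=> aP; apply: contrapT => /forallNP nP.
have : (m setT <= 0)%E.
  have [A [mA A0 PA]] := aP; rewrite -A0; apply: le_measure; rewrite ?inE//.
  by move=> x _; apply: PA; exact: nP.
by rewrite probability_setT; apply/negP; rewrite -ltNge lte_fin.
Qed.

(** Sublevel sets at rational levels are invariant, so each comparison [f x <= q] has an almost
    everywhere constant truth value; two reals with the same rational upper bounds are equal. *)
Lemma ergodic_ae_constant (G : topologicalZmodType) (T : G -> nst m) f :
  ergodic m (fun g => T g) -> measurable_fun setT f ->
  (forall g, {ae m, forall x, f (T g x) = f x}) ->
  exists c, {ae m, forall x, f x = c}.
Proof.
move=> erg mf inv.
pose B (q : rat) := [set x | f x <= ratr q].
have mB q : measurable (B q) by exact: measurable_sublevel.
have dich q : exists b : bool, {ae m, forall x, (f x <= ratr q) = b}.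
  have BB g : m ((T g @` B q) `+` B q) = 0%E.
    have mBB : measurable ((T g @` B q) `+` B q).
      by rewrite nst_imageE; apply: measurableU;
        apply: measurableD => //; exact: measurable_preimage_inv.
    apply/(nst_null (T g) mBB)/negligibleP; first exact: measurable_preimage_fun.
    apply: negligibleS (inv g); rewrite nst_imageE => x.
    by rewrite /B /= nst_funK => -[[h1 h2]|[h1 h2]] h3; apply: h2; rewrite ?h3// -h3.
  have [B0|B0] := erg _ (mB q) BB.
    exists false; exists (B q); split => // x /= h.
    by rewrite /B/=; apply/negPn/negP => /negbTE.
  by exists true; exists (~` B q); split => //; exact: measurableC.
pose b q := sval (cid (dich q)).
have bE q : {ae m, forall x, (f x <= ratr q) = b q} by exact: svalP (cid (dich q)).
have ab : {ae m, forall x, forall n, if unpickle n is Some q then (f x <= ratr q) = b q else True}.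
  apply: ae_foralln => n; case: (unpickle n) => [q|]; first exact: bE.
  exact: aeW.
have [x0 hx0] := ae_exists ab.
exists (f x0); move: ab; apply: filterS => x hx.
have H q : (f x <= ratr q) = (f x0 <= ratr q).
  by have := hx (pickle q); have := hx0 (pickle q); rewrite pickleK => -> ->.
apply/eqP; rewrite eq_le; apply/andP; split; rewrite leNgt; apply/negP => lt.
  have [q] := rat_in_itvoo lt; rewrite in_itv/= => /andP[q1 q2].
  by have := H q; rewrite (ltW q1) leNgt q2.
have [q] := rat_in_itvoo lt; rewrite in_itv/= => /andP[q1 q2].
by have := H q; rewrite (ltW q1) leNgt q2.
Qed.

(** [rho] is the density of the image of [m] under [T], a measure of preimages, unlike
    [comp_measure T]. Non-singularity gives absolute continuity but no bound, so [f \o T] may fail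
    to be integrable; cutting off to a set [A] where [rho] is bounded repairs this. *)
Lemma nst_density T : exists2 rho : X -> R, measurable_fun setT rho &
  forall f A (K : R), intg m f -> measurable A -> (forall x, A x -> `|rho x| <= K) ->
  intg m (fun x => f (T x) * \1_A (T x)) /\
  Int m (fun x => f (T x) * \1_A (T x)) = Int m (fun x => f x * (rho x * \1_A x)).
Proof.
pose mTm := isMeasurableFun.Build _ _ _ _ _ (nst_measurable_fun T).
pose Tm : {mfun X >-> X} := HB.pack (nst_fun T) mTm.
pose P := distribution m Tm.
have Pm : P `<< m.
  by apply/null_content_dominatesP => A mA /(nst_null T mA).
pose r0 := Radon_Nikodym_SigmaFinite.f P m.
have r0E x : (fine (r0 x))%:E = r0 x.
  by rewrite fineK//; exact: Radon_Nikodym_SigmaFinite.f_fin_num.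
pose rho x := fine (r0 x).
have mrho : measurable_fun setT rho.
  apply: intg_measurable; rewrite /intg.
  have -> : EFin \o rho = r0 by apply/funext => x; exact: r0E.
  exact: Radon_Nikodym_SigmaFinite.f_integrable.
have rho0 x : 0 <= rho x.
  by rewrite -lee_fin r0E; exact: Radon_Nikodym_SigmaFinite.f_ge0.
exists rho => //.
have pos f A (K : R) : (forall x, 0 <= f x) -> intg m f -> measurable A ->
    (forall x, A x -> `|rho x| <= K) ->
    intg m (fun x => f (T x) * \1_A (T x)) /\
    Int m (fun x => f (T x) * \1_A (T x)) = Int m (fun x => f x * (rho x * \1_A x)).
  move=> f0 If mA AK.
  have mf := intg_measurable If.
  have mfA : measurable_fun setT (fun x => f x * \1_A x).
    by apply: measurable_funM => //; exact: measurable_fun_indic.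
  have fA0 x : 0 <= f x * \1_A x by rewrite mulr_ge0.
  have E : (\int[m]_x (f (T x) * \1_A (T x))%:E = \int[m]_x (f x * (rho x * \1_A x))%:E)%E.
    rewrite -[LHS](@ge0_integral_pushforward _ _ _ _ _ Tm (measurable_funPT Tm) m setT
      (fun x => (f x * \1_A x)%:E)); [|exact: measurableT|exact/measurable_EFinP|
      by move=> y _; rewrite lee_fin].
    rewrite -(@Radon_Nikodym_SigmaFinite.change_of_variables _ _ _ P m Pm)//.
      by apply: eq_integral => x _; rewrite -/r0 -r0E -EFinM; congr EFin; rewrite -/(rho x); ring.
    exact/measurable_EFinP.
  have irho : intg m (fun x => f x * (rho x * \1_A x)).
    (* Over an empty [A] the bound [K] says nothing and may be negative. *)
    have [A0|/set0P[x1 Ax1]] := eqVneq A set0.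
      have -> : (fun x => f x * (rho x * \1_A x)) = fun=> 0.
        by apply/funext => x; rewrite A0 indicE in_set0 !mulr0.
      exact: intg_cst.
    apply: (@intgM_bounded _ _ _ _ _ _ K) => //.
      by apply: measurable_funM => //; exact: measurable_fun_indic.
    move=> x; rewrite indicE; case: (boolP (x \in A)) => [|_].
      by rewrite inE mulr1 => /AK.
    by rewrite mulr0 normr0 (le_trans _ (AK _ Ax1)).
  split; last by rewrite /Rintegral E.
  apply/integrableP; split.
    by apply/measurable_EFinP; exact: (measurable_comp_nst T mfA).
  under eq_integral do rewrite /= ger0_norm//.
  by rewrite E -EFin_Int// ltry.
move=> f A K If mA AK.
(* The general case writes [f] as [|f|] minus the nonnegative function [|f| - f]. *)
have [i1 E1] := pos (fun x => `|f x|) A K (fun x => normr_ge0 _) (intg_norm If) mA AK.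
have h0 x : 0 <= `|f x| - f x by rewrite subr_ge0 ler_norm.
have [i2 E2] := pos (fun x => `|f x| - f x) A K h0 (intgB (intg_norm If) If) mA AK.
have fE : (fun x => f (T x) * \1_A (T x)) = (fun x => `|f (T x)| * \1_A (T x) -
    (`|f (T x)| - f (T x)) * \1_A (T x)) by apply/funext => x; ring.
have bd f' : intg m f' -> intg m (fun x => f' x * (rho x * \1_A x)).
  move=> If'; have [A0|/set0P[x1 Ax1]] := eqVneq A set0.
    have -> : (fun x => f' x * (rho x * \1_A x)) = fun=> 0.
      by apply/funext => x; rewrite A0 indicE in_set0 !mulr0.
    exact: intg_cst.
  apply: (@intgM_bounded _ _ _ _ _ _ K) => //.
    by apply: measurable_funM => //; exact: measurable_fun_indic.
  move=> x; rewrite indicE; case: (boolP (x \in A)) => [|_].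
    by rewrite inE mulr1 => /AK.
  by rewrite mulr0 normr0 (le_trans _ (AK _ Ax1)).
split; first by rewrite fE; exact: intgB.
rewrite fE IntB// E1 E2 -IntB; [|exact/bd/intg_norm|exact/bd/intgB/If/intg_norm].
by congr Rintegral; apply/funext => x; ring.
Qed.

End nonsingular_transformations.

(** * Transformation laws pass to weak limits *)

Section weak_limit_equivariance.
Context (R : realType) d (X : measurableType d) (m : probability X R).
Context (J : Type) (U : set_system J) (UF : ProperFilter U).

Definition weak_cvg (a : J -> X -> R) (al : X -> R) :=
  forall (phi : X -> R) K, measurable_fun setT phi -> (forall x, `|phi x| <= K) ->
  (fun i => Int m (fun x => a i x * phi x)) @ U --> Int m (fun x => al x * phi x).

(** The relation is tested over preimages under [T] of sets [A] on which [rho] is bounded. The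
    change of variables turns the left side into the pairing of [a i] with the bounded function
    [rho * \1_A], so every term converges weakly. The two functions [a] and [b] are meant as real
    and imaginary parts, mixed by a complex multiplier. *)
Lemma weak_limit_equivariant (T : nst m) (a b r : J -> X -> R) (al bl : X -> R) (p q : R) :
  (forall i, sqi m (a i)) -> (forall i, sqi m (b i)) -> (forall i, sqi m (r i)) ->
  sqi m al -> sqi m bl -> weak_cvg a al -> weak_cvg b bl ->
  (forall i, {ae m, forall x, a i (T x) = p * a i x + q * b i x + r i x}) ->
  (fun i => Int m (fun x => r i x ^+ 2)) @ U --> (0 : R) ->
  {ae m, forall x, al (T x) = p * al x + q * bl x}.
Proof.
move=> sa sb sr sal sbl aal bbl eqv r0.
have [rho mrho rhoE] := nst_density T.
pose S (k : nat) := [set x | `|rho x| <= k%:R].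
have mS k : measurable (S k).
  by apply: measurable_sublevel; exact: measurableT_comp.
have mal : measurable_fun setT al by case: sal.
have mbl : measurable_fun setT bl by case: sbl.
pose dd x := al (T x) - (p * al x + q * bl x).
have mdd : measurable_fun setT dd.
  apply: measurable_funB; first exact: measurable_comp_nst.
  by apply: measurable_funD; exact: measurable_funM.
have main A k : measurable A -> A `<=` S k ->
    intg m (fun x => dd x * \1_A (T x)) /\ Int m (fun x => dd x * \1_A (T x)) = 0.
  move=> mA AS.
  have rA x : A x -> `|rho x| <= k%:R by move=> /AS.
  have mTA : measurable (T @^-1` A) by exact: measurable_preimage_fun.
  have TAE x : \1_A (T x) = \1_(T @^-1` A) x :> R by rewrite !indicE.
  have [ial Eal] := rhoE al A k%:R (sqi_intg sal) mA rA.
  have icomb : intg m (fun x => (p * al x + q * bl x) * \1_(T @^-1` A) x).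
    by apply: intgM_indic => //; apply: intgD; apply: intgZ; exact: sqi_intg.
  have ddE : (fun x => dd x * \1_A (T x)) =
      (fun x => al (T x) * \1_A (T x) - (p * al x + q * bl x) * \1_(T @^-1` A) x).
    by apply/funext => x; rewrite /dd mulrBl TAE.
  split; first by rewrite ddE; exact: intgB.
  rewrite ddE IntB//; apply/eqP; rewrite subr_eq0; apply/eqP.
  have m1 : measurable_fun setT (fun x => rho x * \1_A x).
    by apply: measurable_funM => //; exact: measurable_fun_indic.
  have b1 x : `|rho x * \1_A x| <= k%:R.
    rewrite indicE; case: (boolP (x \in A)) => [|_]; last by rewrite mulr0 normr0.
    by rewrite inE mulr1 => /rA.
  have b2 x : `|\1_(T @^-1` A) x| <= 1 :> R by exact: normr_indic_le1.
  have mi := @measurable_fun_indic R _ _ _ mTA.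
  have l1 := aal _ _ m1 b1.
  have l2 := aal _ _ mi b2.
  have l3 := bbl _ _ mi b2.
  have l4 : (fun i => Int m (fun x => r i x * \1_(T @^-1` A) x)) @ U --> (0 : R).
    apply/cvgr0Pnorm_lt => e e0.
    have e20 : 0 < e ^+ 2 by rewrite exprn_gt0.
    have := r0; move=> /cvgr0Pnorm_lt => /(_ _ e20); apply: filterS => i hi.
    rewrite -(@ltr_pXn2r _ 2)// ?nnegrE//; last exact: ltW.
    rewrite real_normK ?num_real//.
    apply: le_lt_trans (sqr_Int_le (sqiM_indic (sr i) mTA)) _.
    apply: le_lt_trans hi; apply: le_trans (ler_norm _); apply: le_Int.
    - by case: (sqiM_indic (sr i) mTA).
    - by case: (sr i).
    - move=> x; rewrite indicE; case: (_ \in _); rewrite ?mulr1//.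
      by rewrite mulr0 expr0n sqr_ge0.
  have eqi i : Int m (fun x => a i x * (rho x * \1_A x)) =
      p * Int m (fun x => a i x * \1_(T @^-1` A) x) +
      q * Int m (fun x => b i x * \1_(T @^-1` A) x) +
      Int m (fun x => r i x * \1_(T @^-1` A) x).
    have [ia Ea] := rhoE (a i) A k%:R (sqi_intg (sa i)) mA rA.
    have ia' := intgM_indic (sqi_intg (sa i)) mTA.
    have ib' := intgM_indic (sqi_intg (sb i)) mTA.
    have ir' := intgM_indic (sqi_intg (sr i)) mTA.
    have iab := intgD (intgZ p ia') (intgZ q ib').
    have iabr := intgD iab ir'.
    rewrite -Ea -IntZ// -IntZ// -IntD; [|exact: intgZ|exact: intgZ].
    rewrite -IntD//.
    apply: Int_ae.
    - exact: intg_measurable ia.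
    - exact: intg_measurable iabr.
    - by move: (eqv i); apply: filterS => x ->; rewrite TAE; ring.
  rewrite Eal.
  have -> : Int m (fun x => (p * al x + q * bl x) * \1_(T @^-1` A) x) =
     p * Int m (fun x => al x * \1_(T @^-1` A) x) +
     q * Int m (fun x => bl x * \1_(T @^-1` A) x) + 0.
    have ia' := intgM_indic (sqi_intg sal) mTA.
    have ib' := intgM_indic (sqi_intg sbl) mTA.
    rewrite -IntZ// -IntZ// addr0 -IntD; [|exact: intgZ|exact: intgZ].
    by congr Rintegral; apply/funext => x; ring.
  move: l1; rewrite (funext eqi) => l1.
  apply: (cvg_unique _ l1); first exact: norm_hausdorff.
  apply: cvgD => //; apply: cvgD; apply: cvgM => //; exact: cvg_cst.
have step k : {ae m, forall x, dd x * \1_(S k) (T x) = 0}.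
  have [id0 _] := main (S k) k (mS k) (fun x h => h).
  apply: (Int_eq0_sets id0) => B mB.
  have mB' : measurable (S k `&` nst_inv T @^-1` B).
    by apply: measurableI => //; exact: measurable_preimage_inv.
  have [_ <-] := main _ k mB' (@subIsetl _ _ _).
  congr Rintegral; apply/funext => x; rewrite -mulrA; congr (_ * _).
  rewrite indicI /=; congr (_ * _); rewrite !indicE; congr (_%:R); congr nat_of_bool.
  by apply/idP/idP; rewrite !inE /= nst_funK.
have := ae_foralln step; apply: filterS => x hx.
have := hx (Num.trunc `|rho (T x)|).+1.
rewrite indicE mem_set ?mulr1; last first.
  by rewrite /S/=; exact/ltW/truncnS_gt.
by move/eqP; rewrite subr_eq0 => /eqP.
Qed.

End weak_limit_equivariance.

(** * Complex L2 functions through a real bilinear form *)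

Section complex_square_integrable.
Context (R : realType) d (X : measurableType d) (m : probability X R).
Implicit Types (f h k : X -> R[i]^o) (c z : R[i]).

(** The squared modulus as an element of [R]; the norm of [R[i]] has its values in [R[i]]. *)
Definition csq (z : R[i]) : R := complex.Re z ^+ 2 + complex.Im z ^+ 2.

Lemma csq_ge0 z : 0 <= csq z.
Proof. by rewrite addr_ge0// sqr_ge0. Qed.

Lemma csq_eq0 z : csq z = 0 -> z = 0.
Proof.
case: z => a b; rewrite /csq/= => /eqP.
by rewrite paddr_eq0 ?sqr_ge0// !sqrf_eq0 => /andP[/eqP -> /eqP ->].
Qed.

Lemma csqM z z' : csq (z * z') = csq z * csq z'.
Proof. by case: z z' => a b [a' b']; rewrite /csq /=; ring. Qed.

Lemma csq_conj z : csq z^*%C = csq z.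
Proof. by case: z => a b; rewrite /csq/= sqrrN. Qed.


Lemma csq_norm1 z : `|z| = 1 -> csq z = 1.
Proof.
move=> h; have : `|z| ^+ 2 = 1 by rewrite h expr1n.
rewrite normCK => /(congr1 (@complex.Re R)).
by case: z {h} => a b; rewrite /csq /= mulrN opprK -!expr2.
Qed.

Lemma Re_sum (I : Type) (s : seq I) (F : I -> R[i]) :
  complex.Re (\sum_(i <- s) F i) = \sum_(i <- s) complex.Re (F i).
Proof. exact: raddf_sum. Qed.

Lemma Im_sum (I : Type) (s : seq I) (F : I -> R[i]) :
  complex.Im (\sum_(i <- s) F i) = \sum_(i <- s) complex.Im (F i).
Proof. exact: raddf_sum. Qed.

Lemma ReD z z' : complex.Re (z + z') = complex.Re z + complex.Re z'.
Proof. exact: raddfD. Qed.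

Lemma ImD z z' : complex.Im (z + z') = complex.Im z + complex.Im z'.
Proof. exact: raddfD. Qed.

Lemma ReM z z' : complex.Re (z * z') =
  complex.Re z * complex.Re z' - complex.Im z * complex.Im z'.
Proof. by case: z z' => a b [a' b']. Qed.

Lemma ImM z z' : complex.Im (z * z') =
  complex.Re z * complex.Im z' + complex.Im z * complex.Re z'.
Proof. by case: z z' => a b [a' b']. Qed.

Lemma ReMo (z z' : R[i]^o) : complex.Re (z * z') =
  complex.Re z * complex.Re z' - complex.Im z * complex.Im z'.
Proof. exact: ReM. Qed.

Lemma ImMo (z z' : R[i]^o) : complex.Im (z * z') =
  complex.Re z * complex.Im z' + complex.Im z * complex.Re z'.
Proof. exact: ImM. Qed.

Lemma L2P f : L2 m f <->
  sqi m (fun x => complex.Re (f x)) /\ sqi m (fun x => complex.Im (f x)).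
Proof.
split=> [[mr mi fin]|[[mr ir] [mi ii]]]; last first.
  split=> //; apply: (@integrable_lty _ _ _ m setT measurableT).
  exact: (intgD ir ii).
have ms : measurable_fun setT (fun x => complex.Re (f x) ^+ 2 + complex.Im (f x) ^+ 2).
  by apply: measurable_funD; exact: measurable_funX.
have is_ : intg m (fun x => complex.Re (f x) ^+ 2 + complex.Im (f x) ^+ 2).
  apply/integrableP; split; first exact/measurable_EFinP.
  by under eq_integral do rewrite /= ger0_norm ?csq_ge0//.
split; split => //; (apply: intg_le is_ _; first exact: measurable_funX);
  by move=> x; rewrite ger0_norm ?sqr_ge0// ?lerDl ?lerDr sqr_ge0.
Qed.

Lemma L2Re f : L2 m f -> sqi m (fun x => complex.Re (f x)).
Proof. by case/L2P. Qed.

Lemma L2Im f : L2 m f -> sqi m (fun x => complex.Im (f x)).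
Proof. by case/L2P. Qed.

Lemma L2D f h : L2 m f -> L2 m h -> L2 m (fun x => f x + h x).
Proof.
move=> /L2P[fr fi] /L2P[hr hi]; apply/L2P; split.
  by under eq_fun do rewrite raddfD/=; exact: sqiD.
by under eq_fun do rewrite raddfD/=; exact: sqiD.
Qed.

Lemma L2Z c f : L2 m f -> L2 m (fun x => c * f x).
Proof.
move=> /L2P[fr fi]; apply/L2P; split.
  by under eq_fun do rewrite ReM; apply: sqiB; exact: sqiZ.
by under eq_fun do rewrite ImM; apply: sqiD; exact: sqiZ.
Qed.

Lemma L2B f h : L2 m f -> L2 m h -> L2 m (fun x => f x - h x).
Proof.
move=> Lf /(L2Z (-1)) Lh; have := L2D Lf Lh.
by under eq_fun do rewrite mulN1r.
Qed.

Lemma L2_cst c : L2 m (fun=> c).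
Proof. by apply/L2P; split; exact: sqi_cst. Qed.

Lemma L2_sum (I : Type) (s : seq I) (F : I -> X -> R[i]^o) :
  (forall i, L2 m (F i)) -> L2 m (fun x => \sum_(i <- s) F i x).
Proof.
move=> LF; elim: s => [|i s ih].
  by under eq_fun do rewrite big_nil; exact: L2_cst.
by under eq_fun do rewrite big_cons; exact: L2D.
Qed.

(** The real part of [inner]. The imaginary part is the same form with the second argument
    multiplied by ['i], so all estimates can be made with a symmetric real form. *)
Definition ip f h : R :=
  Int m (fun x => complex.Re (f x) * complex.Re (h x) +
                  complex.Im (f x) * complex.Im (h x)).

Definition nsq f : R := ip f f.

Lemma intg_ip f h : L2 m f -> L2 m h ->
  intg m (fun x => complex.Re (f x) * complex.Re (h x) +
                   complex.Im (f x) * complex.Im (h x)).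
Proof.
by move=> /L2P[fr fi] /L2P[hr hi]; apply: intgD; exact: sqi_mul.
Qed.

Lemma inner_ip f h : inner m f h = (ip f h +i* ip f (fun x => 'i%C * h x))%C.
Proof.
rewrite /inner /Cintegral /ip; congr (_ +i* _)%C; congr fine;
  apply: eq_integral => x _; congr EFin;
  by case: (f x) (h x) => a b [a' b']; rewrite /=; ring.
Qed.

Lemma nsqE f : nsq f = Int m (fun x => csq (f x)).
Proof. by congr Rintegral; apply/funext => x; rewrite -!expr2. Qed.

Lemma nsq_ge0 f : 0 <= nsq f.
Proof. by rewrite nsqE; apply: Int_ge0 => x; exact: csq_ge0. Qed.

Lemma ipC f h : ip f h = ip h f.
Proof. by congr Rintegral; apply/funext => x; rewrite mulrC [in X in _ + X]mulrC. Qed.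

Lemma ipDl f h k : L2 m f -> L2 m h -> L2 m k ->
  ip (fun x => f x + h x) k = ip f k + ip h k.
Proof.
move=> Lf Lh Lk; rewrite /ip -IntD; try exact: intg_ip.
by congr Rintegral; apply/funext => x; rewrite !raddfD/=; ring.
Qed.

Lemma ipDr f h k : L2 m f -> L2 m h -> L2 m k ->
  ip k (fun x => f x + h x) = ip k f + ip k h.
Proof. by move=> Lf Lh Lk; rewrite ipC ipDl// ![ip _ k]ipC. Qed.

Lemma ipZl c f h : L2 m f -> L2 m h ->
  ip (fun x => c * f x) h =
  complex.Re c * ip f h + complex.Im c * ip (fun x => 'i%C * f x) h.
Proof.
move=> Lf Lh; have Lif := L2Z 'i%C Lf.
rewrite /ip -IntZ; last exact: intg_ip.
rewrite -IntZ; last exact: intg_ip.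
rewrite -IntD; [|exact/intgZ/intg_ip|exact/intgZ/intg_ip].
by congr Rintegral; apply/funext => x; rewrite !ReM !ImM /=; ring.
Qed.

Lemma ipZl_conj c f h : ip (fun x => c * f x) h = ip f (fun x => c^*%C * h x).
Proof.
congr Rintegral; apply/funext => x; case: c (f x) (h x) => a b [a1 b1] [a2 b2] /=; ring.
Qed.

Lemma ipZZ c f h : L2 m f -> L2 m h ->
  ip (fun x => c * f x) (fun x => c * h x) = csq c * ip f h.
Proof.
move=> Lf Lh; rewrite /ip -IntZ; last exact: intg_ip.
congr Rintegral; apply/funext => x.
by case: c (f x) (h x) => a b [a1 b1] [a2 b2]; rewrite /csq/=; ring.
Qed.

Lemma nsqZ c f : L2 m f -> nsq (fun x => c * f x) = csq c * nsq f.
Proof. by move=> Lf; exact: ipZZ. Qed.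

Lemma ipBl f h k : L2 m f -> L2 m h -> L2 m k ->
  ip (fun x => f x - h x) k = ip f k - ip h k.
Proof.
move=> Lf Lh Lk; rewrite /ip -IntB; try exact: intg_ip.
by congr Rintegral; apply/funext => x; rewrite !raddfB/=; ring.
Qed.

Lemma nsqD f h : L2 m f -> L2 m h ->
  nsq (fun x => f x + h x) = nsq f + nsq h + ip f h *+ 2.
Proof.
move=> Lf Lh; rewrite /nsq ipDl ?ipDr//; try exact: L2D.
by rewrite (ipC h f) mulr2n; ring.
Qed.

Lemma ip_CauchySchwarz f h : L2 m f -> L2 m h -> ip f h ^+ 2 <= nsq f * nsq h.
Proof.
move=> Lf Lh; apply: discriminant_le; first exact: nsq_ge0.
move=> t; have := nsq_ge0 (fun x => f x + t%:C%C * h x).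
have Lth := L2Z t%:C%C Lh.
rewrite nsqD// nsqZ// ipC ipZl// ipC /csq/= expr0n/= addr0 mul0r addr0.
by rewrite (_ : _ + _ = nsq f + t * ip f h *+ 2 + t ^+ 2 * nsq h)//; ring.
Qed.

Lemma L2_measurable f : L2 m f -> measurable_fun setT (fun x => complex.Re (f x) : R) /\
  measurable_fun setT (fun x => complex.Im (f x) : R).
Proof. by case. Qed.

Lemma ip_ae f f' h h' : L2 m f -> L2 m f' -> L2 m h -> L2 m h' ->
  {ae m, forall x, f x = f' x} -> {ae m, forall x, h x = h' x} ->
  ip f h = ip f' h'.
Proof.
move=> Lf Lf' Lh Lh' ff hh; apply: Int_ae.
- exact: intg_measurable (intg_ip Lf Lh).
- exact: intg_measurable (intg_ip Lf' Lh').
- by move: ff hh; apply: filterS2 => x -> ->.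
Qed.

Lemma nsq_eq0 f : L2 m f -> nsq f = 0 -> {ae m, forall x, f x = 0}.
Proof.
move=> Lf; rewrite nsqE => f0.
have := @Int_eq0 _ _ _ m (fun x => csq (f x)) (intg_ip Lf Lf) (fun x => csq_ge0 _) f0.
by apply: filterS => x /csq_eq0.
Qed.

Lemma nsq_sum_orthogonal (I : Type) (s : seq I) (F : I -> X -> R[i]^o)
    (P : rel I) : (forall i, L2 m (F i)) ->
  pairwise P s -> (forall i j, P i j -> ip (F i) (F j) = 0) ->
  nsq (fun x => \sum_(i <- s) F i x) = \sum_(i <- s) nsq (F i).
Proof.
move=> LF + orth; elim: s => [|i s ih] /=.
  move=> _; rewrite big_nil nsqE; under eq_fun do rewrite big_nil.
  by rewrite /csq/= expr0n/= addr0 Int_cst.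
move=> /andP[ai ps]; rewrite big_cons; under eq_fun do rewrite big_cons.
rewrite nsqD//; last exact: L2_sum.
rewrite ih//; suff -> : ip (F i) (fun x => \sum_(j <- s) F j x) = 0 by rewrite mul0rn addr0.
elim: s ai {ps ih} => [|j s ih] /=.
  move=> _; under eq_fun do rewrite big_nil.
  rewrite /ip/=; under eq_fun do rewrite !mulr0 addr0.
  exact: Int_cst.
move=> /andP[ij js]; under eq_fun do rewrite big_cons.
by rewrite ipDr ?ih ?orth ?addr0//; exact: L2_sum.
Qed.

End complex_square_integrable.

(** * Countable families of sets that determine a function *)

Section determining_classes.
Context (R : realType) d (X : measurableType d).

(** The sets over which [f] integrates to 0 form a Dynkin class; [G setT] gives the vanishing total
    integral that complements require. *)
Lemma Int_eq0_pi (m : probability X R) (G : set (set X)) (f : X -> R) :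
  @measurable d X = <<s G >> -> setI_closed G -> G setT -> intg m f ->
  (forall A, G A -> Int m (fun x => f x * \1_A x) = 0) ->
  {ae m, forall x, f x = 0}.
Proof.
move=> GE GI GT If f0.
have mG A : G A -> measurable A by move=> GA; rewrite GE; exact: sub_sigma_algebra.
have fT : Int m f = 0.
  rewrite -(f0 _ GT); congr Rintegral; apply/funext => x.
  by rewrite indicE mem_set// mulr1.
apply: (Int_eq0_sets If) => A; rewrite GE.
apply: (@dynkin_induction d X G (fun A => Int m (fun x => f x * \1_A x) = 0)) => //.
- exact: f0.
- move=> S mS S0.
  transitivity (Int m f - Int m (fun x => f x * \1_S x)); last by rewrite fT S0 subr0.
  rewrite -IntB//; last exact: intgM_indic.
  congr Rintegral; apply/funext => x; rewrite !indicE in_setC.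
  by case: (x \in S) => /=; ring.
- move=> F mF tF F0; have := Int_bigcup_cvg If mF tF.
  rewrite (_ : (fun n => _) = cst 0); last by apply/funext => n; exact: big1.
  by move/(cvg_unique (@norm_hausdorff _ _)) => /(_ _ (cvg_cst 0)).
Qed.

(** Countability is the point: the sequence will index the decomposition of the eigenvalue set into
    closed pieces. *)
Definition separating_sequence (m : probability X R) (C : nat -> set X) : Prop :=
  (forall n, measurable (C n)) /\
  forall f, intg m f -> (forall n, Int m (fun x => f x * \1_(C n) x) = 0) ->
    {ae m, forall x, f x = 0}.

(** Balls of rational radius around a countable dense set generate the sigma-algebra, and their
    finite intersections form a countable class closed under intersection. *)
Lemma standard_borel_separating (m : probability X R) : standard_borel R X ->
  exists C, separating_sequence m C.
Proof.
move=> [dist [[dist0 distE] dist_sym dist_tri _ [D cD Ddense]] mE].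
have [f finj] := countable_injP _ cD.
(* The ball of radius [kq.2] about the point of [D] numbered [kq.1] by [f]; empty if there is no
   such point. *)
pose B (kq : nat * rat) : set X :=
  [set y | exists2 x, D x & f x = kq.1 /\ dist x y < ratr kq.2].
have oB kq : metric_open dist (B kq).
  move=> y [x Dx [fx xy]]; exists (ratr kq.2 - dist x y); first by rewrite subr_gt0.
  move=> z /= yz; exists x => //; split => //.
  by have := dist_tri x y z; lra.
pose gen n : set X := if unpickle n is Some kq then B kq else set0.
have og n : metric_open dist (gen n).
  by rewrite /gen; case: (unpickle n) => [kq|//]; exact: oB.
have genE : @measurable d X = <<s range gen >>.
  rewrite mE; apply/seteqP; split.
    apply: smallest_sub; first exact: smallest_sigma_algebra.
    move=> O oO.
    have -> : O = \bigcup_n (if pselect (gen n `<=` O) then gen n else set0).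
      apply/seteqP; split => [y Oy|y [n _]]; last by case: pselect => // h /h.
      have [e e0 eO] := oO _ Oy.
      have e20 : 0 < e / 2 by rewrite divr_gt0.
      (* With [q < e / 2], the ball of radius [q] about a point of [D] closer than [q] to [y]
         contains [y] and has all its points at distance less than [e] from [y]. *)
      have [q] := rat_in_itvoo e20; rewrite in_itv/= => /andP[q0 qe].
      have [x Dx yx] := Ddense y _ q0.
      have Bp : B (f x, q) y by exists x => //; split => //; rewrite dist_sym.
      have BO : B (f x, q) `<=` O.
        move=> z [x' Dx' [/= fx' xz]].
        have xx' : x' = x by apply: finj; rewrite ?inE.
        apply: eO; rewrite /= in xz *; rewrite xx' in xz.
        by have := dist_tri y x z; lra.
      exists (pickle (f x, q)) => //.
      by rewrite /gen pickleK; case: pselect.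
    apply: sigma_algebra_bigcup => n; case: (pselect (gen n `<=` O)) => h /=; last exact: sigma_algebra0.
    by apply: sub_sigma_algebra; exists n.
  apply: smallest_sub; first exact: smallest_sigma_algebra.
  by move=> _ [n _ <-]; apply: sub_sigma_algebra; exact: og.
pose C n : set X := if unpickle n is Some s then \big[setI/setT]_(k <- (s : seq nat)) gen k else setT.
have mgen n : measurable (gen n) by rewrite genE; apply: sub_sigma_algebra; exists n.
have mC n : measurable (C n).
  rewrite /C; case: (unpickle n) => [s|//].
  by elim: s => [|k s ih]; rewrite ?big_nil ?big_cons//; exact: measurableI.
exists C; split => // h ih h0.
apply: (@Int_eq0_pi m (range C)) => //.
- apply/seteqP; split.
    rewrite genE; apply: smallest_sub; first exact: smallest_sigma_algebra.
    move=> _ [n _ <-]; apply: sub_sigma_algebra.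
    exists (pickle [:: n]) => //; rewrite /C pickleK.
    by rewrite big_seq1.
  apply: smallest_sub; first exact: sigma_algebra_measurable.
  by move=> _ [n _ <-].
- move=> _ _ [n _ <-] [k _ <-].
  rewrite /C; case: (unpickle n) (unpickle k) => [s|] [t|].
  - by exists (pickle (s ++ t)) => //; rewrite pickleK big_cat.
  - by exists (pickle s) => //; rewrite pickleK setIT.
  - by exists (pickle t) => //; rewrite pickleK setTI.
  - by exists (pickle ([::] : seq nat)) => //; rewrite pickleK setTI big_nil.
- by exists (pickle ([::] : seq nat)) => //; rewrite /C pickleK big_nil.
- by move=> _ [n _ <-].
Qed.

End determining_classes.

(** * Complex limits, characters and their evaluations *)

Lemma cvg_csq (R : realType) (J : Type) (F : set_system J) (FF : Filter F)
    (u : J -> R[i]^o) (z : R[i]^o) :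
  u @ F --> z -> forall e : R, 0 < e -> \forall i \near F, csq (u i - z) < e.
Proof.
move=> uz e e0.
have s0 : (0 : R[i]) < (Num.sqrt e)%:C%C by rewrite ltcR sqrtr_gt0.
move/cvgrPdist_lt : uz => /(_ _ s0); apply: filterS => i /=.
rewrite distrC => h; rewrite -ltcR.
have -> : (csq (u i - z))%:C%C = `|u i - z| ^+ 2 :> R[i].
  by rewrite normCK; case: (u i - z) => a b; rewrite /csq; simpc; congr (_ +i* _)%C; ring.
have -> : e%:C%C = (Num.sqrt e)%:C%C ^+ 2 :> R[i].
  by rewrite -rmorphXn/= sqr_sqrtr// ltW.
by rewrite ltr_pXn2r// nnegrE// ltW.
Qed.

Lemma Re_cvg (R : realType) (J : Type) (F : set_system J) (FF : Filter F)
    (u : J -> R[i]^o) (z : R[i]^o) :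
  u @ F --> z -> (fun i => complex.Re (u i)) @ F --> complex.Re z.
Proof.
move=> uz; apply/subr_cvg0/cvgr0Pnorm_lt => e e0.
have e20 : 0 < e ^+ 2 by rewrite exprn_gt0.
have := cvg_csq FF uz e20; apply: filterS => i hi.
rewrite -(@ltr_pXn2r _ 2)// ?nnegrE//; last exact: ltW.
rewrite real_normK ?num_real//; apply: le_lt_trans hi.
by rewrite /csq raddfB /= lerDl sqr_ge0.
Qed.

Lemma Im_cvg (R : realType) (J : Type) (F : set_system J) (FF : Filter F)
    (u : J -> R[i]^o) (z : R[i]^o) :
  u @ F --> z -> (fun i => complex.Im (u i)) @ F --> complex.Im z.
Proof.
move=> uz; apply/subr_cvg0/cvgr0Pnorm_lt => e e0.
have e20 : 0 < e ^+ 2 by rewrite exprn_gt0.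
have := cvg_csq FF uz e20; apply: filterS => i hi.
rewrite -(@ltr_pXn2r _ 2)// ?nnegrE//; last exact: ltW.
rewrite real_normK ?num_real//; apply: le_lt_trans hi.
by rewrite /csq [complex.Im (_ - _)]raddfB /= lerDr sqr_ge0.
Qed.

Section characters.
Context (R : realType) (G : topologicalZmodType).
Implicit Types (chi : dual R G) (g h : G).

Lemma csq_character chi g : csq (chi g) = 1.
Proof. by apply: csq_norm1; case: (dual_character chi). Qed.

Lemma characterD chi g h : chi (g + h) = chi g * chi h.
Proof. by case: (dual_character chi). Qed.

Lemma character0 chi : chi 0 = 1.
Proof.
have n0 : chi 0 != 0.
  by apply/eqP => c0; have := csq_character chi 0; rewrite c0 /csq/= expr0n/= addr0 => /eqP;
    rewrite eq_sym oner_eq0.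
by apply: (mulfI n0); rewrite -characterD addr0 mulr1.
Qed.

Lemma characterMN chi g : chi g * chi (- g) = 1.
Proof. by rewrite -characterD subrr character0. Qed.

(** Singletons are compact, so the compact-open topology refines pointwise convergence. *)
Lemma dual_eval_continuous g :
  continuous (fun chi : dual R G => chi g : R[i]^o).
Proof.
move=> chi.
have hc : {for chi, continuous (@dual_fun R G : dual R G -> {compact-open, G -> R[i]^o})}.
  exact: initial_continuous.
have FF : Filter ((@dual_fun R G : dual R G -> {compact-open, G -> R[i]^o}) x @[x --> chi]).
  exact/fmap_filter/nbhs_filter.
have H := (@compact_open_cvgP _ _ _ _ FF).1 hc.
apply/cvgrPdist_lt; first exact: nbhs_filter.
move=> e e0.
have oB : open (ball (chi g : R[i]^o) e) by exact: ball_open.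
have sub : [set chi x | x in [set g]] `<=` ball (chi g : R[i]^o) e.
  by move=> _ [_ -> <-] /=; exact: ballxx.
have HH := H [set g] _ (@compact_set1 _ _) oB sub.
apply: (@filterS _ _ (nbhs_filter chi) _ _ _ HH) => t /= ht.
by have := ht (t g) (imageP _ erefl); rewrite -ball_normE.
Qed.

Lemma measurable_Re_eval g :
  measurable_fun setT (fun chi : borel_dual R G => complex.Re ((chi : dual R G) g) : R).
Proof.
apply: (measurability _ (RGenOInfty.measurableE R)) => _ [_ [a ->] <-].
rewrite setTI; apply: sub_sigma_algebra => /=.
apply: (@open_comp (dual R G) R (fun chi => complex.Re (chi g))).
  move=> chi _; apply: Re_cvg; [exact: nbhs_filter|exact: dual_eval_continuous].
exact: rray_open.
Qed.

Lemma measurable_Im_eval g :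
  measurable_fun setT (fun chi : borel_dual R G => complex.Im ((chi : dual R G) g) : R).
Proof.
apply: (measurability _ (RGenOInfty.measurableE R)) => _ [_ [a ->] <-].
rewrite setTI; apply: sub_sigma_algebra => /=.
apply: (@open_comp (dual R G) R (fun chi => complex.Im (chi g))).
  move=> chi _; apply: Im_cvg; [exact: nbhs_filter|exact: dual_eval_continuous].
exact: rray_open.
Qed.

End characters.

(** * The eigenvalue set as a countable union of closed sets *)

Section weak_limits_of_complex_functions.
Context (R : realType) d (X : measurableType d) (m : probability X R).
Context (J : Type) (U : set_system J) (UF : UltraFilter U).

Lemma complex_weak_limit (f : J -> X -> R[i]^o) (M : R) :
  (forall i, L2 m (f i)) ->
  (forall i, Int m (fun x => complex.Re (f i x) ^+ 2) <= M) ->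
  (forall i, Int m (fun x => complex.Im (f i x) ^+ 2) <= M) ->
  exists h : X -> R[i]^o, [/\ L2 m h,
    Int m (fun x => complex.Re (h x) ^+ 2) <= M,
    Int m (fun x => complex.Im (h x) ^+ 2) <= M,
    weak_cvg m U (fun i x => complex.Re (f i x)) (fun x => complex.Re (h x)) &
    weak_cvg m U (fun i x => complex.Im (f i x)) (fun x => complex.Im (h x))].
Proof.
move=> Lf fr fi.
have [hr [shr hrM hrw]] := weak_limit_exists UF (fun i => L2Re (Lf i)) fr.
have [hi [shi hiM hiw]] := weak_limit_exists UF (fun i => L2Im (Lf i)) fi.
exists (fun x => (hr x +i* hi x)%C); split => //.
exact/L2P.
Qed.

(** Multiplication by [z] is a real 2 by 2 matrix on real and imaginary parts; each row is an
    instance of [weak_limit_equivariant]. *)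
Lemma complex_weak_limit_equivariant (T : nst m) (f r : J -> X -> R[i]^o)
    (h : X -> R[i]^o) (z : R[i]) :
  (forall i, L2 m (f i)) -> (forall i, L2 m (r i)) -> L2 m h ->
  weak_cvg m U (fun i x => complex.Re (f i x)) (fun x => complex.Re (h x)) ->
  weak_cvg m U (fun i x => complex.Im (f i x)) (fun x => complex.Im (h x)) ->
  (forall i, {ae m, forall x, f i (T x) = z * f i x + r i x}) ->
  (fun i => nsq m (r i)) @ U --> (0 : R) ->
  {ae m, forall x, h (T x) = z * h x}.
Proof.
move=> Lf Lr Lh fr fi eqv r0.
have bound (s : J -> X -> R) : (forall i, sqi m (s i)) ->
    (forall i x, s i x ^+ 2 <= csq (r i x)) ->
    (fun i => Int m (fun x => s i x ^+ 2)) @ U --> (0 : R).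
  move=> ss sr; apply: (@squeeze_cvgr _ _ _ _ (fun=> 0) (fun i => nsq m (r i))) => //; last exact: cvg_cst.
  apply: nearW => i; apply/andP; split; first by apply: Int_ge0 => x; exact: sqr_ge0.
  rewrite nsqE; apply: le_Int => //; first by case: (ss i).
  exact: (intg_ip (Lr i) (Lr i)).
have re : {ae m, forall x, complex.Re (h (T x)) =
    complex.Re z * complex.Re (h x) + (- complex.Im z) * complex.Im (h x)}.
  apply: (@weak_limit_equivariant _ _ _ _ _ U _ T _ _ (fun i x => complex.Re (r i x)) _ _ _ _
    (fun i => L2Re (Lf i)) (fun i => L2Im (Lf i)) (fun i => L2Re (Lr i)) (L2Re Lh) (L2Im Lh) fr fi).
    by move=> i; move: (eqv i); apply: filterS => x ->; rewrite ReD ReMo mulNr.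
  apply: bound => [i|i x]; first exact: L2Re.
  by rewrite /csq lerDl sqr_ge0.
have im : {ae m, forall x, complex.Im (h (T x)) =
    complex.Re z * complex.Im (h x) + complex.Im z * complex.Re (h x)}.
  apply: (@weak_limit_equivariant _ _ _ _ _ U _ T _ _ (fun i x => complex.Im (r i x)) _ _ _ _
    (fun i => L2Im (Lf i)) (fun i => L2Re (Lf i)) (fun i => L2Im (Lr i)) (L2Im Lh) (L2Re Lh) fi fr).
    by move=> i; move: (eqv i); apply: filterS => x ->; rewrite ImD ImMo.
  apply: bound => [i|i x]; first exact: L2Im.
  by rewrite /csq lerDr sqr_ge0.
move: re im; apply: filterS2 => x hr hi.
move: hr hi; case: (h (T x)) => a b; case: (h x) z {eqv} => a' b' [c c'] /= -> ->.
by rewrite mulNr; congr (_ +i* _)%C.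
Qed.

End weak_limits_of_complex_functions.

Section eigenvalue_sets.
Context (R : realType) (G : topologicalZmodType).
Context d (X : measurableType d) (m : probability X R) (T : G -> nst m).

(** The mean over [A] is prescribed instead of asking [f] to be nonzero, because a prescribed mean
    and a norm bound both survive weak limits. *)
Definition eigenset (A : set X) (M : R) : set (dual R G) :=
  [set chi | exists f : X -> R[i]^o,
    [/\ L2 m f,
      Int m (fun x => complex.Re (f x) ^+ 2) <= M /\
      Int m (fun x => complex.Im (f x) ^+ 2) <= M,
      Int m (fun x => complex.Re (f x) * \1_A x) = 1,
      Int m (fun x => complex.Im (f x) * \1_A x) = 0
    & forall g, {ae m, forall x, f (T g x) = chi g * f x}]].

Lemma nsq_Re_Im f : L2 m f -> nsq m f =
  Int m (fun x => complex.Re (f x) ^+ 2) + Int m (fun x => complex.Im (f x) ^+ 2).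
Proof.
by move=> /L2P[[_ fr] [_ fi]]; rewrite nsqE -IntD.
Qed.

(** Along an ultrafilter of characters of the set converging to [chi], the eigenfunctions have a
    weak limit. Replacing the eigenvalue [p i] by [chi] costs the error [(p i g - chi g) * f i],
    which tends to 0 in norm since the [f i] are bounded and evaluation at [g] is continuous. *)
Lemma eigenset_closed A M : measurable A -> closed (eigenset A M).
Proof.
move=> mA chi clchi.
have PF : ProperFilter (within (eigenset A M) (nbhs chi)) by exact: within_nbhs_proper.
have [U [UF sU]] := ultraFilterLemma PF.
have UP : U (eigenset A M).
  by apply: sU; rewrite /within /=; apply: (@filterS _ _ (nbhs_filter chi) _ _ _ (@filterT _ _ (nbhs_filter chi))).
have Uchi : U --> chi.
  move=> B Bchi; apply: sU; rewrite /within /=.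
  exact: (@filterS _ _ (nbhs_filter chi) _ _ _ Bchi).
have [chi0 Pchi0] := @filter_ex _ U _ _ UP.
(* Eigenfunctions have to be chosen for every index; [p] is the identity on a set of [U], and the
   default [chi0] is invisible in the limit. *)
pose p (i : dual R G) := if pselect (eigenset A M i) then i else chi0.
have Pp i : eigenset A M (p i) by rewrite /p; case: pselect.
pose f i := sval (cid (Pp i)).
have fP i := svalP (cid (Pp i)).
have Lf i : L2 m (f i) by case: (fP i).
have [h [Lh hr hi wr wi]] := complex_weak_limit UF Lf
  (fun i => let: And5 _ h _ _ _ := fP i in h.1)
  (fun i => let: And5 _ h _ _ _ := fP i in h.2).
have mI := @measurable_fun_indic R _ _ _ mA.
have bI x : `|\1_A x| <= 1 :> R by exact: normr_indic_le1.
exists h; split => //.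
- have := wr _ _ mI bI.
  have -> : (fun i => Int m (fun x => complex.Re (f i x) * \1_A x)) = fun=> 1.
    by apply/funext => i; case: (fP i).
  by move=> h1; apply: (cvg_unique _ h1 (cvg_cst (1 : R))); exact: norm_hausdorff.
- have := wi _ _ mI bI.
  have -> : (fun i => Int m (fun x => complex.Im (f i x) * \1_A x)) = fun=> 0.
    by apply/funext => i; case: (fP i).
  by move=> h1; apply: (cvg_unique _ h1 (cvg_cst (0 : R))); exact: norm_hausdorff.
move=> g.
pose r i x : R[i]^o := (p i g - chi g) * f i x.
have Lr i : L2 m (r i) by exact: L2Z.
apply: (@complex_weak_limit_equivariant _ _ _ _ _ _ UF (T g) f r) => //.
  move=> i; have [_ _ _ _ /(_ g)] := fP i; apply: filterS => x; rewrite -/(f i) => ->.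
  by rewrite /r -mulrDl addrC subrK.
have M0 : 0 <= M by apply: le_trans hr; apply: Int_ge0 => x; exact: sqr_ge0.
have pU : (fun i => p i g : R[i]^o) @ U --> (chi g : R[i]^o).
  apply: (@cvg_trans _ ((fun i => i g : R[i]^o) @ U)).
    apply: near_eq_cvg; apply: filterS UP => i Pi; rewrite /p.
    by case: pselect.
  by move=> B nB; exact: (Uchi _ (@dual_eval_continuous R G g chi B nB)).
apply/cvgr0Pnorm_lt => e e0.
(* [M + M] bounds the squared norm, one [M] for each part; the added 1 keeps the denominator
   positive when [M = 0]. *)
have e'0 : 0 < e / (M + M + 1) by rewrite divr_gt0//; lra.
have FU : Filter U by exact: ultra_proper.
have := cvg_csq FU pU e'0; apply: filterS => i hpi.
rewrite ger0_norm ?nsq_ge0// nsqZ//.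
have nM : nsq m (f i) <= M + M.
  by rewrite nsq_Re_Im//; case: (fP i) => _ [? ?] _ _ _; exact: lerD.
have n0 := nsq_ge0 m (f i).
have c0 := csq_ge0 (p i g - chi g).
apply: (@le_lt_trans _ _ (csq (p i g - chi g) * (M + M + 1))).
  by apply: ler_wpM2l => //; lra.
by rewrite -ltr_pdivlMr//; lra.
Qed.

(** A nonzero eigenfunction has a nonzero mean over some [C n], and dividing by this mean gives the
    required normalisation; [k] is any integer above the resulting norms. *)
Lemma eigenvaluesE C : separating_sequence m C ->
  eigenvalues m T = \bigcup_n \bigcup_k eigenset (C n) k%:R.
Proof.
move=> [mC sepC]; apply/seteqP; split => [chi [f [Lf f0 ef]]|chi [n _ [k _ [f [Lf _ fr _ ef]]]]]; last first.
  exists f; split => // f0; have : Int m (fun x => complex.Re (f x) * \1_(C n) x) = 0.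
    rewrite -[RHS](Int_cst m 0); apply: Int_ae => //.
      exact: intg_measurable (intgM_indic (sqi_intg (L2Re Lf)) (mC n)).
    by move: f0; apply: filterS => x ->; rewrite mul0r.
  by rewrite fr => /eqP; rewrite oner_eq0.
pose a n := Int m (fun x => complex.Re (f x) * \1_(C n) x).
pose b n := Int m (fun x => complex.Im (f x) * \1_(C n) x).
have [n cn0] : exists n, (a n +i* b n)%C != 0.
  apply: contrapT => /forallNP h; apply: f0.
  have h' n : a n = 0 /\ b n = 0.
    by have /negP := h n; rewrite negbK => /eqP[-> ->].
  have hr := sepC _ (sqi_intg (L2Re Lf)) (fun n => (h' n).1).
  have hi := sepC _ (sqi_intg (L2Im Lf)) (fun n => (h' n).2).
  move: hr hi; apply: filterS2 => x.
  by case: (f x) => u v /= -> ->.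
pose c := (a n +i* b n)%C; pose f' x : R[i]^o := c^-1 * f x.
have Lf' : L2 m f' by exact: L2Z.
pose M := Num.max (Int m (fun x => complex.Re (f' x) ^+ 2)) (Int m (fun x => complex.Im (f' x) ^+ 2)).
have MK : M <= (Num.trunc M).+1%:R by exact/ltW/truncnS_gt.
have ir := intgM_indic (sqi_intg (L2Re Lf)) (mC n).
have ii := intgM_indic (sqi_intg (L2Im Lf)) (mC n).
have cc : c^-1 * c = 1 by rewrite mulVf.
exists n => //; exists (Num.trunc M).+1 => //; exists f'; split => //.
- by split; apply: le_trans MK; rewrite /M le_max lexx ?orbT.
- have -> : (fun x => complex.Re (f' x) * \1_(C n) x) = (fun x =>
      complex.Re c^-1 * (complex.Re (f x) * \1_(C n) x) -
      complex.Im c^-1 * (complex.Im (f x) * \1_(C n) x)).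
    by apply/funext => x; rewrite /f' ReMo; ring.
  rewrite IntB ?IntZ//; try exact: intgZ.
  have := congr1 (@complex.Re R) cc.
  by move=> h; rewrite -[RHS]h; case: c^-1.
- have -> : (fun x => complex.Im (f' x) * \1_(C n) x) = (fun x =>
      complex.Re c^-1 * (complex.Im (f x) * \1_(C n) x) +
      complex.Im c^-1 * (complex.Re (f x) * \1_(C n) x)).
    by apply/funext => x; rewrite /f' ImMo; ring.
  rewrite IntD ?IntZ//; try exact: intgZ.
  have := congr1 (@complex.Im R) cc.
  by move=> h; rewrite -[RHS]h; case: c^-1.
- by move=> g; have := ef g; apply: filterS => x fx; rewrite /f' fx mulrCA.
Qed.

Lemma measurable_eigenset A M : measurable A ->
  measurable (eigenset A M : set (borel_dual R G)).
Proof.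
move=> mA; rewrite -[eigenset A M]setCK; apply: measurableC.
by apply: sub_sigma_algebra; apply: closed_openC; exact: eigenset_closed.
Qed.

End eigenvalue_sets.

(** * Functions of mean zero and measure-preserving maps *)

Section measure_preserving.
Context (R : realType) d (Y : measurableType d) (nu : probability Y R).
Implicit Types (f h : Y -> R[i]^o).

Lemma L20P f : L20 nu f <-> [/\ L2 nu f,
  Int nu (fun y => complex.Re (f y)) = 0 & Int nu (fun y => complex.Im (f y)) = 0].
Proof.
split=> [[Lf]|[Lf fr fi]].
  by rewrite /Cintegral => -[].
by split => //; rewrite /Cintegral; congr (_ +i* _)%C.
Qed.

Lemma L20_L2 f : L20 nu f -> L2 nu f.
Proof. by case. Qed.
Hint Resolve L20_L2 : core.

Lemma L20D f h : L20 nu f -> L20 nu h -> L20 nu (fun y => f y + h y).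
Proof.
move=> /L20P[Lf fr fi] /L20P[Lh hr hi]; apply/L20P; split; first exact: L2D.
- under eq_fun do rewrite ReD; rewrite IntD ?fr ?hr ?addr0//;
  exact/sqi_intg/L2Re.
- under eq_fun do rewrite ImD; rewrite IntD ?fi ?hi ?addr0//;
  exact/sqi_intg/L2Im.
Qed.

Lemma L20Z (c : R[i]) f : L20 nu f -> L20 nu (fun y => c * f y).
Proof.
move=> /L20P[Lf fr fi]; have ir := sqi_intg (L2Re Lf); have ii := sqi_intg (L2Im Lf).
apply/L20P; split; first exact: L2Z.
- under eq_fun do rewrite ReMo; rewrite IntB ?IntZ ?fr ?fi ?mulr0 ?subr0//; exact: intgZ.
- under eq_fun do rewrite ImMo; rewrite IntD ?IntZ ?fr ?fi ?mulr0 ?addr0//; exact: intgZ.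
Qed.

Lemma L20B f h : L20 nu f -> L20 nu h -> L20 nu (fun y => f y - h y).
Proof.
move=> Lf /(L20Z (-1)) Lh; have := L20D Lf Lh.
by under eq_fun do rewrite mulN1r.
Qed.

Lemma L20_0 : L20 nu (fun=> 0).
Proof. by apply/L20P; split; [exact: L2_cst|exact: Int_cst|exact: Int_cst]. Qed.

(** The projection of [\1_D] to the functions of mean zero. Pairing with it integrates over [D], so
    that integrals over sets can be moved through the self-adjoint operators [E A], which are
    controlled only on [L20]. *)
Definition centered_indic (D : set Y) (y : Y) : R[i]^o :=
  (\1_D y - fine (nu D))%:C%C.

Lemma L20_centered_indic D : measurable D -> L20 nu (centered_indic D).
Proof.
move=> mD; have sD : sqi nu (fun y => \1_D y - fine (nu D)).
  by apply: sqiB; [exact: sqi_indic|exact: sqi_cst].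
apply/L20P; split; [by apply/L2P; split; [exact: sD|exact: sqi_cst]| |exact: Int_cst].
rewrite IntB; [|exact/sqi_intg/sqi_indic|exact: intg_cst].
by rewrite Int_indic// Int_cst subrr.
Qed.

Lemma ip_centered_indic D f : measurable D -> L20 nu f ->
  ip nu f (centered_indic D) = Int nu (fun y => complex.Re (f y) * \1_D y).
Proof.
move=> mD /L20P[Lf fr fi]; have ir := sqi_intg (L2Re Lf).
have -> : ip nu f (centered_indic D) = Int nu (fun y =>
    complex.Re (f y) * \1_D y - fine (nu D) * complex.Re (f y)).
  by congr Rintegral; apply/funext => y; rewrite /centered_indic/=; ring.
by rewrite IntB ?IntZ ?fr ?mulr0 ?subr0//; [exact: intgM_indic|exact: intgZ].
Qed.

Section preserving_map.
Context (S : nst nu).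
Hypothesis S_mp : forall A, measurable A -> nu (S @^-1` A) = nu A.

Lemma integral_mp (f : Y -> \bar R) : measurable_fun setT f -> (forall y, (0 <= f y)%E) ->
  (\int[nu]_y f (S y) = \int[nu]_y f y)%E.
Proof.
move=> mf f0.
pose mSm := isMeasurableFun.Build _ _ _ _ _ (nst_measurable_fun S).
pose Sm : {mfun Y >-> Y} := HB.pack (nst_fun S) mSm.
rewrite -[LHS](@ge0_integral_pushforward _ _ _ _ _ Sm (measurable_funPT Sm) nu setT f)//.
by apply: eq_measure_integral => A mA _; exact: S_mp.
Qed.

Lemma intg_mp (f : Y -> R) : intg nu f -> intg nu (fun y => f (S y)).
Proof.
move=> If; have mf := intg_measurable If.
apply/integrableP; split; first exact/measurable_EFinP/measurable_comp_nst.
rewrite (@integral_mp (fun y => `|(f y)%:E|%E))//.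
  by case/integrableP : If.
by apply: measurableT_comp => //; exact/measurable_EFinP.
Qed.

Lemma Int_mp (f : Y -> R) : intg nu f -> Int nu (fun y => f (S y)) = Int nu f.
Proof.
move=> If; have mf := intg_measurable If.
have pos (h : Y -> R) : intg nu h -> (forall y, 0 <= h y) -> Int nu (fun y => h (S y)) = Int nu h.
  move=> Ih h0; congr fine; apply: (@integral_mp (fun y => (h y)%:E)).
    by apply/measurable_EFinP; exact: intg_measurable Ih.
  by move=> y; rewrite lee_fin.
have h0 y : 0 <= `|f y| - f y by rewrite subr_ge0 ler_norm.
have := pos _ (intgB (intg_norm If) If) h0.
have Ifs := intg_mp If.
have Ins : intg nu (fun y => `|f (S y)|) by exact: (intg_norm Ifs).
have In := intg_norm If.
rewrite (IntB Ins Ifs) (IntB In If) (pos (fun y => `|f y|) In) //.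
by move/addrI/oppr_inj.
Qed.

Lemma sqi_mp (f : Y -> R) : sqi nu f -> sqi nu (fun y => f (S y)).
Proof. by move=> [mf If]; split; [exact: measurable_comp_nst|exact: intg_mp If]. Qed.

Lemma L2_mp f : L2 nu f -> L2 nu (f \o S).
Proof.
move=> /L2P[fr fi]; apply/L2P; split; first exact: (sqi_mp fr).
exact: (sqi_mp fi).
Qed.

Lemma ip_mp f h : L2 nu f -> L2 nu h -> ip nu (f \o S) (h \o S) = ip nu f h.
Proof. by move=> Lf Lh; exact: (Int_mp (intg_ip Lf Lh)). Qed.

Lemma L20_mp f : L20 nu f -> L20 nu (f \o S).
Proof.
move=> /L20P[Lf fr fi]; apply/L20P; split; first exact: L2_mp.
  by rewrite -[RHS]fr; exact: (Int_mp (sqi_intg (L2Re Lf))).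
by rewrite -[RHS]fi; exact: (Int_mp (sqi_intg (L2Im Lf))).
Qed.

End preserving_map.
End measure_preserving.
#[export] Hint Resolve L20_L2 : core.

(** * Projection-valued measures *)

Section set_function_integral.
Import HBNNSimple.

(** [spectral_integral] integrates against bare set functions, about which nothing is known off the
    sigma-algebra. This allows replacing them by genuine measures. *)
Lemma eq_set_function_integral (R : realType) d (X : measurableType d)
    (mu1 mu2 : set X -> \bar R) (f : X -> \bar R) :
  (forall A, measurable A -> mu1 A = mu2 A) ->
  (\int[mu1]_x f x = \int[mu2]_x f x)%E.
Proof.
move=> mu12; rewrite /integral.
have E (h : {nnsfun X >-> R}) : sintegral mu1 h = sintegral mu2 h.
  by apply: eq_fsbigr => x _; rewrite mu12//; exact: measurable_funPTI.
by congr (ereal_sup _ - ereal_sup _)%E; apply/seteqP; split => _ [h hf <-];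
  exists h => //.
Qed.

End set_function_integral.

Lemma ip_ae0 (R : realType) d (X : measurableType d) (m : probability X R)
    (f h : X -> R[i]^o) : L2 m f -> L2 m h ->
  {ae m, forall x, f x = 0} -> ip m f h = 0.
Proof.
move=> Lf Lh f0.
rewrite (ip_ae Lf (L2_cst m 0) Lh Lh f0 (aeW _ (fun=> erefl))).
rewrite /ip /=; under eq_fun do rewrite !mul0r addr0.
exact: Int_cst.
Qed.

Section projection_valued_measures.
Context (R : realType) (G : topologicalZmodType) d (Y : measurableType d).
Context (nu : probability Y R).
Context (E : set (borel_dual R G) -> (Y -> R[i]^o) -> (Y -> R[i]^o)).
Hypothesis PE : projection_valued_measure nu E.
Implicit Types (A B : set (borel_dual R G)) (f h : Y -> R[i]^o).

Lemma pvm_L20 A f : measurable A -> L20 nu f -> L20 nu (E A f).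
Proof. by move=> mA Lf; case: PE => /(_ _ mA)[h _ _] _ _ _ _; exact: h. Qed.

Lemma pvm_L2 A f : measurable A -> L20 nu f -> L2 nu (E A f).
Proof. by move=> mA Lf; exact/L20_L2/pvm_L20. Qed.
Hint Resolve pvm_L2 pvm_L20 : core.

Lemma pvm_linear A (a : R[i]) f h : measurable A -> L20 nu f -> L20 nu h ->
  {ae nu, forall y, E A (fun z => a * f z + h z) y = a * E A f y + E A h y}.
Proof. by move=> mA; case: PE => /(_ _ mA)[_ _ h'] _ _ _ _; exact: h'. Qed.

Lemma pvmI A B f : measurable A -> measurable B -> L20 nu f ->
  {ae nu, forall y, E (A `&` B) f y = E A (E B f) y}.
Proof. by move=> mA mB Lf; case: PE => _ _ _ h _; exact: h. Qed.

Lemma pvm0 f : L20 nu f -> {ae nu, forall y, E set0 f y = 0}.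
Proof. by move=> Lf; case: PE => _ _ /(_ _ Lf)[]. Qed.

Lemma pvmT f : L20 nu f -> {ae nu, forall y, E setT f y = f y}.
Proof. by move=> Lf; case: PE => _ _ /(_ _ Lf)[]. Qed.

Lemma pvm_zero A : measurable A -> {ae nu, forall y, E A (fun=> 0) y = 0}.
Proof.
move=> mA; have := pvm_linear (-1) mA (L20_0 nu) (L20_0 nu).
apply: filterS => y; have -> : (fun z : Y => -1 * 0 + 0) = (fun=> 0) :> (Y -> R[i]^o).
  by apply/funext => z; rewrite mulr0 addr0.
by move=> ->; rewrite mulN1r addNr.
Qed.

Lemma pvmZ A (a : R[i]) f : measurable A -> L20 nu f ->
  {ae nu, forall y, E A (fun z => a * f z) y = a * E A f y}.
Proof.
move=> mA Lf; have := pvm_linear a mA Lf (L20_0 nu).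
have -> : (fun z : Y => a * f z + 0) = (fun z => a * f z) :> (Y -> R[i]^o).
  by apply/funext => z; rewrite addr0.
by have := pvm_zero mA; apply: filterS2 => y -> ->; rewrite addr0.
Qed.

Lemma pvmD A f h : measurable A -> L20 nu f -> L20 nu h ->
  {ae nu, forall y, E A (fun z => f z + h z) y = E A f y + E A h y}.
Proof.
move=> mA Lf Lh; have := pvm_linear 1 mA Lf Lh.
have -> : (fun z : Y => 1 * f z + h z) = (fun z => f z + h z) :> (Y -> R[i]^o).
  by apply/funext => z; rewrite mul1r.
by apply: filterS => y ->; rewrite mul1r.
Qed.

Lemma ip_pvm A f h : measurable A -> L20 nu f -> L20 nu h ->
  ip nu (E A f) h = ip nu f (E A h).
Proof.
move=> mA Lf Lh; case: PE => _ /(_ _ mA)[_ /(_ _ _ Lf Lh)] + _ _ _.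
by rewrite !inner_ip => -[].
Qed.

Lemma ip_pvmI A B f h : measurable A -> measurable B -> L20 nu f -> L20 nu h ->
  ip nu (E A f) (E B h) = ip nu (E (A `&` B) f) h.
Proof.
move=> mA mB Lf Lh; rewrite -ip_pvm//; last exact: pvm_L20.
have mAB : measurable (A `&` B) by exact: measurableI.
apply: ip_ae; [exact/pvm_L2/pvm_L20|exact: pvm_L2|exact: L20_L2|exact: L20_L2| |exact: aeW].
have := pvmI mB mA Lf; rewrite setIC.
by apply: filterS => y ->.
Qed.

Lemma nsq_pvm A f : measurable A -> L20 nu f -> nsq nu (E A f) = ip nu (E A f) f.
Proof. by move=> mA Lf; rewrite /nsq ip_pvmI// setIid. Qed.

Lemma pvm_disjoint A B f : measurable A -> measurable B -> A `&` B = set0 ->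
  L20 nu f -> {ae nu, forall y, E A (E B f) y = 0}.
Proof.
move=> mA mB AB Lf; have := pvmI mA mB Lf; rewrite AB.
by have := pvm0 Lf; apply: filterS2 => y -> ->.
Qed.

Lemma ip_pvm_disjoint A B f h : measurable A -> measurable B -> A `&` B = set0 ->
  L20 nu f -> L20 nu h -> ip nu (E A f) (E B h) = 0.
Proof.
move=> mA mB AB Lf Lh; rewrite ip_pvmI// AB.
by apply: ip_ae0; [exact: pvm_L2|exact: L20_L2|exact: pvm0].
Qed.

(** Countable additivity for the two sets followed by empty ones. *)
Lemma ip_pvmU A B f h : measurable A -> measurable B -> A `&` B = set0 ->
  L20 nu f -> L20 nu h ->
  ip nu (E (A `|` B) f) h = ip nu (E A f) h + ip nu (E B f) h.
Proof.
move=> mA mB AB Lf Lh.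
pose F (k : nat) := if k == 0%N then A else if k == 1%N then B else set0.
have mF k : measurable (F k) by rewrite /F; case: ifP => // _; case: ifP.
have tF : trivIset setT F.
  apply/trivIsetP => i j _ _; rewrite /F.
  by case: i j => [|[|i]] [|[|j]]//= _; rewrite ?AB ?(setIC B) ?AB ?set0I ?setI0.
have UF : \bigcup_n F n = A `|` B.
  apply/seteqP; split => [x [[|[|n]] _]|x [Ax|Bx]]; rewrite /F/=.
  - by left.
  - by right.
  - by [].
  - by exists 0%N.
  - by exists 1%N.
case: PE => _ _ _ _ /(_ F mF tF f h Lf Lh); rewrite UF => /Re_cvg lim.
have R0 k : complex.Re (inner nu (E (F k) f) h) = ip nu (E (F k) f) h.
  by rewrite inner_ip.
have e n : (2 <= n)%N -> complex.Re (\sum_(0 <= k < n) inner nu (E (F k) f) h) =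
    ip nu (E A f) h + ip nu (E B f) h.
  move=> n2; rewrite Re_sum (eq_bigr _ (fun k _ => R0 k)).
  rewrite big_ltn; last exact: leq_trans n2.
  rewrite big_ltn// big_nat big1 ?addr0// => k /andP[k2 _].
  have -> : F k = set0 by case: k k2 => [|[|k]].
  by apply: ip_ae0; [exact: pvm_L2|exact: L20_L2|exact: pvm0].
have := lim; rewrite inner_ip/= => lim'.
have lim2 : (fun n => complex.Re (\sum_(0 <= k < n) inner nu (E (F k) f) h)) @ \oo -->
    (ip nu (E A f) h + ip nu (E B f) h).
  by apply: cvg_near_cst; exists 2%N => // n; exact: e.
by apply: (cvg_unique _ lim' lim2); exact: norm_hausdorff.
Qed.

Definition spectral_mass f (A : set (borel_dual R G)) : \bar R :=
  if pselect (measurable A) then (nsq nu (E A f))%:E else 0%E.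

Lemma spectral_massE f A : measurable A -> spectral_mass f A = (nsq nu (E A f))%:E.
Proof. by move=> mA; rewrite /spectral_mass; case: pselect. Qed.

End projection_valued_measures.

Lemma Rintegral_mscale (R : realType) d (X : measurableType d)
    (s : {measure set X -> \bar R}) (k : {nonneg R}) (f : X -> R) :
  s.-integrable setT (EFin \o f) ->
  Rintegral (mscale k s) setT f = k%:num * Rintegral s setT f.
Proof.
move=> If; have mf : measurable_fun setT (EFin \o f) by case/integrableP : If.
have p := integrable_pos_fin_num measurableT If.
have n := integrable_neg_fin_num measurableT If.
rewrite /Rintegral [in LHS]integralE [in RHS]integralE.
rewrite ge0_integral_mscale//; last exact: measurable_funepos.
rewrite ge0_integral_mscale//; last exact: measurable_funeneg.
rewrite -muleBr//; last exact: fin_num_adde_defr.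
by rewrite fineM// fin_numB p n.
Qed.

Section spectral_measures.
Context (R : realType) (G : topologicalZmodType) d (Y : measurableType d).
Context (nu : probability Y R).
Context (E : set (borel_dual R G) -> (Y -> R[i]^o) -> (Y -> R[i]^o)).
Hypothesis PE : projection_valued_measure nu E.
Implicit Types (A B : set (borel_dual R G)) (f h : Y -> R[i]^o).

(** As [E A] is an orthogonal projection, the squared norm of [E A f - f] is the difference of the
    two sides. *)
Lemma nsq_pvm_le A f : measurable A -> L20 nu f -> nsq nu (E A f) <= nsq nu f.
Proof.
move=> mA Lf; have LE := pvm_L2 PE mA Lf; have L2f := L20_L2 Lf.
have := nsq_ge0 nu (fun y => E A f y - f y).
rewrite {1}/nsq ipBl ?(ipC nu (E A f) (fun y => _ - _)) ?(ipC nu f (fun y => _ - _))//;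
  try exact: L2B.
rewrite !ipBl// -(nsq_pvm PE mA Lf) (ipC nu f) -(nsq_pvm PE mA Lf).
by rewrite -/(nsq nu _) -/(nsq nu f); lra.
Qed.

Lemma spectral_measure_exists f : L20 nu f ->
  exists s : {measure set (borel_dual R G) -> \bar R},
    forall A, measurable A -> s A = (nsq nu (E A f))%:E.
Proof.
move=> Lf.
have h0 : spectral_mass nu E f set0 = 0%E.
  rewrite spectral_massE//; congr EFin; apply: ip_ae0; [exact: pvm_L2|exact: pvm_L2|].
  exact: pvm0.
have hge A : (0 <= spectral_mass nu E f A)%E.
  by rewrite /spectral_mass; case: pselect => // mA; rewrite lee_fin nsq_ge0.
have hs : semi_sigma_additive (spectral_mass nu E f).
  move=> F mF tF mUF.
  have [_ _ _ _ /(_ F mF tF f f Lf Lf) /Re_cvg lim] := PE.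
  rewrite spectral_massE// nsq_pvm//; apply: cvg_EFin.
    by apply: nearW => n; apply/sum_fin_numP => k _ _; rewrite spectral_massE.
  have -> : fine \o (fun n => \sum_(0 <= k < n) spectral_mass nu E f (F k))%E =
     (fun n => complex.Re (\sum_(0 <= k < n) inner nu (E (F k) f) f)).
    apply/funext => n /=; rewrite Re_sum.
    rewrite (eq_bigr (fun k => (ip nu (E (F k) f) f)%:E)); last first.
      by move=> k _; rewrite spectral_massE// nsq_pvm.
    by rewrite sumEFin; apply: eq_bigr => k _; rewrite inner_ip.
  by have := lim _; rewrite inner_ip.
pose mix := isMeasure.Build _ _ _ (spectral_mass nu E f) h0 hge hs.
pose s : {measure set (borel_dual R G) -> \bar R} := HB.pack (spectral_mass nu E f) mix.
by exists s => A mA; rewrite -spectral_massE.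
Qed.

End spectral_measures.

(** * The Koopman representation on spectral subspaces *)

Section koopman_representation.
Context (R : realType) (G : topologicalZmodType) d (Y : measurableType d).
Context (nu : probability Y R) (S : G -> nst nu).
Hypothesis S_mp : forall g A, measurable A -> nu (S g @^-1` A) = nu A.
Context (E : set (borel_dual R G) -> (Y -> R[i]^o) -> (Y -> R[i]^o)).
Hypothesis SE : is_spectral_measure nu (fun g => S g) E.
Implicit Types (A B : set (borel_dual R G)) (f h u : Y -> R[i]^o) (g : G).

Let PE : projection_valued_measure nu E := SE.1.

Lemma integrable_character_parts (s : {measure set (borel_dual R G) -> \bar R}) g :
  (s setT < +oo)%E ->
  s.-integrable setT (EFin \o (fun chi : borel_dual R G => complex.Re ((chi : dual R G) g))) /\
  s.-integrable setT (EFin \o (fun chi : borel_dual R G => complex.Im ((chi : dual R G) g))).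
Proof.
move=> sT; split; apply: measurable_bounded_integrable => //.
- exact: measurable_Re_eval.
- exists 1; split => // x x1 chi _ /=; apply: le_trans (ltW x1).
  have := csq_character chi g; rewrite /csq => c1.
  rewrite -(@ler_pXn2r _ 2)// ?nnegrE// expr1n real_normK ?num_real// -c1.
  by rewrite lerDl sqr_ge0.
- exact: measurable_Im_eval.
- exists 1; split => // x x1 chi _ /=; apply: le_trans (ltW x1).
  have := csq_character chi g; rewrite /csq => c1.
  rewrite -(@ler_pXn2r _ 2)// ?nnegrE// expr1n real_normK ?num_real// -c1.
  by rewrite lerDr sqr_ge0.
Qed.

(** By linearity of [E A], the set function of [c * u] is [csq c] times the measure of [u]. This
    evaluates the polarisation terms when both vectors coincide. *)
Lemma Cintegral_spectralZ (s : {measure set (borel_dual R G) -> \bar R}) u (c : R[i]) g :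
  L20 nu u -> (forall A, measurable A -> s A = (nsq nu (E A u))%:E) ->
  Cintegral (fun A => (complex.Re (inner nu (E A (fun y => c * u y)) (fun y => c * u y)))%:E)
    (fun chi : dual R G => chi g) =
  (csq c)%:C%C * Cintegral s (fun chi : borel_dual R G => (chi : dual R G) g).
Proof.
move=> Lu sE; have Lcu := L20Z c Lu.
have c0 : 0 <= csq c by exact: csq_ge0.
have EA A : measurable A ->
    (complex.Re (inner nu (E A (fun y => c * u y)) (fun y => c * u y)))%:E =
    mscale (NngNum c0) s A.
  move=> mA; rewrite inner_ip /mscale/= sE// -EFinM; congr EFin.
  rewrite (@ip_ae _ _ _ nu _ (fun y => c * E A u y) _ (fun y => c * u y))//.
  - by rewrite ipZZ ?nsq_pvm//; [exact: pvm_L2|exact: L20_L2].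
  - exact: pvm_L2.
  - exact/L2Z/pvm_L2.
  - exact: L20_L2.
  - exact: L20_L2.
  - exact: pvmZ.
  - exact: aeW.
have sT : (s setT < +oo)%E by rewrite sE// ltry.
have [ir ii] := integrable_character_parts g sT.
rewrite /Cintegral (eq_set_function_integral _ EA) (eq_set_function_integral _ EA).
have := Rintegral_mscale (NngNum c0) ir; rewrite /Rintegral => ->.
have := Rintegral_mscale (NngNum c0) ii; rewrite /Rintegral => -> /=.
by simpc.
Qed.

(** For equal vectors the four polarisation terms are multiples of one integral by
    [csq (1 + 'i ^+ k)], that is 4, 2, 0, 2. Weighted by the powers of ['i] they add up to 4, which
    the factor [4^-1] cancels. *)
Lemma koopman_diag (s : {measure set (borel_dual R G) -> \bar R}) u g :
  L20 nu u -> (forall A, measurable A -> s A = (nsq nu (E A u))%:E) ->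
  inner nu (u \o S g) u =
  Cintegral s (fun chi : borel_dual R G => (chi : dual R G) (- g)).
Proof.
move=> Lu sE; rewrite (SE.2 g u u Lu Lu) /spectral_integral.
have eqk (k : nat) : (fun y => u y + 'i%C ^+ k * u y) = (fun y => (1 + 'i%C ^+ k) * u y).
  by apply/funext => y; rewrite mulrDl mul1r.
under eq_bigr do rewrite eqk (Cintegral_spectralZ _ _ Lu sE).
move: (Cintegral _ _) => z; rewrite !big_ord_recl big_ord0 /=.
have -> : csq (1 + 'i%C ^+ 0 : R[i]) = 4 by rewrite expr0 /csq/=; ring.
have -> : csq (1 + 'i%C ^+ 1 : R[i]) = 2 by rewrite expr1 /csq/=; ring.
have -> : csq (1 + 'i%C ^+ 2 : R[i]) = 0 by rewrite expr2 /csq/=; ring.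
have -> : csq (1 + 'i%C ^+ 3 : R[i]) = 2 by rewrite exprS expr2 /csq/=; ring.
have i3 : 'i%C ^+ 3 = - 'i%C :> R[i] by rewrite exprS sqr_i mulrN1.
rewrite !rmorph_nat rmorph0 expr0 expr1 sqr_i i3.
by field.
Qed.

Lemma ip_pvm_cross A B B' (c : R[i]) f h : measurable A -> measurable B ->
  measurable B' -> B `&` B' = set0 -> L20 nu f -> L20 nu h ->
  ip nu (E A (E B f)) (fun y => c * E B' h y) = 0.
Proof.
move=> mA mB mB' BB Lf Lh.
have La := pvm_L20 PE mB Lf; have LEa := pvm_L2 PE mA La.
have Lch := L20Z c Lh; have mAB : measurable (A `&` B') by exact: measurableI.
rewrite (@ip_ae _ _ _ nu _ (E A (E B f)) _ (E B' (fun y => c * h y)))//.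
- rewrite ip_pvmI//; apply: ip_ae0; [exact: pvm_L2|exact: L20_L2|].
  by apply: pvm_disjoint => //; rewrite -setIA (setIC B') BB setI0.
- exact/L2Z/pvm_L2.
- exact: pvm_L2.
- exact: aeW.
- by have := pvmZ PE c mB' Lh; apply: filterS => y ->.
Qed.

Lemma inner_eq0 f h : inner nu f h = 0 <-> ip nu f h = 0 /\ ip nu f (fun y => 'i%C * h y) = 0.
Proof.
by rewrite inner_ip; split => [[-> ->]|[-> ->]].
Qed.

(** Cross terms between orthogonal spectral ranges vanish, so the four set functions of the
    polarisation coincide, and the powers of ['i] sum to 0. *)
Lemma koopman_disjoint B B' f h g : measurable B -> measurable B' -> B `&` B' = set0 ->
  L20 nu f -> L20 nu h -> inner nu (E B f \o S g) (E B' h) = 0.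
Proof.
move=> mB mB' BB Lf Lh.
have La := pvm_L20 PE mB Lf; have Lb := pvm_L20 PE mB' Lh.
rewrite (SE.2 g _ _ La Lb) /spectral_integral.
set a := E B f; set b := E B' h; rewrite -/a -/b in La Lb.
have E0 (c : R[i]) : csq c = 1 -> forall A, measurable A ->
   (complex.Re (inner nu (E A (fun y => a y + c * b y)) (fun y => a y + c * b y)))%:E =
   (nsq nu (E A a) + nsq nu (E A b))%:E.
  move=> c1 A mA; congr EFin; have Lcb := L20Z c Lb.
  have LEa := pvm_L2 PE mA La; have LEb := pvm_L2 PE mA Lb.
  rewrite inner_ip/=.
  rewrite (@ip_ae _ _ _ nu _ (fun y => E A a y + c * E A b y) _ (fun y => a y + c * b y)).
  - rewrite ipDl ?ipDr//; try exact: L20_L2; try exact: L2Z; last by apply: L2D; exact: L20_L2.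
    rewrite ipZZ ?c1 ?mul1r//; last exact: L20_L2.
    have d1 : ip nu (E A a) (fun y => c * b y) = 0 by exact: ip_pvm_cross.
    have d2 : ip nu (fun y => c * E A b y) a = 0.
      by rewrite ipZl_conj; apply: ip_pvm_cross => //; rewrite setIC.
    by rewrite d1 d2 addr0 add0r -(nsq_pvm PE mA La) -(nsq_pvm PE mA Lb).
  - exact/pvm_L2/L20D.
  - by apply: L2D => //; exact: L2Z.
  - by apply: L2D; exact: L20_L2.
  - by apply: L2D; exact: L20_L2.
  - have := pvmD PE mA La Lcb; have := pvmZ PE c mA Lb.
    by apply: filterS2 => y -> ->.
  - exact: aeW.
pose sg A : \bar R := (nsq nu (E A a) + nsq nu (E A b))%:E.
pose z := Cintegral sg (fun chi : dual R G => chi (- g)).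
have zk (k : nat) : Cintegral (fun A => (complex.Re (inner nu
    (E A (fun y => a y + 'i%C ^+ k * b y)) (fun y => a y + 'i%C ^+ k * b y)))%:E)
    (fun chi : dual R G => chi (- g)) = z.
  have ck : csq ('i%C ^+ k : R[i]) = 1.
    elim: k => [|k ih]; first by rewrite expr0 /csq/= expr1n expr0n addr0.
    by rewrite exprS csqM ih mulr1 /csq/= expr1n expr0n add0r.
  by rewrite /Cintegral (eq_set_function_integral _ (E0 _ ck))
    (eq_set_function_integral _ (E0 _ ck)).
under eq_bigr do rewrite zk.
rewrite !big_ord_recl big_ord0 /=.
have i3 : 'i%C ^+ 3 = - 'i%C :> R[i] by rewrite exprS sqr_i mulrN1.
rewrite expr0 expr1 sqr_i i3.
by ring.
Qed.

Lemma koopman_orthogonal B B' f h g : measurable B -> measurable B' -> B `&` B' = set0 ->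
  L20 nu f -> L20 nu h -> ip nu (E B f \o S g) (E B' h) = 0.
Proof.
by move=> mB mB' BB Lf Lh; have /inner_eq0[] := koopman_disjoint g mB mB' BB Lf Lh.
Qed.

(** Additivity of [E] is available only inside inner products; the pointwise identity follows by
    testing the difference against itself. *)
Lemma pvm_splitC B f : measurable B -> L20 nu f ->
  {ae nu, forall y, f y = E B f y + E (~` B) f y}.
Proof.
move=> mB Lf; have mBC := measurableC mB.
have LB := pvm_L20 PE mB Lf; have LC := pvm_L20 PE mBC Lf.
have Ls := L20D LB LC; have Ld := L20B Lf Ls.
have test h : L20 nu h -> ip nu (fun y => f y - (E B f y + E (~` B) f y)) h = 0.
  move=> Lh; rewrite ipBl ?ipDl//; try exact: L20_L2.
  rewrite -ip_pvmU//; last by rewrite setICr.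
  rewrite setUCr (@ip_ae _ _ _ nu _ f _ h) ?subrr//; try exact: L20_L2.
  - exact: pvm_L2.
  - exact: pvmT.
  - exact: aeW.
have := nsq_eq0 (L20_L2 Ld) (test _ Ld); apply: filterS => y /eqP.
by rewrite subr_eq0 => /eqP.
Qed.

(** Weak form of the commutation of [E B] with the Koopman operators. By [koopman_orthogonal] these
    keep the ranges belonging to [B] and to its complement orthogonal, so on either side only the
    [B]-parts of [f] and [h] contribute. *)
Lemma koopman_pvm B f g h : measurable B -> L20 nu f -> L20 nu h ->
  ip nu (E B (f \o S g)) h = ip nu (E B f \o S g) h.
Proof.
move=> mB Lf Lh; have mBC := measurableC mB.
have mp := S_mp g.
have LB := pvm_L20 PE mB Lf; have LC := pvm_L20 PE mBC Lf.
have LhB := pvm_L20 PE mB Lh; have LhC := pvm_L20 PE mBC Lh.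
have LBs := L20_mp mp LB; have LCs := L20_mp mp LC; have Lfs := L20_mp mp Lf.
rewrite (ip_pvm PE)//.
rewrite (@ip_ae _ _ _ nu _ (fun y => (E B f \o S g) y + (E (~` B) f \o S g) y) _ (E B h)).
- rewrite ipDl; [|exact: L20_L2|exact: L20_L2|exact: L20_L2].
  rewrite (koopman_orthogonal g mBC mB _ Lf Lh) ?setICl// addr0.
  rewrite [RHS](@ip_ae _ _ _ nu _ (E B f \o S g) _ (fun y => E B h y + E (~` B) h y)).
  + rewrite ipDr; [|exact: L20_L2|exact: L20_L2|exact: L20_L2].
    by rewrite (koopman_orthogonal g mB mBC _ Lf Lh) ?setICr// addr0.
  + exact: L20_L2.
  + exact: L20_L2.
  + exact: L20_L2.
  + exact/L20_L2/L20D.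
  + exact: aeW.
  + exact: pvm_splitC.
- exact: L20_L2.
- exact/L20_L2/L20D.
- exact: L20_L2.
- exact: L20_L2.
- exact: (ae_nst (S g) (pvm_splitC mB Lf)).
- exact: aeW.
Qed.

(** The error of an approximate eigenvector stays in the range of [E B]; this is what keeps the
    errors of different cells orthogonal. *)
Lemma pvm_koopman_sub B f g (z : R[i]) : measurable B -> L20 nu f ->
  {ae nu, forall y, E B (fun y => E B f (S g y) - z * E B f y) y =
    E B f (S g y) - z * E B f y}.
Proof.
move=> mB Lf; have LB := pvm_L20 PE mB Lf.
have LBs := L20_mp (S_mp g) LB; have LzB := L20Z z LB.
have LNzB := L20Z (- z) LB.
have Lv : L20 nu (fun y => E B f (S g y) - z * E B f y) by exact: L20B.
have LEv := pvm_L20 PE mB Lv; have Ld := L20B LEv Lv.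
have idem : {ae nu, forall y, E B (E B f) y = E B f y}.
  by have := pvmI PE mB mB Lf; rewrite setIid; apply: filterS => y ->.
have test h : L20 nu h -> ip nu (E B (fun y => E B f (S g y) - z * E B f y)) h =
    ip nu (fun y => E B f (S g y) - z * E B f y) h.
  move=> Lh; have LEBs := pvm_L20 PE mB LBs; have LEN := pvm_L20 PE mB LNzB.
  rewrite (@ip_ae _ _ _ nu _ (fun y => E B (E B f \o S g) y + (- z) * E B f y) _ h).
  - rewrite ipDl; [|exact: L20_L2|exact: L20_L2|exact: L20_L2].
    rewrite koopman_pvm//.
    rewrite (@ip_ae _ _ _ nu _ (E B f \o S g) _ h).
    + rewrite -ipDl; [|exact: L20_L2|exact: L20_L2|exact: L20_L2].
      by congr (ip nu _ h); apply/funext => y; rewrite mulNr.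
    + exact/L20_L2/(L20_mp (S_mp g))/pvm_L20.
    + exact: L20_L2.
    + exact: L20_L2.
    + exact: L20_L2.
    + exact: (ae_nst (S g) idem).
    + exact: aeW.
  - exact: L20_L2.
  - exact/L20_L2/L20D.
  - exact: L20_L2.
  - exact: L20_L2.
  - have := pvmD PE mB LBs LNzB; have := pvmZ PE (- z) mB LB.
    have -> : (fun y => (E B f \o S g) y + - z * E B f y) =
      (fun y => E B f (S g y) - z * E B f y) by apply/funext => y; rewrite mulNr.
    move: idem; apply: filterS3 => y h1 h2 h3.
    by rewrite h3 h2 h1.
  - exact: aeW.
have : ip nu (fun y => E B (fun y => E B f (S g y) - z * E B f y) y -
    (E B f (S g y) - z * E B f y)) (fun y => E B (fun y => E B f (S g y) - z * E B f y) y -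
    (E B f (S g y) - z * E B f y)) = 0.
  by rewrite ipBl ?test ?subrr//; exact: L20_L2.
move=> /(nsq_eq0 (L20_L2 Ld)); apply: filterS => y /eqP.
by rewrite subr_eq0 => /eqP.
Qed.

(** The left side is the integral of [csq (chi (- g) - z)] against the spectral measure of [E B f],
    which gives no mass to the complement of [B]. The sign of [- g] is that of the spectral
    formula. *)
Lemma koopman_approx_scalar B f g (z : R[i]) (eps : R) : measurable B ->
  L20 nu f -> 0 <= eps ->
  (forall chi : dual R G, B chi -> csq (chi (- g) - z) <= eps) ->
  nsq nu (fun y => E B f (S g y) - z * E B f y) <= eps * nsq nu (E B f).
Proof.
move=> mB Lf eps0 Beps; have mBC := measurableC mB.
have Lu := pvm_L20 PE mB Lf; set u := E B f in Lu *.
have L2u := L20_L2 Lu; have L2us := L2_mp (S_mp g) L2u.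
have [s sE] := spectral_measure_exists PE Lu.
have sT : s setT = (nsq nu u)%:E.
  by rewrite sE//; congr EFin; apply: ip_ae => //; try exact: pvm_L2; exact: pvmT.
have sT' : (s setT < +oo)%E by rewrite sT ltry.
have sBC : s (~` B) = 0%E.
  rewrite sE//; congr EFin; apply: ip_ae0; try exact: pvm_L2.
  by apply: pvm_disjoint => //; rewrite setICl.
have [ir ii] := integrable_character_parts (- g) sT'.
pose a := Rintegral s setT (fun chi : borel_dual R G => complex.Re ((chi : dual R G) (- g))).
pose b := Rintegral s setT (fun chi : borel_dual R G => complex.Im ((chi : dual R G) (- g))).
have [Ea Eb] : ip nu (u \o S g) u = a /\ ip nu (u \o S g) (fun y => 'i%C * u y) = b.
  by have := koopman_diag g Lu sE; rewrite inner_ip => -[].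
(* This expression and the integral of [phi] are the same affine function of [a] and [b]: here
   because [S g] preserves the norm, there because characters have modulus 1. *)
have -> : nsq nu (fun y => u (S g y) - z * u y) =
    (1 + csq z) * nsq nu u - (complex.Re z * a + complex.Im z * b) *+ 2.
  have -> : (fun y => u (S g y) - z * u y) = (fun y => (u \o S g) y + (- z) * u y).
    by apply/funext => y; rewrite mulNr.
  have LNz := L2Z (- z) L2u.
  rewrite nsqD// nsqZ// {1}/nsq (ip_mp (S_mp g))// -/(nsq nu u).
  rewrite (ipC _ _ (fun y => - z * u y)) ipZl// ipC Ea (ipC _ _ (u \o S g)) Eb.
  by case: (z) => z1 z2; rewrite /csq/= !sqrrN; ring.
pose phi (chi : borel_dual R G) := csq ((chi : dual R G) (- g) - z).
have phiE chi : phi chi = (1 + csq z) - 2 * (complex.Re z * complex.Re ((chi : dual R G) (- g)) +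
    complex.Im z * complex.Im ((chi : dual R G) (- g))).
  have := csq_character chi (- g); rewrite /phi.
  case: (chi (- g)) (z) => c1 c2 [z1 z2]; rewrite /csq/= => h.
  apply/eqP; rewrite -subr_eq0; apply/eqP.
  by rewrite -[RHS](subrr 1) -{1}h; ring.
have icst (k : R) : s.-integrable setT (EFin \o (fun=> k)).
  apply: measurable_bounded_integrable => //.
  by exists `|k|; split => // x kx chi _ /=; exact: ltW.
have i1 : s.-integrable setT (EFin \o (fun chi : borel_dual R G =>
    complex.Re z * complex.Re ((chi : dual R G) (- g)))).
  exact: (integrableZl measurableT (complex.Re z) ir).
have i2 : s.-integrable setT (EFin \o (fun chi : borel_dual R G =>
    complex.Im z * complex.Im ((chi : dual R G) (- g)))).
  exact: (integrableZl measurableT (complex.Im z) ii).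
have i12 : s.-integrable setT (EFin \o (fun chi : borel_dual R G =>
    complex.Re z * complex.Re ((chi : dual R G) (- g)) +
    complex.Im z * complex.Im ((chi : dual R G) (- g)))).
  exact: (integrableD measurableT i1 i2).
have i3 : s.-integrable setT (EFin \o (fun chi : borel_dual R G =>
    2 * (complex.Re z * complex.Re ((chi : dual R G) (- g)) +
    complex.Im z * complex.Im ((chi : dual R G) (- g))))).
  exact: (integrableZl measurableT 2 i12).
have iphi : s.-integrable setT (EFin \o phi).
  rewrite (funext phiE); exact: (integrableB measurableT (icst (1 + csq z)) i3).
have Iphi : Rintegral s setT phi = (1 + csq z) * nsq nu u -
    (complex.Re z * a + complex.Im z * b) *+ 2.
  rewrite (funext phiE) RintegralB// Rintegral_cst// RintegralZl// RintegralD//.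
  by rewrite RintegralZl// RintegralZl// [s _]sT -/a -/b /=; ring.

have mphi : measurable_fun setT (EFin \o phi) by case/integrableP : iphi.
rewrite -Iphi -lee_fin /Rintegral fineK; last exact: integrable_fin_num.
apply: (@le_trans _ _ (\int[s]_(chi in setT) eps%:E)%E); last first.
  by rewrite integral_cst// [s _]sT EFinM.
apply: ae_ge0_le_integral => //.
- by move=> chi _; rewrite lee_fin csq_ge0.
- exists (~` B); split => // chi /= nle Bchi; apply: nle => _.
  by rewrite lee_fin; exact: Beps.
Qed.

End koopman_representation.

Lemma ae_nst_inv (R : realType) d (X : measurableType d) (m : probability X R)
    (T : nst m) (P : X -> Prop) :
  {ae m, forall x, P (T x)} -> {ae m, forall x, P x}.
Proof.
move=> [N [mN N0 PN]].
have mN' : measurable (nst_inv T @^-1` N) by exact: measurable_preimage_inv.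
exists (nst_inv T @^-1` N); split => //.
  apply/(nst_null T mN'); rewrite -[RHS]N0; congr (m _).
  by apply/seteqP; split => x /=; rewrite nst_funK.
by move=> x /= nP; apply: PN; rewrite /= nst_invK.
Qed.

(** * Product spaces, tensors and product maps *)

Section product_spaces.
Context (R : realType) dX (X : measurableType dX) dY (Y : measurableType dY).
Context (m : probability X R) (nu : probability Y R).

Local Notation mn := (m \x nu)%E.

Lemma prod_null_sections (A : set (X * Y)) : measurable A ->
  mn A = 0%E <-> {ae m, forall x, nu (xsection A x) = 0%E}.
Proof.
move=> mA; rewrite /product_measure1 /=.
have mf := measurable_fun_xsection nu mA.
have abs : (\int[m]_x `|(nu \o xsection A) x| = \int[m]_x (nu \o xsection A) x)%E.
  by apply: eq_integral => x _; rewrite gee0_abs//=.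
split=> [h|h].
  have := (ae_eq_integral_abs m measurableT mf).1.
  rewrite abs => /(_ h); apply: filterS => x; exact.
rewrite -abs; apply/(ae_eq_integral_abs m measurableT mf).
by move: h; apply: filterS => x ? _.
Qed.

Lemma ae_prod_sections (P : X * Y -> Prop) : {ae mn, forall p, P p} ->
  {ae m, forall x, {ae nu, forall y, P (x, y)}}.
Proof.
move=> [N [mN N0 PN]]; have := (prod_null_sections mN).1 N0.
apply: filterS => x nN; exists (xsection N x); split => //.
  exact: measurable_xsection.
by move=> y /= nP; rewrite /xsection/= inE; apply: PN.
Qed.

Lemma ae_prod_fst (P : X -> Prop) : {ae m, forall x, P x} -> {ae mn, forall p, P p.1}.
Proof.
move=> [N [mN N0 PN]]; exists (N `*` setT); split.
- exact: measurableX.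
- by rewrite product_measure1E// [X in (X * _)%E]N0 mul0e.
- by move=> p /= nP; split => //; apply: PN.
Qed.

Lemma measurable_fun_section (F : X * Y -> R) x : measurable_fun setT F ->
  measurable_fun setT (fun y => F (x, y)).
Proof. by move=> mF; exact: (measurableT_comp mF (pair1_measurable x)). Qed.

Lemma Int_prod (F : X * Y -> R) : intg mn F ->
  (forall x, intg nu (fun y => F (x, y))) ->
  intg m (fun x => Int nu (fun y => F (x, y))) /\
  Int mn F = Int m (fun x => Int nu (fun y => F (x, y))).
Proof.
move=> IF sF.
have E : EFin \o (fun x => Int nu (fun y => F (x, y))) = fubini_F nu (EFin \o F).
  by apply/funext => x; rewrite /= EFin_Int.
split; first by rewrite /intg E; exact: integrable_fubini_F.
congr fine; rewrite -(integral12_prod_meas1 IF) -E.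
by apply: eq_integral.
Qed.

Lemma Int_prod_swap (F : X * Y -> R) : intg mn F ->
  (forall y, intg m (fun x => F (x, y))) ->
  measurable_fun setT (fun y => Int m (fun x => F (x, y))) /\
  Int mn F = Int nu (fun y => Int m (fun x => F (x, y))).
Proof.
move=> IF sF.
have E : EFin \o (fun y => Int m (fun x => F (x, y))) = fubini_G m (EFin \o F).
  by apply/funext => x; rewrite /= EFin_Int.
split.
  by apply/measurable_EFinP; rewrite E; exact: (measurable_fubini_G IF).
congr fine; rewrite -(integral21_prod_meas1 IF) -E.
by apply: eq_integral.
Qed.

Lemma measurable_tensor (a : X -> R) (b : Y -> R) : measurable_fun setT a ->
  measurable_fun setT b -> measurable_fun setT (fun p : X * Y => a p.1 * b p.2).
Proof.
by move=> ma mb; apply: measurable_funM; apply: measurableT_comp.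
Qed.

Lemma Int_tensor (a : X -> R) (b : Y -> R) : intg m a -> intg nu b ->
  intg mn (fun p => a p.1 * b p.2) /\
  Int mn (fun p => a p.1 * b p.2) = Int m a * Int nu b.
Proof.
move=> Ia Ib; have ma := intg_measurable Ia; have mb := intg_measurable Ib.
have mab := measurable_tensor ma mb.
have Iab : intg mn (fun p => a p.1 * b p.2).
  apply/(integrable12ltyP m nu); first exact/measurable_EFinP.
  rewrite (_ : integral _ _ _ = (\int[m]_x (Int nu (fun y => `|b y|) * `|a x|)%:E)%E).
    by rewrite -EFin_Int ?ltry//; exact/intgZ/intg_norm.
  apply: eq_integral => x _; rewrite mulrC -IntZ; last exact: intg_norm.
  rewrite EFin_Int; last exact/intgZ/intg_norm.
  by apply: eq_integral => y _; rewrite /= normrM.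
split => //; have [_ ->] := Int_prod Iab (fun x => intgZ (a x) Ib).
rewrite mulrC -IntZ//; congr Rintegral; apply/funext => x /=.
by rewrite IntZ// mulrC.
Qed.

Lemma sqi_tensor (a : X -> R) (b : Y -> R) : sqi m a -> sqi nu b ->
  sqi mn (fun p => a p.1 * b p.2).
Proof.
move=> [ma Ia] [mb Ib]; split; first exact: measurable_tensor.
have [+ _] := Int_tensor Ia Ib.
by under eq_fun do rewrite -exprMn.
Qed.

Definition tensor (f : X -> R[i]^o) (u : Y -> R[i]^o) (p : X * Y) : R[i]^o :=
  f p.1 * u p.2.

Lemma L2_tensor f u : L2 m f -> L2 nu u -> L2 mn (tensor f u).
Proof.
move=> /L2P[fr fi] /L2P[ur ui]; apply/L2P; split.
  under eq_fun do rewrite ReMo.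
  by apply: sqiB; [exact: (sqi_tensor fr ur)|exact: (sqi_tensor fi ui)].
under eq_fun do rewrite ImMo.
by apply: sqiD; [exact: (sqi_tensor fr ui)|exact: (sqi_tensor fi ur)].
Qed.

(** The complex inner product is multiplicative on tensors; this is the real part of the product. *)
Lemma ip_tensor f f' u u' : L2 m f -> L2 m f' -> L2 nu u -> L2 nu u' ->
  ip mn (tensor f u) (tensor f' u') = ip m f f' * ip nu u u' -
    ip m f (fun x => 'i%C * f' x) * ip nu u (fun y => 'i%C * u' y).
Proof.
move=> Lf Lf' Lu Lu'.
have Lif := L2Z 'i%C Lf'; have Liu := L2Z 'i%C Lu'.
have [I1 E1] := Int_tensor (intg_ip Lf Lf') (intg_ip Lu Lu').
have [I2 E2] := Int_tensor (intg_ip Lf Lif) (intg_ip Lu Liu).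
rewrite /ip -E1 -E2 -IntB//.
congr Rintegral; apply/funext => -[x y]; rewrite /tensor /=.
by case: (f x) (f' x) (u y) (u' y) => a1 b1 [a2 b2] [a3 b3] [a4 b4] /=; ring.
Qed.

Lemma ip_i0 d (Z : measurableType d) (mu : probability Z R) (f : Z -> R[i]^o) :
  L2 mu f -> ip mu f (fun x => 'i%C * f x) = 0.
Proof.
move=> Lf; rewrite -[RHS](Int_cst mu 0); congr Rintegral; apply/funext => x.
by case: (f x) => a b /=; ring.
Qed.

Lemma nsq_tensor f u : L2 m f -> L2 nu u -> nsq mn (tensor f u) = nsq m f * nsq nu u.
Proof. by move=> Lf Lu; rewrite /nsq ip_tensor// !ip_i0// mulr0 subr0. Qed.

Section product_transformation.
Context (T : nst m) (S : nst nu).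

Let TS (p : X * Y) := (T p.1, S p.2).
Let TSi (p : X * Y) := (nst_inv T p.1, nst_inv S p.2).

Let TSK : cancel TS TSi.
Proof. by move=> [x y]; rewrite /TSi /TS /= !nst_funK. Qed.

Let TSiK : cancel TSi TS.
Proof. by move=> [x y]; rewrite /TSi /TS /= !nst_invK. Qed.

Let mTS : measurable_fun setT TS.
Proof.
apply: measurable_fun_pair.
  by apply: measurableT_comp => //; exact: nst_measurable_fun.
by apply: measurableT_comp => //; exact: nst_measurable_fun.
Qed.

Let mTSi : measurable_fun setT TSi.
Proof.
apply: measurable_fun_pair.
  by apply: measurableT_comp => //; exact: nst_measurable_inv.
by apply: measurableT_comp => //; exact: nst_measurable_inv.
Qed.

Let TS_null (A : set (X * Y)) : measurable A -> mn A = 0%E <-> mn (TS @^-1` A) = 0%E.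
Proof.
move=> mA.
have mTA : measurable (TS @^-1` A) by rewrite -[X in measurable X]setTI; exact: mTS.
rewrite (prod_null_sections mA) (prod_null_sections mTA).
have secE x : xsection (TS @^-1` A) x = S @^-1` (xsection A (T x)).
  by apply/seteqP; split => y; rewrite /xsection/= !inE.
have nullE x : nu (xsection (TS @^-1` A) x) = 0%E <-> nu (xsection A (T x)) = 0%E.
  by rewrite secE; apply: iff_sym; apply: nst_null; exact: measurable_xsection.
split=> [h|h].
  by have := ae_nst T h; apply: filterS => x /nullE.
apply: (ae_nst_inv (T := T)); move: h; apply: filterS => x; exact: (nullE x).1.
Qed.

(** As an [nst] of the product measure, the product map falls under the lemmas on invariant
    functions and weak limits. *)
Definition prod_nst : nst mn :=
  @Nst _ _ _ (m \x nu)%E TS TSi TSK TSiK mTS mTSi TS_null.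

End product_transformation.
End product_spaces.

(* A measurable map to an initial segment of nat encodes a finite measurable
   partition of the dual into cells, its level sets. *)
Definition finite_code (R : realType) (G : topologicalZmodType)
    (c : dual R G -> nat) (N : nat) : Prop :=
  (forall chi, (c chi < N)%N) /\
  forall k, measurable (c @^-1` [set k] : set (borel_dual R G)).

(** * Fine finite partitions of the dual *)

Section finite_codes.
Context (R : realType) (G : topologicalZmodType).

(** The common refinement, with the pair of codes written in base [N']. *)
Lemma finite_code_pair (c c' : dual R G -> nat) N N' :
  finite_code c N -> finite_code c' N' ->
  finite_code (fun chi => c chi * N' + c' chi)%N (N * N')%N.
Proof.
move=> [cN mc] [cN' mc'].
have N'0 (chi : dual R G) : (0 < N')%N by exact: leq_ltn_trans (cN' chi).
split=> [chi|k].
  rewrite -ltn_divLR ?N'0// divnMDl ?(N'0 chi)//.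
  by rewrite divn_small ?cN'// addn0.
rewrite (_ : _ @^-1` _ = (c @^-1` [set (k %/ N')%N]) `&` (c' @^-1` [set (k %% N')%N])).
  exact: measurableI.
apply/seteqP; split => [chi /= <-|chi /= [-> ->]]; last by rewrite -divn_eq.
rewrite divnMDl ?(N'0 chi)// modnMDl divn_small ?modn_small ?cN'//.
by rewrite addn0.
Qed.

(** The code is the integer part of [(r + 1) * K]. The shift makes it nonnegative, and the value
    [2 * K], taken at [r = 1], accounts for the successor. *)
Lemma finite_code_real (r : borel_dual R G -> R) (K : nat) :
  measurable_fun setT r -> (forall chi, `|r chi| <= 1) ->
  exists c : dual R G -> nat, exists2 N, finite_code c N &
    forall chi chi', c chi = c chi' -> `|r chi - r chi'| * K%:R <= 1.
Proof.
move=> mr r1.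
have r0 chi : 0 <= (r chi + 1) * K%:R.
  by rewrite mulr_ge0//; have := r1 chi; rewrite ler_norml; lra.
exists (fun chi => Num.trunc ((r chi + 1) * K%:R)); exists (2 * K).+1.
  split=> [chi|k].
    rewrite ltnS -(ler_nat R); have /andP[h _] := truncn_itv (r0 chi).
    apply: le_trans h _; rewrite natrM ler_wpM2r//.
    by have := r1 chi; rewrite ler_norml; lra.
  rewrite (_ : _ @^-1` _ = [set chi | k%:R <= (r chi + 1) * K%:R] `&`
      [set chi | (r chi + 1) * K%:R < k.+1%:R]); last first.
    apply/seteqP; split => chi /=.
      by move=> <-; have /andP[] := truncn_itv (r0 chi).
    by move=> [h1 h2]; apply: truncn_def; rewrite h1 h2.
  have mrK : measurable_fun setT (fun chi : borel_dual R G => (r chi + 1) * K%:R).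
    by apply: measurable_funM => //; apply: measurable_funD.
  have mrN : measurable_fun setT (fun chi : borel_dual R G => - ((r chi + 1) * K%:R)).
    exact: measurableT_comp.
  apply: measurableI.
    by under eq_set do rewrite -lerN2; exact: measurable_sublevel.
  rewrite (_ : [set _ | _] = ~` [set chi | k.+1%:R <= (r chi + 1) * K%:R]); last first.
    by apply/seteqP; split => chi /=; [rewrite ltNge => /negP|move=> /negP; rewrite -ltNge].
  by apply: measurableC; under eq_set do rewrite -lerN2; exact: measurable_sublevel.
move=> chi chi' e.
have /andP[a1 a2] := truncn_itv (r0 chi).
have := truncn_itv (r0 chi'); rewrite -e => /andP[b1 b2].
rewrite -(ger0_norm (ler0n R K)) -normrM ler_norml.
move: a1 a2 b1 b2; rewrite -[(Num.trunc _).+1]addn1 natrD.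
by lra.
Qed.

Lemma finite_code_close (Phi : seq G) (eps : R) : 0 < eps ->
  exists c : dual R G -> nat, exists2 N, finite_code c N &
    forall chi chi', c chi = c chi' ->
      forall g, g \in Phi -> csq (chi g - chi' g) <= eps.
Proof.
move=> eps0.
(* Real and imaginary parts vary by at most [1 / K] on a cell and each contributes at most [1 / K]
   to [csq]; hence [2 / K <= eps] is enough. *)
pose K := (Num.trunc (2 / eps)).+1.
have Keps : 2 / eps <= K%:R by exact/ltW/truncnS_gt.
have K1 : (1 : R) <= K%:R by rewrite ler1n.
elim: Phi => [|g Phi [c [N cN cE]]].
  exists (fun=> 0%N); exists 1%N => //; split => // k.
  have [->|k0] := eqVneq k 0%N.
    by rewrite (_ : _ @^-1` _ = setT)//; apply/seteqP; split.
  rewrite (_ : _ @^-1` _ = set0)//; apply/seteqP; split => // chi /= /esym /eqP.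
  by rewrite (negbTE k0).
have re1 (chi : borel_dual R G) : `|complex.Re ((chi : dual R G) g)| <= 1.
  have c1 := csq_character (chi : dual R G) g.
  rewrite -(@ler_pXn2r _ 2)// ?nnegrE// expr1n real_normK ?num_real// -c1.
  by rewrite lerDl sqr_ge0.
have im1 (chi : borel_dual R G) : `|complex.Im ((chi : dual R G) g)| <= 1.
  have c1 := csq_character (chi : dual R G) g.
  rewrite -(@ler_pXn2r _ 2)// ?nnegrE// expr1n real_normK ?num_real// -c1.
  by rewrite lerDr sqr_ge0.
have [cr [Nr crN crE]] := finite_code_real K (@measurable_Re_eval R G g) re1.
have [ci [Ni ciN ciE]] := finite_code_real K (@measurable_Im_eval R G g) im1.
exists (fun chi => (c chi * (Nr * Ni) + (cr chi * Ni + ci chi)))%N.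
exists (N * (Nr * Ni))%N.
  by apply: finite_code_pair => //; exact: finite_code_pair.
move=> chi chi' e.
have [ric rii] : (c chi = c chi' /\ (cr chi = cr chi' /\ ci chi = ci chi'))%N.
  have Ni0 : (0 < Ni)%N by exact: leq_ltn_trans (ciN.1 chi).
  have Nri0 : (0 < Nr * Ni)%N.
    by rewrite muln_gt0 Ni0 andbT; exact: leq_ltn_trans (crN.1 chi).
  have [lt _] := finite_code_pair crN ciN.
  have e1 : c chi = c chi'.
    have := congr1 (fun n => n %/ (Nr * Ni))%N e.
    by rewrite !divnMDl// !(divn_small (lt _)) !addn0.
  have e2 : (cr chi * Ni + ci chi = cr chi' * Ni + ci chi')%N.
    have := congr1 (fun n => n %% (Nr * Ni))%N e.
    by rewrite !modnMDl !(modn_small (lt _)).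
  split => //; split.
    have := congr1 (fun n => n %/ Ni)%N e2.
    by rewrite !divnMDl// !(divn_small (ciN.1 _)) !addn0.
  have := congr1 (fun n => n %% Ni)%N e2.
  by rewrite !modnMDl !(modn_small (ciN.1 _)).
move=> h; rewrite inE => /orP[/eqP ->|]; last exact: cE.
have hr := crE _ _ rii.1; have hi := ciE _ _ rii.2.
rewrite /csq (raddfB (@complex.Re R)) (raddfB (@complex.Im R)) /=.
rewrite -(real_normK (num_real (_ - complex.Re _))) -(real_normK (num_real (_ - complex.Im _))).
move: hr hi; move: `|_| (normr_ge0 (complex.Re (chi g) - complex.Re (chi' g))) => p p0.
move: `|_| (normr_ge0 (complex.Im (chi g) - complex.Im (chi' g))) => q q0 hp hq.
have Ke : 2 <= K%:R * eps by rewrite -ler_pdivrMr.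
have p2 : p ^+ 2 * K%:R <= 1.
  have : p <= 1 by apply: le_trans hp; rewrite ler_peMr.
  by nra.
have q2 : q ^+ 2 * K%:R <= 1.
  have : q <= 1 by apply: le_trans hq; rewrite ler_peMr.
  by nra.
have K0 : (0 : R) < K%:R by lra.
rewrite -(ler_pM2r K0); lra.
Qed.

Context d (Y : measurableType d) (nu : probability Y R).
Context (E : set (borel_dual R G) -> (Y -> R[i]^o) -> (Y -> R[i]^o)).
Hypothesis PE : projection_valued_measure nu E.

Lemma ip_pvm_code c N (P : set (borel_dual R G)) f h : finite_code c N ->
  measurable P -> L20 nu f -> L20 nu h ->
  ip nu (E P f) h = \sum_(k <- iota 0 N) ip nu (E (c @^-1` [set k] `&` P) f) h.
Proof.
move=> [cN mc] mP Lf Lh.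
have mlt n : measurable ([set chi | (c chi < n)%N] : set (borel_dual R G)).
  elim: n => [|n ih].
    by rewrite (_ : [set _ | _] = set0)//; apply/seteqP; split => chi.
  rewrite (_ : [set _ | _] = [set chi | (c chi < n)%N] `|` c @^-1` [set n]).
    exact: measurableU.
  apply/seteqP; split => chi /=.
    by rewrite ltnS leq_eqVlt => /orP[/eqP|]; [right|left].
  by move=> [lt|->]; rewrite ltnS// ltnW.
have step n : ip nu (E ([set chi | (c chi < n)%N] `&` P) f) h =
    \sum_(k <- iota 0 n) ip nu (E (c @^-1` [set k] `&` P) f) h.
  elim: n => [|n ih].
    rewrite big_nil (_ : [set _ | _] `&` P = set0).
      by apply: ip_ae0; [exact: pvm_L2|exact: L20_L2|exact: pvm0].
    by apply/seteqP; split => chi // [].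
  rewrite -addn1 iotaD big_cat/= big_seq1 add0n -ih -(ip_pvmU PE)//.
  - congr (ip nu (E _ f) h); apply/seteqP; split => chi /=.
      by rewrite addn1 ltnS leq_eqVlt => -[/orP[/eqP|] ? ?]; [right|left].
    by move=> [[lt ?]|[-> ?]]; rewrite addn1 ltnS; split => //; exact: ltnW.
  - exact: measurableI.
  - exact: measurableI.
  - apply/seteqP; split => chi // [[/= h1 _] [h2 _]].
    by move: h1; rewrite h2 ltnn.
rewrite -step; congr (ip nu (E _ f) h).
by apply/seteqP; split => [chi Pchi|chi []//]; split => //=; exact: cN.
Qed.

End finite_codes.

(** * Ergodicity of the product implies nullity of the eigenvalues *)

Section ergodic_product_null.
Context (R : realType) (G : topologicalZmodType).
Context dX (X : measurableType dX) (m : probability X R) (T : G -> nst m).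
Context dY (Y : measurableType dY) (nu : probability Y R) (S : G -> nst nu).
Hypothesis S_mp : forall g A, measurable A -> nu (S g @^-1` A) = nu A.
Context (E : set (borel_dual R G) -> (Y -> R[i]^o) -> (Y -> R[i]^o)).
Hypothesis SE : is_spectral_measure nu (fun g => S g) E.
Context (C : set X) (M : R).
Hypothesis mC : measurable C.

Local Notation mn := (m \x nu)%E.
Local Notation P := (eigenset T C M).

Let PE : projection_valued_measure nu E := SE.1.
Let mP : measurable (P : set (borel_dual R G)).
Proof. exact: measurable_eigenset. Qed.

Lemma ip_i_centered_indic D (f : Y -> R[i]^o) : measurable D -> L20 nu f ->
  ip nu f (fun y => 'i%C * centered_indic nu D y) =
  Int nu (fun y => complex.Im (f y) * \1_D y).
Proof.
move=> mD /L20P[Lf fr fi]; have ii := sqi_intg (L2Im Lf).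
have -> : ip nu f (fun y => 'i%C * centered_indic nu D y) = Int nu (fun y =>
    complex.Im (f y) * \1_D y - fine (nu D) * complex.Im (f y)).
  by congr Rintegral; apply/funext => y; rewrite /centered_indic/=; ring.
by rewrite IntB ?IntZ ?fi ?mulr0 ?subr0//; [exact: intgM_indic|exact: intgZ].
Qed.

Lemma ip_pvm_disjointZ (c : R[i]) A B f h : measurable A -> measurable B ->
  A `&` B = set0 -> L20 nu f -> L20 nu h ->
  ip nu (E A f) (fun y => c * E B h y) = 0.
Proof.
move=> mA mB AB Lf Lh; have Lch := L20Z c Lh.
rewrite (@ip_ae _ _ _ nu _ (E A f) _ (E B (fun y => c * h y))).
- by rewrite (ip_pvm_disjoint PE).
- exact: (pvm_L2 PE).
- exact: (pvm_L2 PE).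
- exact/L2Z/(pvm_L2 PE).
- exact: (pvm_L2 PE).
- exact: aeW.
- by have := pvmZ PE c mB Lh; apply: filterS => y ->.
Qed.

(** Normalisation makes [f] drop out of the mean, so a different eigenfunction may be used in each
    cell without changing the mean of the sum. *)
Lemma Int_tensor_rectangle (f : X -> R[i]^o) (u : Y -> R[i]^o) D :
  L2 m f -> L2 nu u -> measurable D ->
  Int m (fun x => complex.Re (f x) * \1_C x) = 1 ->
  Int m (fun x => complex.Im (f x) * \1_C x) = 0 ->
  Int mn (fun p => complex.Re (tensor f u p) * \1_(C `*` D) p) =
    Int nu (fun y => complex.Re (u y) * \1_D y) /\
  Int mn (fun p => complex.Im (tensor f u p) * \1_(C `*` D) p) =
    Int nu (fun y => complex.Im (u y) * \1_D y).
Proof.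
move=> Lf Lu mD f1 f0.
have fr := intgM_indic (sqi_intg (L2Re Lf)) mC.
have fi := intgM_indic (sqi_intg (L2Im Lf)) mC.
have ur := intgM_indic (sqi_intg (L2Re Lu)) mD.
have ui := intgM_indic (sqi_intg (L2Im Lu)) mD.
have indX p : \1_(C `*` D) p = \1_C p.1 * \1_D p.2 :> R.
  rewrite !indicE in_setX; case: (_ \in C); case: (_ \in D);
    by rewrite /= ?mulr1 ?mulr0.
have [rr rrE] := Int_tensor fr ur; have [ri riE] := Int_tensor fr ui.
have [ir irE] := Int_tensor fi ur; have [ii iiE] := Int_tensor fi ui.
split.
  rewrite -[RHS]mul1r -[RHS]subr0 -[X in _ = _ - X](mul0r (Int nu (fun y => complex.Im (u y) * \1_D y))).
  rewrite -{1}f1 -f0 -rrE -iiE -IntB//.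
  by congr Rintegral; apply/funext => p; rewrite indX /tensor ReMo; ring.
rewrite -[RHS]mul1r -[RHS]addr0 -[X in _ = _ + X](mul0r (Int nu (fun y => complex.Re (u y) * \1_D y))).
rewrite -{1}f1 -f0 -riE -irE -IntD//.
by congr Rintegral; apply/funext => p; rewrite indX /tensor ImMo; ring.
Qed.

(** In each cell the eigenfunction gains the factor [chi_ k g] and the spectral component nearly the
    factor [chi_ k (- g)], and the two cancel. Terms and errors of different cells are orthogonal,
    so the bounds add up to the mass of [E P h] whatever the number of cells. The relation holds for
    all [g]; only the size of [r] depends on [Phi]. *)
Lemma approximate_invariant_function h (chi0 : dual R G) (Phi : seq G) (eps : R) :
  L20 nu h -> P chi0 -> 0 < eps ->
  exists F : X * Y -> R[i]^o,
    [/\ L2 mn F, nsq mn F <= (M + M) * nsq nu (E P h),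
     forall D, measurable D ->
       Int mn (fun p => complex.Re (F p) * \1_(C `*` D) p) =
         Int nu (fun y => complex.Re (E P h y) * \1_D y) /\
       Int mn (fun p => complex.Im (F p) * \1_(C `*` D) p) =
         Int nu (fun y => complex.Im (E P h y) * \1_D y)
     & forall g, exists r : X * Y -> R[i]^o,
       [/\ L2 mn r, {ae mn, forall p, F (prod_nst (T g) (S g) p) = F p + r p} &
         - g \in Phi -> nsq mn r <= (M + M) * (eps * nsq nu (E P h))]].
Proof.
move=> Lh P0 eps0; set u := E P h.
have [c [N cN cE]] := finite_code_close Phi eps0.
have mc k : measurable (c @^-1` [set k] : set (borel_dual R G)) by exact: cN.2.
pose V k : set (borel_dual R G) := c @^-1` [set k] `&` P.
have mV k : measurable (V k) by exact: measurableI.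
have V0 k l : k != l -> V k `&` V l = set0.
  move=> kl; apply/seteqP; split => // chi [[/= ck _] [/= cl _]].
  by move: kl; rewrite -ck -cl eqxx.
(* An empty cell receives [chi0] only so that an eigenfunction can be chosen; its spectral component
   is 0 almost everywhere. *)
have exchi k : exists chi : dual R G, P chi /\ forall chi', V k chi' -> V k chi.
  have [[chi Vchi]|nV] := pselect (exists chi, V k chi).
    by exists chi; split => //; case: Vchi.
  by exists chi0; split => // chi' Vchi'; exfalso; apply: nV; exists chi'.
pose chi_ k := sval (cid (exchi k)).
have chiP k : P (chi_ k) by have [] := svalP (cid (exchi k)).
have chiV k chi' : V k chi' -> V k (chi_ k).
  by have [_] := svalP (cid (exchi k)); apply.
pose f k := sval (cid (chiP k)).
have fP k := svalP (cid (chiP k)); rewrite -/(f _) in fP.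
have Lf k : L2 m (f k) by have [] := fP k.
have nf k : nsq m (f k) <= M + M.
  by rewrite nsq_Re_Im//; have [_ [? ?] _ _ _] := fP k; exact: lerD.
pose v k := E (V k) h.
have Lv0 k : L20 nu (v k) by exact: (pvm_L20 PE).
have Lv k : L2 nu (v k) by exact: L20_L2.
have nv : \sum_(k <- iota 0 N) nsq nu (v k) = nsq nu u.
  rewrite (nsq_pvm PE)// (ip_pvm_code PE cN)//.
  by apply: eq_bigr => k _; rewrite (nsq_pvm PE).
have M0 : 0 <= M + M by exact: le_trans (nsq_ge0 m (f 0%N)) (nf 0%N).
have uniqN : pairwise (fun k l : nat => k != l) (iota 0 N).
  by rewrite -uniq_pairwise iota_uniq.
exists (fun p => \sum_(k <- iota 0 N) tensor (f k) (v k) p); split.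
- by apply: L2_sum => k; exact: L2_tensor.
- rewrite (@nsq_sum_orthogonal _ _ _ _ _ _ (fun k => tensor (f k) (v k)) (fun k l : nat => k != l))//.
  + rewrite -nv mulr_sumr; apply: ler_sum => k _.
    by rewrite nsq_tensor// ler_wpM2r// nsq_ge0.
  + by move=> k; exact: L2_tensor.
  + move=> k l kl; rewrite ip_tensor// (ip_pvm_disjoint PE)// ?V0//.
    by rewrite ip_pvm_disjointZ ?V0// !mulr0 subr0.
- move=> D mD.
  have mCD : measurable (C `*` D) by exact: measurableX.
  have LF k : L2 mn (tensor (f k) (v k)) by exact: L2_tensor.
  have tE k := Int_tensor_rectangle (Lf k) (Lv k) mD
    (let: And5 _ _ h1 _ _ := fP k in h1) (let: And5 _ _ _ h1 _ := fP k in h1).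
  split.
    under eq_fun do rewrite Re_sum mulr_suml.
    rewrite Int_sum; last by move=> k; apply: intgM_indic => //; exact/sqi_intg/L2Re.
    rewrite (eq_bigr _ (fun k _ => (tE k).1)).
    rewrite -ip_centered_indic//; last exact: (pvm_L20 PE).
    rewrite (ip_pvm_code PE cN)//; last exact: L20_centered_indic.
    by apply: eq_bigr => k _; rewrite (ip_centered_indic mD (Lv0 k)).
  under eq_fun do rewrite Im_sum mulr_suml.
  rewrite Int_sum; last by move=> k; apply: intgM_indic => //; exact/sqi_intg/L2Im.
  rewrite (eq_bigr _ (fun k _ => (tE k).2)).
  rewrite -ip_i_centered_indic//; last exact: (pvm_L20 PE).
  rewrite (ip_pvm_code PE cN)//; last exact/L20Z/L20_centered_indic.
  by apply: eq_bigr => k _; rewrite (ip_i_centered_indic mD (Lv0 k)).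
- move=> g.
  pose w k y : R[i]^o := v k (S g y) - chi_ k (- g) * v k y.
  have Lw0 k : L20 nu (w k) by apply: L20B; [exact: (L20_mp (S_mp g))|exact: L20Z].
  have Lw k : L2 nu (w k) by exact: L20_L2.
  (* [w k] is the error of [v k] under [S g]; lying in the range of [E (V k)], these errors are
     mutually orthogonal. *)
  have wE k : {ae nu, forall y, w k y = E (V k) (w k) y}.
    by have := pvm_koopman_sub S_mp SE g (chi_ k (- g)) (mV k) Lh; apply: filterS => y ->.
  have Lcw k : L2 m (fun x => chi_ k g * f k x) by exact: L2Z.
  exists (fun p => \sum_(k <- iota 0 N) tensor (fun x => chi_ k g * f k x) (w k) p); split.
  + by apply: L2_sum => k; exact: L2_tensor.
  + have af : {ae m, forall x, forall k, f k (T g x) = chi_ k g * f k x}.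
      by apply: ae_foralln => k; have [_ _ _ _] := fP k; apply.
    have := ae_prod_fst nu af; apply: filterS => -[x y] /= hx.
    rewrite -big_split /=; apply: eq_bigr => k _; rewrite /tensor /= hx /w mulrBr.
    have := characterMN (chi_ k) g => ch.
    rewrite [X in _ = _ + (_ - X)](_ : _ = f k x * v k y); last first.
      by rewrite mulrACA ch mul1r.
    by rewrite addrC subrK.
  + move=> gPhi.
    rewrite (@nsq_sum_orthogonal _ _ _ _ _ _ (fun k => tensor (fun x => chi_ k g * f k x) (w k))
      (fun k l : nat => k != l))//.
    * rewrite -nv !mulr_sumr; apply: ler_sum => k _.
      rewrite nsq_tensor// nsqZ// csq_character mul1r.
      apply: ler_pM => //; [exact: nsq_ge0|exact: nsq_ge0|].
      apply: (koopman_approx_scalar S_mp SE) => //; first exact: ltW.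
      move=> chi Vchi; have [ck _] := chiV k chi Vchi.
      by apply: cE => //; case: Vchi => /= -> _; rewrite ck.
    * by move=> k; exact: L2_tensor.
    * move=> k l kl; rewrite ip_tensor//.
      have LEw j := pvm_L20 PE (mV j) (Lw0 j).
      rewrite (ip_ae (Lw k) (L20_L2 (LEw k)) (Lw l) (L20_L2 (LEw l)) (wE k) (wE l)).
      rewrite (ip_pvm_disjoint PE)// ?V0// mulr0 sub0r.
      have Liw := L2Z 'i%C (Lw l); have Liw' := L2Z 'i%C (L20_L2 (LEw l)).
      rewrite (ip_ae (Lw k) (L20_L2 (LEw k)) Liw Liw' (wE k)).
        by rewrite ip_pvm_disjointZ ?V0// mulr0 oppr0.
      by have := wE l; apply: filterS => y <-.
Qed.

End ergodic_product_null.

Section ergodic_product_implies_null.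
Context (R : realType) (G : topologicalZmodType).
Context dX (X : measurableType dX) (m : probability X R) (T : G -> nst m).
Context dY (Y : measurableType dY) (nu : probability Y R) (S : G -> nst nu).
Hypothesis S_mp : forall g A, measurable A -> nu (S g @^-1` A) = nu A.
Context (E : set (borel_dual R G) -> (Y -> R[i]^o) -> (Y -> R[i]^o)).
Hypothesis SE : is_spectral_measure nu (fun g => S g) E.

Local Notation mn := (m \x nu)%E.

(** The means of the constant [a] over rectangles are [a * m C * nu D]. For [D] the whole space this
    is the integral of [w], which is 0; so [a * m C = 0] and all the means vanish. *)
Lemma rectangle_mean_eq0 (C : set X) (w : Y -> R) (F : X * Y -> R) (a : R) :
  measurable C -> intg nu w -> Int nu w = 0 -> intg mn F ->
  {ae mn, forall p, F p = a} ->
  (forall D, measurable D ->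
    Int mn (fun p => F p * \1_(C `*` D) p) = Int nu (fun y => w y * \1_D y)) ->
  {ae nu, forall y, w y = 0}.
Proof.
move=> mC Iw w0 IF Fa FD; apply: (Int_eq0_sets Iw) => D mD.
have FE D' : measurable D' -> Int mn (fun p => F p * \1_(C `*` D') p) =
    a * (fine (m C) * fine (nu D')).
  move=> mD'; have mCD : measurable (C `*` D') by exact: measurableX.
  rewrite (@Int_ae _ _ _ mn _ (fun p => a * \1_(C `*` D') p)).
  - rewrite IntZ; last exact/sqi_intg/sqi_indic.
    rewrite Int_indic// [X in fine X]product_measure1E// fineM// fin_num_measure//.
  - exact: intg_measurable (intgM_indic IF mCD).
  - by apply: measurable_funM => //; exact: measurable_fun_indic.
  - by move: Fa; apply: filterS => p ->.
have aC : a * fine (m C) = 0.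
  have := FE _ (@measurableT _ Y); rewrite probability_setT/= mulr1 => <-.
  rewrite FD// -[RHS]w0; congr Rintegral; apply/funext => y.
  by rewrite indicT mulr1.
by rewrite -FD// FE// mulrA aC mul0r.
Qed.

Lemma ergodic_product_pvm_eigenset (C : set X) (M : R) (h : Y -> R[i]^o) :
  ergodic mn (fun g => prod_nst (T g) (S g)) -> measurable C -> L20 nu h ->
  {ae nu, forall y, E (eigenset T C M) h y = 0}.
Proof.
move=> erg mC Lh; pose P : set (borel_dual R G) := eigenset T C M.
have PE := SE.1; have mP : measurable P by exact: measurable_eigenset.
(* A point of [P] serves as the character of empty cells; if there is none, the claim is that
   [E set0] vanishes. *)
have [P0|/set0P[chi0 Pchi0]] := eqVneq P set0.
  by rewrite -/P P0; exact: (pvm0 PE).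
have LuO := pvm_L20 PE mP Lh; have Lu := L20_L2 LuO.
have [_ ur0 ui0] := (L20P _ _).1 LuO.
have eps0 n : 0 < n.+1%:R^-1 :> R by [].
pose J := (seq G * nat)%type.
pose HF (i : J) := approximate_invariant_function S_mp SE mC i.1 Lh Pchi0 (eps0 i.2).
pose F (i : J) := sval (cid (HF i)).
have FP i := svalP (cid (HF i)); rewrite -/(F _) in FP.
have LF i : L2 mn (F i) by have [] := FP i.
(* Along growing finite sets of group elements and growing [n], each single [g] is eventually
   controlled, so the limit is invariant under all of [G] at once. *)
pose Fil (A : set J) := exists (Phi0 : seq G) (n0 : nat), forall (Phi : seq G) (n : nat),
  {subset Phi0 <= Phi} -> (n0 <= n)%N -> A (Phi, n).
have PFil : ProperFilter Fil.
  split; first by move=> [Phi0 [n0 h0]]; exact: (h0 Phi0 n0).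
  split; first by exists [::], 0%N.
    move=> A B [Phi1 [n1 h1]] [Phi2 [n2 h2]]; exists (Phi1 ++ Phi2), (maxn n1 n2).
    move=> Phi n sub; rewrite geq_max => /andP[le1 le2]; split.
      by apply: h1 => // g gP; apply: sub; rewrite mem_cat gP.
    by apply: h2 => // g gP; apply: sub; rewrite mem_cat gP orbT.
  by move=> A B AB [Phi0 [n0 h0]]; exists Phi0, n0 => Phi n s1 s2; exact/AB/h0.
have [U [UF sU]] := ultraFilterLemma PFil.
pose K := (M + M) * nsq nu (E P h).
have FK i : nsq mn (F i) <= K by have [_ + _ _] := FP i.
have FrK i : Int mn (fun p => complex.Re (F i p) ^+ 2) <= K.
  apply: le_trans (FK i); rewrite nsq_Re_Im// lerDl.
  by apply: Int_ge0 => p; exact: sqr_ge0.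
have FiK i : Int mn (fun p => complex.Im (F i p) ^+ 2) <= K.
  apply: le_trans (FK i); rewrite nsq_Re_Im// lerDr.
  by apply: Int_ge0 => p; exact: sqr_ge0.
have [H [LH _ _ wr wi]] := complex_weak_limit UF LF FrK FiK.
have inv g : {ae mn, forall p, H (prod_nst (T g) (S g) p) = 1 * H p}.
  pose Hr i := let: And4 _ _ _ hr := FP i in hr g.
  pose r i := sval (cid (Hr i)).
  have rP i := svalP (cid (Hr i)); rewrite -/(r _) in rP.
  have Lr i : L2 mn (r i) by have [] := rP i.
  apply: (complex_weak_limit_equivariant UF (T := prod_nst (T g) (S g)) LF Lr LH wr wi).
    by move=> i; have [_ + _] := rP i; apply: filterS => p; rewrite -/(F i) => ->; rewrite mul1r.
  apply/cvgr0Pnorm_lt => e e0.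
  (* The error is at most [K / n.+1], which is below [e] as soon as [n >= n0]. *)
  pose n0 := Num.trunc (`|K| / e).
  apply: sU; exists [:: - g], n0 => Phi n sub n0n /=.
  have gP : - g \in Phi by apply: sub; rewrite inE.
  rewrite ger0_norm ?nsq_ge0//.
  have [_ _ le] := rP (Phi, n).
  apply: le_lt_trans (le gP) _; rewrite mulrCA -/K /= mulrC ltr_pdivrMr//.
  apply: le_lt_trans (ler_norm K) _; rewrite mulrC -ltr_pdivrMr//.
  apply: lt_le_trans (truncnS_gt _) _; by rewrite ler_nat ltnS.
have [a Ha] : exists a, {ae mn, forall p, complex.Re (H p) = a}.
  apply: (@ergodic_ae_constant R _ _ mn G (fun g => prod_nst (T g) (S g))) => //.
    by case: (L2Re LH).
  by move=> g; have := inv g; apply: filterS => p ->; rewrite mul1r.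
have [b Hb] : exists b, {ae mn, forall p, complex.Im (H p) = b}.
  apply: (@ergodic_ae_constant R _ _ mn G (fun g => prod_nst (T g) (S g))) => //.
    by case: (L2Im LH).
  by move=> g; have := inv g; apply: filterS => p ->; rewrite mul1r.
have rect D : measurable D -> measurable_fun setT (\1_(C `*` D) : X * Y -> R) /\
    forall p, `|\1_(C `*` D) p| <= 1 :> R.
  move=> mD; split; first by apply: measurable_fun_indic; exact: measurableX.
  by move=> p; exact: normr_indic_le1.
have re0 : {ae nu, forall y, complex.Re (E P h y) = 0}.
  apply: (@rectangle_mean_eq0 C _ (fun p => complex.Re (H p)) a) => //.
  - exact/sqi_intg/L2Re.
  - exact/sqi_intg/L2Re.
  - move=> D mD; have [m1 b1] := rect D mD; have := wr _ _ m1 b1.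
    have -> : (fun i => Int mn (fun p => complex.Re (F i p) * \1_(C `*` D) p)) =
       fun=> Int nu (fun y => complex.Re (E P h y) * \1_D y).
      by apply/funext => i; have [_ _ /(_ D mD)[]] := FP i.
    move=> h1; apply: (cvg_unique _ h1 (cvg_cst (Int nu (fun y => complex.Re (E P h y) * \1_D y)))).
    exact: norm_hausdorff.
have im0 : {ae nu, forall y, complex.Im (E P h y) = 0}.
  apply: (@rectangle_mean_eq0 C _ (fun p => complex.Im (H p)) b) => //.
  - exact/sqi_intg/L2Im.
  - exact/sqi_intg/L2Im.
  - move=> D mD; have [m1 b1] := rect D mD; have := wi _ _ m1 b1.
    have -> : (fun i => Int mn (fun p => complex.Im (F i p) * \1_(C `*` D) p)) =
       fun=> Int nu (fun y => complex.Im (E P h y) * \1_D y).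
      by apply/funext => i; have [_ _ /(_ D mD)[]] := FP i.
    move=> h1; apply: (cvg_unique _ h1 (cvg_cst (Int nu (fun y => complex.Im (E P h y) * \1_D y)))).
    exact: norm_hausdorff.
move: re0 im0; apply: filterS2 => y; rewrite -/P.
by case: (E P h y) => p q /= -> ->.
Qed.

End ergodic_product_implies_null.

(** * Extending an eigenvalue equation from a dense sequence to the group *)

Section continuous_extension.
Context (R : realType) (G : topologicalZmodType).

Lemma polish_dense_sequence : polish R G -> exists q : nat -> G,
  forall O : set G, open O -> O !=set0 -> exists i, O (q i).
Proof.
move=> [dist [[d0 _] _ _ _ [D cD Ddense]] oE].
have [f finj] := countable_injP _ cD.
(* The point of [D] numbered [n]; numbers of no point go to 0, which does not affect density. *)
pose q n : G := if pselect (exists2 y, D y & f y = n) is left h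
  then sval (cid2 h) else 0.
exists q => O; rewrite oE => oO [x Ox].
have [e e0 eO] := oO x Ox.
have [y Dy xy] := Ddense x e e0.
exists (f y); rewrite /q; case: pselect => [h|]; last by case; exists y.
have Dz := s2valP (cid2 h); have fz := s2valP' (cid2 h).
have -> : sval (cid2 h) = y by apply: finj; rewrite ?inE.
exact: eO.
Qed.

Lemma eq_on_dense (q : nat -> G) (a b : G -> R[i]^o) :
  (forall O : set G, open O -> O !=set0 -> exists i, O (q i)) ->
  continuous a -> continuous b -> (forall i, a (q i) = b (q i)) ->
  forall g, a g = b g.
Proof.
move=> qd ca cb ab g; apply: contrapT => /eqP; rewrite -subr_eq0 => n0.
have cd : continuous (fun g => a g - b g).
  by move=> x; apply: cvgB; [exact: ca|exact: cb].
have oO : open ((fun g => a g - b g) @^-1` [set z : R[i]^o | z != 0]).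
  apply: open_comp => [x _|]; first exact: cd.
  rewrite (_ : [set _ | _] = ~` [set 0]).
    by apply/closed_openC/accessible_closed_set1/hausdorff_accessible; exact: norm_hausdorff.
  by apply/seteqP; split => z /= /eqP.
have [j] := qd _ oO (ex_intro _ g n0).
by rewrite /= ab subrr eqxx.
Qed.

Lemma continuous_complexM (a b : G -> R[i]^o) : continuous a -> continuous b ->
  continuous (fun g => a g * b g : R[i]^o).
Proof. by move=> ca cb x; apply: cvgM; [exact: ca|exact: cb]. Qed.

End continuous_extension.

Section complex_measurability.
Context (R : realType) d (X : measurableType d) (m : probability X R).
Implicit Types (f h : X -> R[i]^o).

Definition cmeasurable f : Prop :=
  measurable_fun setT (fun x => complex.Re (f x) : R) /\
  measurable_fun setT (fun x => complex.Im (f x) : R).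

Lemma cmeasurableM f h : cmeasurable f -> cmeasurable h ->
  cmeasurable (fun x => f x * h x).
Proof.
move=> [fr fi] [hr hi]; split.
  under eq_fun do rewrite ReMo.
  by apply: measurable_funB; exact: measurable_funM.
under eq_fun do rewrite ImMo.
by apply: measurable_funD; exact: measurable_funM.
Qed.

Lemma cmeasurable_conj f : cmeasurable f -> cmeasurable (fun x => (f x)^*%C).
Proof.
move=> [fr fi]; split.
  rewrite (_ : (fun _ => _) = (fun x => complex.Re (f x)))//.
  by apply/funext => x; case: (f x).
rewrite (_ : (fun _ => _) = (fun x => - complex.Im (f x))); last first.
  by apply/funext => x; case: (f x).
exact: measurableT_comp.
Qed.

Lemma cmeasurable_real (r : X -> R) : measurable_fun setT r ->
  cmeasurable (fun x => (r x)%:C%C).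
Proof. by move=> mr; split => //; exact: measurable_cst. Qed.

Lemma L2_bounded f (K : R) : cmeasurable f -> (forall x, csq (f x) <= K) -> L2 m f.
Proof.
move=> [fr fi] fK.
have bd (p : R) x : p ^+ 2 <= csq (f x) -> `|p| <= K + 1.
  move=> pf; have K0 : 0 <= K by apply: le_trans (fK x); exact: csq_ge0.
  rewrite -(@ler_pXn2r _ 2)// ?nnegrE//; last by clear -K0; lra.
  rewrite real_normK ?num_real//; apply: (le_trans pf); apply: (le_trans (fK x)).
  by clear -K0; nra.
apply/L2P; split; apply: (@sqi_bounded _ _ _ _ _ (K + 1)) => // x; apply: (bd _ x).
  by rewrite /csq lerDl sqr_ge0.
by rewrite /csq lerDr sqr_ge0.
Qed.

Lemma CintegralE f : Cintegral m f =
  (Int m (fun x => complex.Re (f x)) +i* Int m (fun x => complex.Im (f x)))%C.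
Proof. by []. Qed.

Lemma CintegralZ (c : R[i]) f : intg m (fun x => complex.Re (f x)) ->
  intg m (fun x => complex.Im (f x)) ->
  Cintegral m (fun x => c * f x) = c * Cintegral m f.
Proof.
move=> ir ii; rewrite !CintegralE.
have -> : Int m (fun x => complex.Re (c * f x)) =
    complex.Re c * Int m (fun x => complex.Re (f x)) -
    complex.Im c * Int m (fun x => complex.Im (f x)).
  rewrite -!IntZ// -IntB; [|exact: intgZ|exact: intgZ].
  by congr Rintegral; apply/funext => x; rewrite ReMo.
have -> : Int m (fun x => complex.Im (c * f x)) =
    complex.Re c * Int m (fun x => complex.Im (f x)) +
    complex.Im c * Int m (fun x => complex.Re (f x)).
  rewrite -!IntZ// -IntD; [|exact: intgZ|exact: intgZ].
  by congr Rintegral; apply/funext => x; rewrite ImMo.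
by case: c.
Qed.

Lemma Cintegral_ae f h : cmeasurable f -> cmeasurable h ->
  {ae m, forall x, f x = h x} -> Cintegral m f = Cintegral m h.
Proof.
move=> [fr fi] [hr hi] fh; rewrite !CintegralE; congr (_ +i* _)%C; apply: Int_ae => //.
  by move: fh; apply: filterS => x ->.
by move: fh; apply: filterS => x ->.
Qed.

Lemma CintegralB f h : intg m (fun x => complex.Re (f x)) ->
  intg m (fun x => complex.Im (f x)) -> intg m (fun x => complex.Re (h x)) ->
  intg m (fun x => complex.Im (h x)) ->
  Cintegral m (fun x => f x - h x) = Cintegral m f - Cintegral m h.
Proof.
move=> fr fi hr hi; rewrite !CintegralE.
have -> : Int m (fun x => complex.Re (f x - h x)) = Int m (fun x => complex.Re (f x)) - Int m (fun x => complex.Re (h x)).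
  by rewrite -IntB//; congr Rintegral; apply/funext => x; rewrite raddfB.
have -> : Int m (fun x => complex.Im (f x - h x)) = Int m (fun x => complex.Im (f x)) - Int m (fun x => complex.Im (h x)).
  by rewrite -IntB//; congr Rintegral; apply/funext => x; rewrite raddfB.
by [].
Qed.

(** The weight in [nst_unitary], hence a square root. The chosen derivative may be negative on a
    null set, where [Num.sqrt] gives 0. *)
Definition jacobian (T : nst m) (x : X) : R :=
  Num.sqrt (fine (Radon_Nikodym (comp_measure T) m x)).

Lemma nst_unitaryE (T : nst m) f x :
  nst_unitary T f x = (jacobian T x)%:C%C * f (T x).
Proof. by []. Qed.

Lemma comp_measure_dominated (T : nst m) : comp_measure T `<< m.
Proof.
apply/null_content_dominatesP => A mA mA0; rewrite /comp_measure nst_imageE.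
have mA' := measurable_preimage_inv T mA.
apply/(nst_null T mA'); rewrite -[RHS]mA0; congr (m _).
by apply/seteqP; split => x /=; rewrite nst_funK.
Qed.

Lemma measurable_density (T : nst m) :
  measurable_fun setT (fun x => fine (Radon_Nikodym (comp_measure T) m x)) /\
  intg m (fun x => fine (Radon_Nikodym (comp_measure T) m x)).
Proof.
have dom := comp_measure_dominated T.
have i : intg m (fun x => fine (Radon_Nikodym (comp_measure T) m x)).
  rewrite /intg (_ : EFin \o _ = Radon_Nikodym (comp_measure T) m).
    exact: Radon_Nikodym_integrable.
  by apply/funext => x /=; rewrite fineK//; exact: Radon_Nikodym_fin_num.
by split => //; exact: intg_measurable i.
Qed.

Lemma sqi_jacobian (T : nst m) : sqi m (jacobian T).
Proof.
have [mr ir] := measurable_density T.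
have mj : measurable_fun setT (jacobian T) by apply: measurableT_comp mr;
  apply: continuous_measurable_fun; exact: sqrt_continuous.
split => //; apply: (intg_le _ (intg_norm ir)); first exact: measurable_funX.
move=> x; rewrite normrX ger0_norm ?sqrtr_ge0// /jacobian.
move: (fine _) => r; have [r0|r0] := leP 0 r; first by rewrite sqr_sqrtr// ger0_norm.
by rewrite ltr0_sqrtr// expr0n /= normr_ge0.
Qed.

(** The image of the set [Z] where the derivative is nonpositive has measure equal to its integral
    over [Z], hence 0; by non-singularity [Z] is null. The weight can therefore be divided out. *)
Lemma jacobian_neq0 (T : nst m) : {ae m, forall x, jacobian T x != 0}.
Proof.
have dom := comp_measure_dominated T; have [mr ir] := measurable_density T.
pose Z := [set x | fine (Radon_Nikodym (comp_measure T) m x) <= 0].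
have mZ : measurable Z by exact: measurable_sublevel.
exists Z; split => //; last first.
  move=> x /= /negP; rewrite negbK /jacobian sqrtr_eq0; exact.
have TZ0 : (comp_measure T Z <= 0)%E.
  rewrite (Radon_Nikodym_integral dom mZ) integral_mkcond.
  rewrite (_ : _ \_ Z = EFin \o (fun x => fine (Radon_Nikodym (comp_measure T) m x) * \1_Z x)).
    rewrite -EFin_Int; last exact: intgM_indic.
    rewrite lee_fin -(Int_cst m 0); apply: le_Int; [exact: intgM_indic|exact: intg_cst|].
    move=> x; rewrite indicE; case: (boolP (x \in Z)) => [|_]; last by rewrite mulr0.
    by rewrite inE mulr1.
  apply/funext => x; rewrite /patch /= indicE; case: (x \in Z); last by rewrite mulr0.
  by rewrite mulr1 fineK//; exact: Radon_Nikodym_fin_num.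
have mTZ : measurable (T @` Z) by rewrite nst_imageE; exact: measurable_preimage_inv.
have : m (T @` Z) = 0%E by apply/eqP; rewrite eq_le TZ0 measure_ge0.
move=> /(nst_null T mTZ) <-; congr (m _).
apply/seteqP; split => x /=; first by exists x.
by move=> [x' Zx' /(can_inj (nst_funK T)) <-].
Qed.

End complex_measurability.

Section eigenfunctions_from_dense_sets.
Context (R : realType) (G : topologicalZmodType).
Context d (X : measurableType d) (m : probability X R) (T : G -> nst m).
Hypothesis T_action : nonsingular_action T.

(* The test function is the defect itself, cut off to where everything is bounded. *)
Lemma eigen_dense (q : nat -> G) (chi : dual R G) (H : X -> R[i]^o) :
  (forall O : set G, open O -> O !=set0 -> exists i, O (q i)) ->
  L2 m H -> (forall i, {ae m, forall x, H (T (q i) x) = chi (q i) * H x}) ->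
  forall g, {ae m, forall x, H (T g x) = chi g * H x}.
Proof.
move=> qd LH Hq g.
have cH : cmeasurable H by exact: L2_measurable LH.
have cHg : cmeasurable (fun x => H (T g x)).
  by case: cH => hr hi; split; [exact: (measurable_comp_nst (T g) hr)|exact: (measurable_comp_nst (T g) hi)].
have cJ g' : cmeasurable (fun x => (jacobian (T g') x)%:C%C : R[i]^o).
  by apply: cmeasurable_real; case: (sqi_jacobian (T g')).
have mcsq (f : X -> R[i]^o) : cmeasurable f -> measurable_fun setT (fun x => csq (f x)).
  by move=> [fr fi]; apply: measurable_funD; exact: measurable_funX.
have mJ : measurable_fun setT (jacobian (T g)) by case: (sqi_jacobian (T g)).
pose J x : R[i]^o := (jacobian (T g) x)%:C%C.
pose B (k : nat) := [set x | jacobian (T g) x ^+ 2 <= k%:R] `&`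
  ([set x | csq (H x) <= k%:R] `&` [set x | csq (H (T g x)) <= k%:R]).
have mB k : measurable (B k).
  apply: measurableI; first by apply: measurable_sublevel; exact: measurable_funX.
  by apply: measurableI; apply: measurable_sublevel; exact: mcsq.
(* The defect carries the weight [J] because only weighted compositions are known to depend
   continuously on the group element. *)
pose D x : R[i]^o := J x * H (T g x) - chi g * (J x * H x).
have cJH : cmeasurable (fun x => J x * H x) by apply: cmeasurableM => //; exact: cJ.
have cJHg : cmeasurable (fun x => J x * H (T g x)) by apply: cmeasurableM => //; exact: cJ.
have ccst (c : R[i]) : cmeasurable (fun _ : X => c : R[i]^o) by split; exact: measurable_cst.
have cD : cmeasurable D.
  have [r1 i1] := cJHg; have [r2 i2] := cmeasurableM (ccst (chi g)) cJH.
  split.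
    by under eq_fun do rewrite (raddfB (@complex.Re R)); exact: measurable_funB.
  by under eq_fun do rewrite (raddfB (@complex.Im R)); exact: measurable_funB.
have step k : {ae m, forall x, csq (D x) * \1_(B k) x = 0}.
  pose I x : R[i]^o := (\1_(B k) x)%:C%C.
  have cI : cmeasurable I by apply: cmeasurable_real; exact: measurable_fun_indic.
  pose K : R := k%:R; have K0 : 0 <= K by [].
  have csqI x : csq (I x) = \1_(B k) x.
    by rewrite /I /csq indicE /=; case: (x \in B k); rewrite /= ?expr1n !expr0n /= addr0.
  have bd (a b : X -> R[i]^o) (M N : R) : (forall x, B k x -> csq (a x) <= M) ->
      (forall x, B k x -> csq (b x) <= N) -> 0 <= M -> 0 <= N ->
      forall x, csq (a x * b x * I x) <= M * N.
    move=> aM bN M0 N0 x; rewrite !csqM csqI indicE; case: (boolP (x \in B k)) => [|_].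
      rewrite inE mulr1 => Bx; apply: ler_pM => //; try exact: csq_ge0.
        exact: aM.
      exact: bN.
    by rewrite mulr0 mulr_ge0.
  have JB x : B k x -> csq (J x) <= K.
    by move=> [h _]; rewrite /csq /= expr0n /= addr0.
  have HB x : B k x -> csq (H x) <= K by move=> [_ []].
  have HgB x : B k x -> csq (H (T g x)) <= K by move=> [_ []].
  have csqB (z z' : R[i]) : csq (z - z') <= 2 * (csq z + csq z').
    case: z z' => a b [a' b']; rewrite /csq/=.
    have : 0 <= (a + a') ^+ 2 by exact: sqr_ge0.
    have : 0 <= (b + b') ^+ 2 by exact: sqr_ge0.
    nra.
  have DB x : B k x -> csq (D x) <= 4 * (K * K).
    move=> Bx; apply: le_trans (csqB _ _) _; rewrite !csqM csq_character mul1r.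
    have h1 : csq (J x) * csq (H (T g x)) <= K * K.
      by apply: ler_pM; [exact: csq_ge0|exact: csq_ge0|exact: JB|exact: HgB].
    have h2 : csq (J x) * csq (H x) <= K * K.
      by apply: ler_pM; [exact: csq_ge0|exact: csq_ge0|exact: JB|exact: HB].
    by lra.
  have KK0 : 0 <= 4 * (K * K) by rewrite mulr_ge0// mulr_ge0.
  pose h x : R[i]^o := D x * I x.
  have ch : cmeasurable h by exact: cmeasurableM.
  have Lh : L2 m h.
    apply: (@L2_bounded _ _ _ _ _ (4 * (K * K) * 1)) => // x.
    have := bd D (fun=> 1) _ 1 DB _ KK0 _ x; rewrite mulr1; apply => //.
    by move=> x' _; rewrite /csq/= expr1n expr0n addr0.
  pose h' x : R[i]^o := (H x)^*%C * h x.
  have ch' : cmeasurable h' by apply: cmeasurableM => //; exact: cmeasurable_conj.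
  have Lh' : L2 m h'.
    apply: (@L2_bounded _ _ _ _ _ (K * (4 * (K * K)))) => // x.
    rewrite /h' /h [_ * (D x * _)]mulrA; apply: (bd (fun x => (H x)^*%C) D) => // x' Bx'.
      by rewrite csq_conj; exact: HB.
  have cM (z z' : R[i]^o) : (z * z' : R[i]^o)^*%C = (z^*%C : R[i]^o) * z'^*%C.
    by case: z z' => p r [p' r'] /=; congr (_ +i* _)%C; ring.
  have cK (z : R[i]^o) : (z^*%C : R[i]^o)^*%C = z by case: z => p r /=; rewrite opprK.
  have innerL (a b : X -> R[i]^o) : L2 m a -> L2 m b ->
      intg m (fun x => complex.Re (a x * (b x)^*%C)) /\
      intg m (fun x => complex.Im (a x * (b x)^*%C)).
    move=> La Lb; split.
      rewrite (_ : (fun _ => _) = (fun x => complex.Re (a x) * complex.Re (b x) +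
        complex.Im (a x) * complex.Im (b x))); first exact: intg_ip.
      by apply/funext => x; case: (a x) (b x) => p r [p' r'] /=; ring.
    rewrite (_ : (fun _ => _) = (fun x => complex.Im (a x) * complex.Re (b x) -
      complex.Re (a x) * complex.Im (b x))).
      by apply: intgB; apply: sqi_mul; (exact: L2Re || exact: L2Im).
    by apply/funext => x; case: (a x) (b x) => p r [p' r'] /=; ring.
  have L1 : L2 m (fun=> 1 : R[i]^o) by exact: L2_cst.
  have LU g' : L2 m (nst_unitary (T g') (fun=> 1 : R[i]^o)).
    apply/L2P; under eq_fun do rewrite nst_unitaryE mulr1; split; first exact: sqi_jacobian.
    by under eq_fun do rewrite nst_unitaryE mulr1; exact: sqi_cst.
  (* The factor [H x] does not depend on [g'] and is moved into the test function [h']. Both sides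
     are then continuous in [g'] by the weak continuity of the action, and they agree on the dense
     sequence. *)
  have E (g' : G) : inner m (nst_unitary (T g') H) h =
      chi g' * inner m (nst_unitary (T g') (fun=> 1 : R[i]^o)) h'.
    apply: (eq_on_dense qd (a := fun g' => inner m (nst_unitary (T g') H) h)
      (b := fun g' => chi g' * inner m (nst_unitary (T g') (fun=> 1 : R[i]^o)) h')).
    - exact: T_action.2.
    - apply: continuous_complexM; first by case: (dual_character chi).
      exact: T_action.2.
    move=> i; have [ir ii] := innerL _ _ (LU (q i)) Lh'.
    rewrite /inner -CintegralZ//; apply: Cintegral_ae.
    - apply: cmeasurableM; last exact: cmeasurable_conj.
      apply: cmeasurableM; first exact: cJ.
      by case: cH => hr hi; split; [exact: (measurable_comp_nst (T (q i)) hr)|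
        exact: (measurable_comp_nst (T (q i)) hi)].
    - apply: cmeasurableM; first exact: ccst.
      apply: cmeasurableM; last exact: cmeasurable_conj.
      by apply: cmeasurableM; [exact: cJ|exact: ccst].
    - have := Hq i; apply: filterS => x Hx.
      rewrite !nst_unitaryE Hx /h' [((H x)^*%C * h x)^*%C]cM cK mulr1.
      by ring.
  have := E g; rewrite /inner.
  have LJHI : L2 m (fun x => J x * H x * I x).
    by apply: (@L2_bounded _ _ _ _ _ (K * K)); [exact: cmeasurableM|exact: bd].
  have LJHgI : L2 m (fun x => J x * H (T g x) * I x).
    by apply: (@L2_bounded _ _ _ _ _ (K * K)); [exact: cmeasurableM|exact: bd].
  have LDI : L2 m (fun x => D x * I x) by exact: Lh.
  have II x : I x * I x = I x.
    by rewrite /I indicE; case: (x \in B k); rewrite /= ?mulr1 ?mulr0.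
  have Iconj x : (I x)^*%C = I x by rewrite /I /=; congr (_ +i* _)%C; exact: oppr0.
  have hconj x : (h x)^*%C = I x * (D x * I x)^*%C.
    by rewrite /h !cM Iconj mulrCA II mulrC.
  have -> : (fun x => nst_unitary (T g) H x * (h x)^*%C) =
      (fun x => (J x * H (T g x) * I x) * (D x * I x)^*%C).
    apply/funext => x; rewrite -[RHS]mulrA nst_unitaryE.
    by congr (_ * _); exact: hconj.
  have -> : (fun x => nst_unitary (T g) (fun=> 1 : R[i]^o) x * (h' x)^*%C) =
      (fun x => (J x * H x * I x) * (D x * I x)^*%C).
    apply/funext => x; rewrite nst_unitaryE mulr1 /h' [((H x)^*%C * h x)^*%C]cM cK.
    by rewrite -!mulrA; congr (_ * (_ * _)); exact: hconj.
  have [r1 i1] := innerL _ _ LJHgI LDI.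
  have [r2 i2] := innerL _ _ (L2Z (chi g) LJHI) LDI.
  have [r3 i3] := innerL _ _ LJHI LDI.
  rewrite -CintegralZ// => /eqP; rewrite -subr_eq0 -CintegralB//; last 2 first.
  - by under eq_fun do rewrite mulrA.
  - by under eq_fun do rewrite mulrA.
  (* At [g] the two sides differ by the integral of the squared modulus of the cut-off defect. *)
  have -> : (fun x => J x * H (T g x) * I x * (D x * I x)^*%C -
     chi g * (J x * H x * I x * (D x * I x)^*%C)) = (fun x => (csq (D x * I x))%:C%C).
    apply/funext => x.
    have -> : (csq (D x * I x))%:C%C = D x * I x * (D x * I x)^*%C.
      case: (D x * I x) => a b; rewrite /csq; simpc.
      by congr (_ +i* _)%C; ring.
    rewrite {3}/D; ring.
  rewrite CintegralE => /eqP[+ _] => I0.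
  have := @Int_eq0 _ _ _ m (fun x => csq (D x * I x)) (intg_ip LDI LDI) (fun x => csq_ge0 _) I0.
  by apply: filterS => x; rewrite csqM csqI.
have := ae_foralln step; have := jacobian_neq0 (T g).
apply: filterS2 => x j0 hx.
pose M := Num.max (jacobian (T g) x ^+ 2) (Num.max (csq (H x)) (csq (H (T g x)))).
have MK : M <= (Num.trunc M).+1%:R by exact/ltW/truncnS_gt.
have Bx : B (Num.trunc M).+1 x.
  by split; [|split] => /=; apply: le_trans MK; rewrite /M !le_max lexx ?orbT.
have := hx (Num.trunc M).+1; rewrite indicE mem_set// mulr1 => /csq_eq0 /eqP.
rewrite /D mulrCA -mulrBr mulf_eq0 subr_eq0 => /orP[/eqP J0|/eqP //].
by move: j0; rewrite -(inj_eq (@complexI R)) -/(J x) J0 eqxx.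
Qed.

End eigenfunctions_from_dense_sets.

(** * Sections of a set in the product and pairings with them *)

Section complex_CauchySchwarz.
Context (R : realType) d (Y : measurableType d) (nu : probability Y R).
Implicit Types (a b f h : Y -> R[i]^o).

Lemma ipZr (z : R[i]) f h : L2 nu f -> L2 nu h ->
  ip nu f (fun y => z * h y) =
  complex.Re z * ip nu f h + complex.Im z * ip nu f (fun y => 'i%C * h y).
Proof. by move=> Lf Lh; rewrite ipC ipZl// ipC [in X in _ + X]ipC. Qed.

(** Multiplying [b] by the complex inner product turns its squared modulus into a value of the real
    form, to which the real inequality applies. *)
Lemma csq_inner_le a b : L2 nu a -> L2 nu b ->
  ip nu a b ^+ 2 + ip nu a (fun y => 'i%C * b y) ^+ 2 <= nsq nu a * nsq nu b.
Proof.
move=> La Lb; set p := ip nu a b; set q := ip nu a _.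
have Lz := L2Z (p +i* q)%C Lb.
have := ip_CauchySchwarz La Lz; rewrite ipZr// nsqZ// -/p -/q /csq /=.
rewrite -!expr2; set c := p ^+ 2 + q ^+ 2 => h.
have c0 : 0 <= c by rewrite addr_ge0 ?sqr_ge0.
have [->|cn0] := eqVneq c 0; first by rewrite mulr_ge0 ?nsq_ge0.
have cp : 0 < c by rewrite lt_neqAle eq_sym cn0.
by rewrite -(ler_pM2r cp) -expr2 (le_trans h)// [leLHS]mulrCA [leLHS]mulrC.
Qed.

End complex_CauchySchwarz.

Lemma indic_xsection (R : pzRingType) X Y (K : set (X * Y)) x y :
  \1_(xsection K x) y = \1_K (x, y) :> R.
Proof.
rewrite !indicE; congr (_%:R); congr nat_of_bool; rewrite /xsection.
by apply/idP/idP; rewrite !inE/= ?inE.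
Qed.

Section sections_of_a_set.
Context (R : realType) dX (X : measurableType dX) (m : probability X R).
Context dY (Y : measurableType dY) (nu : probability Y R).
Context (A : set (X * Y)).
Hypothesis mA : measurable A.

Local Notation mn := (m \x nu)%E.

Definition centered_section (x : X) : Y -> R[i]^o := centered_indic nu (xsection A x).

Definition centered_set (p : X * Y) : R := \1_A p - fine (nu (xsection A p.1)).

Lemma L20_centered_section x : L20 nu (centered_section x).
Proof. by apply: L20_centered_indic; exact: measurable_xsection. Qed.

Lemma centered_sectionE x y : centered_section x y = (centered_set (x, y))%:C%C.
Proof.
rewrite /centered_section /centered_indic /centered_set /=; congr ((_ - _)%:C)%C.
by rewrite indic_xsection.
Qed.

Lemma measurable_section_mass : measurable_fun setT (fun x => fine (nu (xsection A x))).
Proof.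
have s1 x : intg nu (fun y => \1_A (x, y)).
  apply: (@intg_bounded _ _ _ _ _ 1).
    exact: (measurable_fun_section x (measurable_fun_indic mA)).
  by move=> y; exact: normr_indic_le1.
have [h _] := Int_prod (sqi_intg (sqi_indic mn mA)) s1.
have := intg_measurable h; congr measurable_fun; apply/funext => x.
rewrite -Int_indic; last exact: measurable_xsection.
congr Rintegral; apply/funext => y.
by rewrite indic_xsection.
Qed.

Lemma section_mass_bounds x : 0 <= fine (nu (xsection A x)) <= 1.
Proof.
have mx := measurable_xsection x mA.
rewrite fine_ge0//= -lee_fin fineK ?fin_num_measure//.
exact: probability_le1.
Qed.

Lemma measurable_centered_set : measurable_fun setT centered_set.
Proof.
apply: measurable_funB; first exact: measurable_fun_indic.
by apply: (measurableT_comp measurable_section_mass); exact: measurable_fst.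
Qed.

Lemma centered_set_le1 p : `|centered_set p| <= 1.
Proof.
have /andP[h0 h1] := section_mass_bounds p.1.
by rewrite /centered_set indicE ler_norml; case: (p \in A) => /=; lra.
Qed.

Lemma nsq_centered_section_le1 x : nsq nu (centered_section x) <= 1.
Proof.
rewrite nsqE -[leRHS](Int_cst nu 1); apply: le_Int; [|exact: intg_cst|].
  exact: intg_ip (L20_L2 (L20_centered_section x)) (L20_L2 (L20_centered_section x)).
move=> y; rewrite centered_sectionE /csq /= expr0n/= addr0.
rewrite -(real_normK (num_real _)) expr_le1//; exact: centered_set_le1.
Qed.

(** The vector-valued integral of the centered sections over [C], defined pointwise in [y]. *)
Definition section_average (C : set X) (y : Y) : R[i]^o :=
  (Int m (fun x => centered_set (x, y) * \1_C x))%:C%C.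

Lemma ip_centered_section x (v : Y -> R[i]^o) :
  ip nu (centered_section x) v = Int nu (fun y => centered_set (x, y) * complex.Re (v y)).
Proof.
congr Rintegral; apply/funext => y.
by rewrite centered_sectionE /= mul0r addr0.
Qed.

(** All the consequences of one use of Fubini's theorem, for the product of [\1_C], [b] and
    [centered_set]. *)
Lemma section_average_pairing (C : set X) (b : Y -> R) : measurable C -> intg nu b ->
  [/\ intg m (fun x => Int nu (fun y => centered_set (x, y) * b y) * \1_C x),
    Int m (fun x => Int nu (fun y => centered_set (x, y) * b y) * \1_C x) =
      Int nu (fun y => Int m (fun x => centered_set (x, y) * \1_C x) * b y),
    Int mn (fun p => (\1_C p.1 * b p.2) * centered_set p) =
      Int nu (fun y => Int m (fun x => centered_set (x, y) * \1_C x) * b y)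
    & measurable_fun setT (fun y => Int m (fun x => centered_set (x, y) * \1_C x) * b y)].
Proof.
move=> mC Ib; have IC : intg m (\1_C) by exact/sqi_intg/sqi_indic.
have [It _] := Int_tensor IC Ib.
have IK := intgM_bounded It measurable_centered_set centered_set_le1.
have sx x : intg nu (fun y => (\1_C x * b y) * centered_set (x, y)).
  apply: (intgM_bounded (intgZ (\1_C x) Ib)); last by move=> y; exact: centered_set_le1.
  exact: (measurable_fun_section x measurable_centered_set).
have msy y : measurable_fun setT (fun x => centered_set (x, y)).
  exact: (measurableT_comp measurable_centered_set (pair2_measurable y)).
have sy y : intg m (fun x => (\1_C x * b y) * centered_set (x, y)).
  apply: intgM_bounded; [|exact: msy|by move=> x; exact: centered_set_le1].
  by under eq_fun do rewrite mulrC; exact: intgZ.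
have [I1 E1] := Int_prod IK sx.
have [M2 E2] := Int_prod_swap IK sy.
have e1 x : Int nu (fun y => (\1_C x * b y) * centered_set (x, y)) =
    Int nu (fun y => centered_set (x, y) * b y) * \1_C x.
  rewrite mulrC -IntZ.
    by congr Rintegral; apply/funext => y; ring.
  under eq_fun do rewrite mulrC.
  apply: (intgM_bounded Ib); last by move=> y; exact: centered_set_le1.
  exact: (measurable_fun_section x measurable_centered_set).
have e2 y : Int m (fun x => (\1_C x * b y) * centered_set (x, y)) =
    Int m (fun x => centered_set (x, y) * \1_C x) * b y.
  rewrite mulrC -IntZ.
    by congr Rintegral; apply/funext => x; ring.
  apply: intgM_indic => //; apply: (@intg_bounded _ _ _ _ _ 1) => // x.
  exact: centered_set_le1.
rewrite (funext e1) in I1 E1; rewrite (funext e2) in M2 E2.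
by split => //; rewrite -E1.
Qed.

Lemma measurable_section_average C : measurable C ->
  measurable_fun setT (fun y => Int m (fun x => centered_set (x, y) * \1_C x)).
Proof.
move=> mC; have [_ _ _] := section_average_pairing mC (intg_cst nu 1).
by under eq_fun do rewrite mulr1.
Qed.

Lemma L20_section_average C : measurable C -> L20 nu (section_average C).
Proof.
move=> mC; have [_ E1 _ _] := section_average_pairing mC (intg_cst nu 1).
apply/L20P; split.
- apply/L2P; split; last exact: sqi_cst.
  apply: (@sqi_bounded _ _ _ _ _ 1); first exact: measurable_section_average.
  move=> y; have I1 : intg m (fun x => centered_set (x, y) * \1_C x).
    apply: intgM_indic => //; apply: (@intg_bounded _ _ _ _ _ 1); last by move=> x; exact: centered_set_le1.
    exact: (measurableT_comp measurable_centered_set (pair2_measurable y)).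
  apply: le_trans (ler_norm_Int I1) _; rewrite -[leRHS](Int_cst m 1).
  apply: le_Int; [exact: intg_norm|exact: intg_cst|].
  move=> x; rewrite normrM indicE; case: (x \in C); rewrite ?normr1 ?normr0 ?mulr1 ?mulr0//.
  exact: centered_set_le1.
- rewrite /section_average /=.
  transitivity (Int nu (fun y => Int m (fun x => centered_set (x, y) * \1_C x) * 1)).
    by congr Rintegral; apply/funext => y; rewrite mulr1.
  rewrite -E1 -[RHS](Int_cst m 0); congr Rintegral; apply/funext => x.
  have /L20P[_ + _] := L20_centered_section x.
  have -> : (fun y => complex.Re (centered_section x y)) = (fun y => centered_set (x, y) * 1).
    by apply/funext => y; rewrite centered_sectionE mulr1.
  by move=> ->; rewrite mul0r.
- exact: Int_cst.
Qed.

Lemma ip_section_average C (v : Y -> R[i]^o) : measurable C -> L2 nu v ->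
  Int m (fun x => ip nu (centered_section x) v * \1_C x) = ip nu (section_average C) v.
Proof.
move=> mC Lv; have [_ E1 _ _] := section_average_pairing mC (sqi_intg (L2Re Lv)).
under eq_fun do rewrite ip_centered_section.
rewrite E1; congr Rintegral; apply/funext => y.
by rewrite /section_average /= mul0r addr0.
Qed.

Lemma intg_ip_centered_section (v : Y -> R[i]^o) : L2 nu v ->
  intg m (fun x => ip nu (centered_section x) v).
Proof.
move=> Lv; have [I1 _ _ _] := section_average_pairing measurableT (sqi_intg (L2Re Lv)).
under eq_fun do rewrite ip_centered_section.
by move: I1; under eq_fun do rewrite indicT mulr1.
Qed.

(** The mean of [centered_set] over a rectangle is the integral of a section average over its second
    side, and rectangles determine integrable functions. *)
Lemma section_averages_separate :
  (forall C, measurable C -> {ae nu, forall y, section_average C y = 0}) ->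
  {ae mn, forall p, centered_set p = 0}.
Proof.
move=> w0.
pose GG := [set C `*` D | C in @measurable _ X & D in @measurable _ Y].
apply: (@Int_eq0_pi _ _ _ mn GG).
- exact: measurable_prod_measurableType.
- move=> _ _ [C1 mC1 [D1 mD1 <-]] [C2 mC2 [D2 mD2 <-]].
  exists (C1 `&` C2); first exact: measurableI.
  exists (D1 `&` D2); first exact: measurableI.
  by rewrite setXI.
- by exists setT => //; exists setT => //; rewrite setXTT.
- apply: (@intg_bounded _ _ _ _ _ 1); [exact: measurable_centered_set|exact: centered_set_le1].
move=> _ [C mC [D mD <-]].
have [_ _ E1 mE] := section_average_pairing mC (sqi_intg (sqi_indic nu mD)).
transitivity (Int mn (fun p => (\1_C p.1 * \1_D p.2) * centered_set p)).
  congr Rintegral; apply/funext => p; rewrite mulrC; congr (_ * _).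
  by rewrite !indicE in_setX; case: (_ \in C); case: (_ \in D); rewrite /= ?mulr1 ?mulr0.
rewrite E1 -[RHS](Int_cst nu 0); apply: Int_ae => //.
have := w0 C mC; apply: filterS => y /(congr1 (@complex.Re R)) /= ->.
by rewrite mul0r.
Qed.

End sections_of_a_set.

(** * Spectral energy of the sections *)

Section approximate_eigenfunctions.
Context (R : realType) (G : topologicalZmodType).
Context dX (X : measurableType dX) (m : probability X R) (T : G -> nst m).
Context dY (Y : measurableType dY) (nu : probability Y R) (S : G -> nst nu).
Hypothesis S_mp : forall g A, measurable A -> nu (S g @^-1` A) = nu A.
Context (E : set (borel_dual R G) -> (Y -> R[i]^o) -> (Y -> R[i]^o)).
Hypothesis SE : is_spectral_measure nu (fun g => S g) E.
Context (A : set (X * Y)).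
Hypothesis mA : measurable A.

Local Notation mn := (m \x nu)%E.
Local Notation F := (centered_section nu A).
Let PE : projection_valued_measure nu E := SE.1.

Definition section_energy (V : set (borel_dual R G)) (x : X) : R := nsq nu (E V (F x)).

Lemma section_energy_ge0 V x : 0 <= section_energy V x.
Proof. exact: nsq_ge0. Qed.

Lemma section_energy_le1 V x : measurable V -> section_energy V x <= 1.
Proof.
move=> mV; apply: le_trans (nsq_centered_section_le1 nu mA x).
by apply: (nsq_pvm_le PE mV); exact: L20_centered_section.
Qed.

(* The energy is Int Re(E V F_x) 1_K(x, .) for K = A; measurability is clear
   when K is a rectangle. *)
Lemma measurable_section_energy V : measurable V ->
  measurable_fun setT (section_energy V).
Proof.
move=> mV.
have LF x : L20 nu (F x) by exact: L20_centered_section.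
have LEF x : L20 nu (E V (F x)) by exact: (pvm_L20 PE).
have IEF x : intg nu (fun y => complex.Re (E V (F x) y)) by exact/sqi_intg/L2Re/L20_L2.
have mK (K : set (X * Y)) x : measurable K -> measurable (xsection K x) by move=> ?; exact: measurable_xsection.
pose Q (K : set (X * Y)) := measurable_fun setT (fun x =>
  Int nu (fun y => complex.Re (E V (F x) y) * \1_(xsection K x) y)).
have QA : Q A.
  pose GG := [set C `*` D | C in @measurable _ X & D in @measurable _ Y].
  have prodE : @measurable _ (X * Y)%type = <<s GG >> by exact: measurable_prod_measurableType.
  have rect C D : measurable C -> measurable D -> Q (C `*` D).
    move=> mC mD; rewrite /Q.
    have -> : (fun x => Int nu (fun y => complex.Re (E V (F x) y) * \1_(xsection (C `*` D) x) y)) =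
       (fun x => ip nu (F x) (E V (centered_indic nu D)) * \1_C x).
      apply/funext => x; rewrite -(ip_pvm PE)//; last exact: L20_centered_indic.
      rewrite ip_centered_indic// mulrC -IntZ; last exact: intgM_indic.
      congr Rintegral; apply/funext => y; rewrite mulrCA; congr (_ * _).
      by rewrite indic_xsection !indicE in_setX /=; case: (_ \in C); case: (_ \in D); rewrite /= ?mulr1 ?mulr0.
    apply: measurable_funM; last exact: measurable_fun_indic.
    apply: (@intg_measurable _ _ _ m); apply: intg_ip_centered_section => //.
    exact/(pvm_L2 PE)/L20_centered_indic.
  apply: (@dynkin_induction _ (X * Y)%type GG Q) => //.
  - move=> _ _ [C1 mC1 [D1 mD1 <-]] [C2 mC2 [D2 mD2 <-]].
    exists (C1 `&` C2); first exact: measurableI.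
    exists (D1 `&` D2); first exact: measurableI.
    by rewrite setXI.
  - by rewrite -setXTT; exact: rect.
  - by move=> _ [C mC [D mD <-]]; exact: rect.
  - move=> K mK' QK; rewrite /Q.
    have -> : (fun x => Int nu (fun y => complex.Re (E V (F x) y) * \1_(xsection (~` K) x) y)) =
        (fun x => - Int nu (fun y => complex.Re (E V (F x) y) * \1_(xsection K x) y)).
      (* [E V (F x)] has mean zero, so passing to the complement only changes the sign. *)
      apply/funext => x; have /L20P[_ re0 _] := LEF x.
      rewrite -[RHS]add0r -[X in _ = X + _]re0 -IntB//; last exact/intgM_indic/mK.
      congr Rintegral; apply/funext => y; rewrite !indic_xsection !indicE in_setC.
      by case: (_ \in _) => /=; ring.
    exact: measurableT_comp.
  - move=> K mKn tK QK; rewrite /Q.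
    pose g n x := \sum_(k <- iota 0 n)
      Int nu (fun y => complex.Re (E V (F x) y) * \1_(xsection (K k) x) y).
    apply: (@measurable_fun_cvg _ _ _ setT g) => //.
      by move=> n; apply: measurable_sum => k; exact: QK.
    move=> x _; rewrite xsection_bigcup.
    apply: Int_bigcup_cvg; [exact: IEF|by move=> k; exact: mK|exact: trivIset_xsection].
  - by rewrite -prodE.
rewrite /section_energy; move: QA; congr measurable_fun; apply/funext => x.
rewrite (nsq_pvm PE)// -ip_centered_indic//; exact: mK.
Qed.

Definition mean_energy V : R := Int m (section_energy V).

Lemma intg_section_energy V : measurable V -> intg m (section_energy V).
Proof.
move=> mV; apply: (@intg_bounded _ _ _ _ _ 1); first exact: measurable_section_energy.
by move=> x; rewrite ger0_norm ?section_energy_ge0// section_energy_le1.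
Qed.

Lemma mean_energy_ge0 V : 0 <= mean_energy V.
Proof. by apply: Int_ge0 => x; exact: section_energy_ge0. Qed.

End approximate_eigenfunctions.

(** * Almost eigenfunctions from a single cell *)

Lemma conj_inverse (R : realType) (z c : R[i]) : csq z = 1 -> c * z = 1 -> z^*%C = c.
Proof.
move=> z1 cz; have zz : z * z^*%C = 1.
  case: z z1 {cz} => a b; rewrite /csq /= => h.
  by simpc; rewrite -!expr2 h; congr (_ +i* _)%C; ring.
by rewrite -[LHS]mul1r -cz -mulrA zz mulr1.
Qed.

Section eigenfunction_of_a_cell.
Context (R : realType) (G : topologicalZmodType).
Context dX (X : measurableType dX) (m : probability X R) (T : G -> nst m).
Context dY (Y : measurableType dY) (nu : probability Y R) (S : G -> nst nu).
Hypothesis S_mp : forall g A, measurable A -> nu (S g @^-1` A) = nu A.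
Context (E : set (borel_dual R G) -> (Y -> R[i]^o) -> (Y -> R[i]^o)).
Hypothesis SE : is_spectral_measure nu (fun g => S g) E.
Context (A : set (X * Y)).
Hypothesis mA : measurable A.

Local Notation F := (centered_section nu A).
Let PE : projection_valued_measure nu E := SE.1.
Let LF x : L20 nu (F x) := L20_centered_section nu mA x.

(** This is [inner nu (F x) v], by [inner_ip]; it is conjugate linear in [v]. *)
Definition section_coefficient (v : Y -> R[i]^o) (x : X) : R[i]^o :=
  (ip nu (F x) v +i* ip nu (F x) (fun y => 'i%C * v y))%C.

Lemma ip_pvm_range V a b : measurable V -> L20 nu a -> L20 nu b ->
  {ae nu, forall y, E V b y = b y} -> ip nu a b = ip nu (E V a) b.
Proof.
move=> mV La Lb Vb; rewrite (ip_pvm PE)//.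
apply: ip_ae; [exact: L20_L2|exact: L20_L2|exact: L20_L2|exact: (pvm_L2 PE)|exact: aeW|].
by move: Vb; apply: filterS => y ->.
Qed.

(** A vector [v] in the range of [E V] sees only the [V]-part of the section. This brings in the
    energy in [V] instead of the whole norm. *)
Lemma csq_section_coefficient_le V v x : measurable V -> L20 nu v ->
  {ae nu, forall y, E V v y = v y} ->
  csq (section_coefficient v x) <= section_energy nu E A V x * nsq nu v.
Proof.
move=> mV Lv Vv; have Liv := L20Z 'i%C Lv.
have Viv : {ae nu, forall y, E V (fun y => 'i%C * v y) y = 'i%C * v y}.
  by have := pvmZ PE 'i%C mV Lv; move: Vv; apply: filterS2 => y -> ->.
rewrite /csq /section_coefficient /= (ip_pvm_range mV (LF x) Lv Vv).
rewrite (ip_pvm_range mV (LF x) Liv Viv).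
by apply: csq_inner_le; [exact: (pvm_L2 PE)|exact: L20_L2].
Qed.

Lemma L2_section_coefficient V v : measurable V -> L20 nu v ->
  {ae nu, forall y, E V v y = v y} ->
  L2 m (section_coefficient v) /\
  nsq m (section_coefficient v) <= mean_energy m nu E A V * nsq nu v.
Proof.
move=> mV Lv Vv; have Liv := L20Z 'i%C Lv.
have I1 := intg_ip_centered_section m mA (L20_L2 Lv).
have I2 := intg_ip_centered_section m mA (L20_L2 Liv).
have cm : cmeasurable (section_coefficient v).
  by split; [exact: intg_measurable I1|exact: intg_measurable I2].
have LL : L2 m (section_coefficient v).
  apply: (@L2_bounded _ _ _ _ _ (nsq nu v)) => // x.
  apply: le_trans (csq_section_coefficient_le x mV Lv Vv) _.
  rewrite -[leRHS]mul1r ler_wpM2r ?nsq_ge0//.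
  exact: (section_energy_le1 SE).
split => //; rewrite nsqE mulrC /mean_energy -IntZ; last exact: (intg_section_energy m SE).
apply: le_Int.
- exact: intg_ip.
- exact/intgZ/(intg_section_energy m SE).
- by move=> x; rewrite mulrC; exact: csq_section_coefficient_le.
Qed.

Lemma section_coefficientZ (z : R[i]) v x : L20 nu v ->
  section_coefficient (fun y => z * v y) x = z^*%C * section_coefficient v x.
Proof.
move=> Lv; have Liv := L20Z 'i%C Lv; have LFx := L20_L2 (LF x).
rewrite /section_coefficient (ipZr z LFx (L20_L2 Lv)).
have -> : (fun y => 'i%C * (z * v y)) = (fun y => ('i%C * z) * v y).
  by apply/funext => y; rewrite mulrA.
rewrite (ipZr ('i%C * z) LFx (L20_L2 Lv)).
move: (ip nu (F x) v) (ip nu (F x) (fun y => 'i%C * v y)) => p q.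
by case: z => a b /=; congr (_ +i* _)%C; ring.
Qed.

Lemma section_coefficientD v v' x : L20 nu v -> L20 nu v' ->
  section_coefficient (fun y => v y + v' y) x =
  section_coefficient v x + section_coefficient v' x.
Proof.
move=> Lv Lv'; have LFx := L20_L2 (LF x).
have Liv := L20_L2 (L20Z 'i%C Lv); have Liv' := L20_L2 (L20Z 'i%C Lv').
rewrite /section_coefficient ipDr//; try exact: L20_L2.
have -> : (fun y => 'i%C * (v y + v' y)) = (fun y => 'i%C * v y + 'i%C * v' y).
  by apply/funext => y; rewrite mulrDr.
by rewrite ipDr.
Qed.

Hypothesis F_invariant :
  forall g, {ae m, forall x, {ae nu, forall y, F (T g x) (S g y) = F x y}}.

(** Invariance moves [T g] on the section to [S g] on the vector, because composing both arguments
    with [S g] preserves the inner product. *)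
Lemma section_coefficient_shift g v : L20 nu v ->
  {ae m, forall x, section_coefficient v (T g x) = section_coefficient (v \o S g) x}.
Proof.
move=> Lv; have Liv := L20Z 'i%C Lv.
have := F_invariant g; apply: filterS => x Fx.
have sh w : L20 nu w -> ip nu (F (T g x)) w = ip nu (F x) (w \o S g).
  move=> Lw; rewrite -(ip_mp (S_mp g) (L20_L2 (LF _)) (L20_L2 Lw)).
  apply: ip_ae; [exact/L20_L2/(L20_mp (S_mp g))|exact: L20_L2|
    exact/L20_L2/(L20_mp (S_mp g))|exact/L20_L2/(L20_mp (S_mp g))| |exact: aeW].
  by move: Fx; apply: filterS => y /= ->.
by rewrite /section_coefficient !sh.
Qed.

(** With [v = E V w] and [n = nsq v], the mean of the coefficient over [C] is the pairing of [w]
    with [v], which is [n]: hence the division by [n]. The squared norm is then at most the mean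
    energy divided by [n], so at most [delta^-1] for every cell, and the same estimate for the error
    vector [v'] bounds [r]. *)
Lemma approximate_eigenfunction C V (delta : R) (chi0 : dual R G) :
  measurable C -> measurable V -> 0 < delta ->
  let w := section_average m nu A C in
  0 < nsq nu (E V w) -> delta * mean_energy m nu E A V <= nsq nu (E V w) ->
  exists f : X -> R[i]^o,
    [/\ L2 m f, nsq m f <= delta^-1,
      Int m (fun x => complex.Re (f x) * \1_C x) = 1,
      Int m (fun x => complex.Im (f x) * \1_C x) = 0
    & forall g, exists r : X -> R[i]^o,
      [/\ L2 m r, {ae m, forall x, f (T g x) = chi0 g * f x + r x} &
        forall eps, 0 <= eps ->
          (forall chi : dual R G, V chi -> csq (chi (- g) - chi0 (- g)) <= eps) ->
          nsq m r <= eps * delta^-1]].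
Proof.
move=> mC mV delta0 w n0 qn.
have Lw : L20 nu w by exact: L20_section_average.
set v := E V w; set n := nsq nu v in n0 qn; set q := mean_energy m nu E A V in qn.
have Lv : L20 nu v by exact: (pvm_L20 PE).
have Vv : {ae nu, forall y, E V v y = v y}.
  by have := pvmI PE mV mV Lw; rewrite setIid; apply: filterS => y; rewrite -/v => <-.
have q0 : 0 <= q by exact: mean_energy_ge0.
have nn0 : n != 0 by rewrite gt_eqF.
have dn : q / n <= delta^-1.
  by rewrite ler_pdivrMr// ler_pdivlMl.
have [LL nL] := L2_section_coefficient mV Lv Vv; rewrite -/n -/q in nL.
pose k : R[i] := (n^-1)%:C%C.
have csqk : csq k = n^-1 ^+ 2 by rewrite /csq /= expr0n /= addr0.
have LiV := L20Z 'i%C Lv.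
have ipw b : L20 nu b -> {ae nu, forall y, E V b y = b y} -> ip nu w b = ip nu v b.
  by move=> Lb Vb; rewrite (ip_pvm_range mV Lw Lb Vb).
have Viv : {ae nu, forall y, E V (fun y => 'i%C * v y) y = 'i%C * v y}.
  by have := pvmZ PE 'i%C mV Lv; move: Vv; apply: filterS2 => y -> ->.
exists (fun x => k * section_coefficient v x); split.
- exact: L2Z.
- rewrite nsqZ// csqk; apply: le_trans dn.
  apply: (@le_trans _ _ (n^-1 ^+ 2 * (q * n))).
    by rewrite ler_wpM2l// exprn_ge0// invr_ge0 ltW.
  by rewrite le_eqVlt; apply/orP; left; apply/eqP; field.
- rewrite (_ : (fun _ => _) = (fun x => n^-1 * (ip nu (F x) v * \1_C x))); last first.
    by apply/funext => x; rewrite /k /section_coefficient /=; ring.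
  rewrite IntZ; last by apply: intgM_indic => //; exact/(intg_ip_centered_section m mA)/L20_L2.
  rewrite ip_section_average//; last exact: L20_L2.
  by rewrite ipw// -/(nsq nu v) -/n mulVf.
- rewrite (_ : (fun _ => _) = (fun x => n^-1 * (ip nu (F x) (fun y => 'i%C * v y) * \1_C x))); last first.
    by apply/funext => x; rewrite /k /section_coefficient /=; ring.
  rewrite IntZ; last by apply: intgM_indic => //; exact/(intg_ip_centered_section m mA)/L20_L2.
  rewrite ip_section_average//; last exact: L20_L2.
  by rewrite ipw// ip_i0 ?mulr0//; exact: L20_L2.
- move=> g; pose z : R[i] := chi0 (- g).
  pose v' y : R[i]^o := v (S g y) - z * v y.
  have Lv' : L20 nu v' by apply: L20B; [exact: (L20_mp (S_mp g))|exact: L20Z].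
  have Vv' : {ae nu, forall y, E V v' y = v' y} by exact: (pvm_koopman_sub S_mp SE).
  have [LL' nL'] := L2_section_coefficient mV Lv' Vv'; rewrite -/q in nL'.
  exists (fun x => k * section_coefficient v' x); split.
  + exact: L2Z.
  + have := section_coefficient_shift g Lv; apply: filterS => x ->.
    have -> : v \o S g = (fun y => z * v y + v' y).
      by apply/funext => y; rewrite /v' /= addrC subrK.
    rewrite section_coefficientD//; last exact: L20Z.
    rewrite section_coefficientZ// mulrDr; congr (_ + _).
    (* Conjugate linearity turns the factor [chi0 (- g)] of the vector into the eigenvalue
       [chi0 g]. *)
    have -> : z^*%C = chi0 g.
      by apply: conj_inverse; [exact: csq_character|exact: characterMN].
    by rewrite mulrCA.
  + move=> eps eps0 Veps; rewrite nsqZ// csqk.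
    have nv' : nsq nu v' <= eps * n by exact: (koopman_approx_scalar S_mp SE).
    apply: (@le_trans _ _ (n^-1 ^+ 2 * (q * (eps * n)))).
      rewrite ler_wpM2l ?exprn_ge0 ?invr_ge0 ?(ltW n0)//.
      by apply: le_trans nL' _; rewrite ler_wpM2l.
    have -> : n^-1 ^+ 2 * (q * (eps * n)) = eps * (q / n) by field.
    by rewrite ler_wpM2l.
Qed.

End eigenfunction_of_a_cell.

(** * Nullity of the eigenvalues implies ergodicity of the product *)

Lemma ae_invariant_indic (R : realType) d (Z : measurableType d) (m : probability Z R)
    (P : nst m) (A : set Z) : measurable A ->
  m ((P @` A) `+` A) = 0%E -> {ae m, forall p, (P p \in A) = (p \in A)}.
Proof.
move=> mA A0.
have mPA : measurable ((P @` A) `+` A).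
  rewrite nst_imageE; apply: measurableU; apply: measurableD => //;
    exact: measurable_preimage_inv.
exists (P @^-1` ((P @` A) `+` A)); split.
- exact: measurable_preimage_fun.
- exact/(nst_null P mPA).
- rewrite nst_imageE => p /= ne; rewrite nst_funK.
  have [Ap|Ap] := boolP (p \in A); have [APp|APp] := boolP (P p \in A).
  + by exfalso; apply: ne; rewrite Ap APp.
  + by left; split; [exact: set_mem|move=> /mem_set; exact/negP].
  + by right; split; [exact: set_mem|move=> /mem_set; exact/negP].
  + by exfalso; apply: ne; rewrite (negbTE Ap) (negbTE APp).
Qed.

Section null_eigenvalues_imply_ergodic.
Context (R : realType) (G : topologicalZmodType).
Context dX (X : measurableType dX) (m : probability X R) (T : G -> nst m).
Hypothesis T_action : nonsingular_action T.
Hypothesis T_ergodic : ergodic m (fun g => T g).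
Context dY (Y : measurableType dY) (nu : probability Y R) (S : G -> nst nu).
Hypothesis S_mp : forall g A, measurable A -> nu (S g @^-1` A) = nu A.
Context (E : set (borel_dual R G) -> (Y -> R[i]^o) -> (Y -> R[i]^o)).
Hypothesis SE : is_spectral_measure nu (fun g => S g) E.
Context (q : nat -> G).
Hypothesis q_dense : forall O : set G, open O -> O !=set0 -> exists i, O (q i).

Local Notation mn := (m \x nu)%E.
Let PE : projection_valued_measure nu E := SE.1.

Lemma centered_section_invariant A g : measurable A ->
  {ae mn, forall p, (prod_nst (T g) (S g) p \in A) = (p \in A)} ->
  {ae m, forall x, fine (nu (xsection A (T g x))) = fine (nu (xsection A x)) /\
    {ae nu, forall y, centered_section nu A (T g x) (S g y) = centered_section nu A x y}}.
Proof.
move=> mA /ae_prod_sections; apply: filterS => x hx.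
have m1 := measurable_xsection x mA; have m2 := measurable_xsection (T g x) mA.
have ind : {ae nu, forall y, \1_(xsection A (T g x)) (S g y) = \1_(xsection A x) y :> R}.
  by move: hx; apply: filterS => y h; rewrite !indic_xsection !indicE -h.
have mass : fine (nu (xsection A (T g x))) = fine (nu (xsection A x)).
  rewrite -(Int_indic nu m1) -(Int_indic nu m2).
  rewrite -(Int_mp (S_mp g)); last exact/sqi_intg/sqi_indic.
  apply: Int_ae => //; first by apply: measurable_comp_nst; exact: measurable_fun_indic.
  exact: measurable_fun_indic.
split => //; move: ind; apply: filterS => y h.
by rewrite /centered_section /centered_indic h mass.
Qed.

(** If all averages vanish, [\1_A] is almost everywhere the mass of the section at [x]. That mass is
    invariant under [T], hence constant, and a set with constant indicator is null or conull. *)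
Lemma exists_section_average A : measurable A ->
  (forall g, {ae mn, forall p, (prod_nst (T g) (S g) p \in A) = (p \in A)}) ->
  mn A <> 0%E -> mn (~` A) <> 0%E ->
  exists2 C, measurable C & 0 < nsq nu (section_average m nu A C).
Proof.
move=> mA inv A0 AC0; apply: contrapT => nex.
have w0 C : measurable C -> {ae nu, forall y, section_average m nu A C y = 0}.
  move=> mC; apply: nsq_eq0; first exact/L20_L2/L20_section_average.
  apply/eqP; rewrite eq_le nsq_ge0 andbT leNgt; apply/negP => h.
  by apply: nex; exists C.
have c0 := section_averages_separate mA w0.
have [c hc] : exists c, {ae m, forall x, fine (nu (xsection A x)) = c}.
  apply: (ergodic_ae_constant T_ergodic); first exact: measurable_section_mass.
  by move=> g; have := centered_section_invariant mA (inv g); apply: filterS => x [].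
have Ac : {ae mn, forall p, \1_A p = c :> R}.
  have := ae_prod_fst nu hc; move: c0; apply: filterS2 => p.
  by rewrite /centered_set => /eqP; rewrite subr_eq0 => /eqP -> ->.
have [cz|cnz] := eqVneq c 0.
  apply: A0; apply/negligibleP => //; apply: negligibleS Ac => p Ap /=.
  by rewrite indicE mem_set// cz => /eqP; rewrite oner_eq0.
apply: AC0; apply/negligibleP; first exact: measurableC.
apply: negligibleS Ac => p Ap /=.
by rewrite indicE memNset// => /eqP; rewrite eq_sym (negbTE cnz).
Qed.

Lemma sum_mean_energy A c N : measurable A -> finite_code c N ->
  \sum_(k <- iota 0 N) mean_energy m nu E A (c @^-1` [set k]) <= 1.
Proof.
move=> mA cN; have mc k : measurable (c @^-1` [set k] : set (borel_dual R G)) by exact: cN.2.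
have LF x := L20_centered_section nu mA x.
rewrite -Int_sum; last by move=> k; exact: (intg_section_energy m SE).
rewrite -[leRHS](Int_cst m 1); apply: le_Int; [|exact: intg_cst|].
  by apply: intg_sum => k; exact: (intg_section_energy m SE).
move=> x; apply: le_trans (nsq_centered_section_le1 nu mA x).
rewrite le_eqVlt; apply/orP; left; apply/eqP.
transitivity (ip nu (E setT (centered_section nu A x)) (centered_section nu A x)).
  rewrite (ip_pvm_code PE cN)//; apply: eq_bigr => k _.
  by rewrite setIT /section_energy (nsq_pvm PE).
apply: ip_ae; [exact: (pvm_L2 PE)|exact: L20_L2|exact: L20_L2|exact: L20_L2| |exact: aeW].
exact: pvmT.
Qed.

(** The inequality is summed over the cells: the total energy is at most 1, and a cell that is not
    bad meets the bad set in the empty set. *)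
Lemma bad_cells_mass A c N (w : Y -> R[i]^o) (delta : R) (bad : pred nat) :
  measurable A -> finite_code c N -> L20 nu w -> 0 <= delta ->
  (forall k, bad k -> nsq nu (E (c @^-1` [set k]) w) <=
    delta * mean_energy m nu E A (c @^-1` [set k])) ->
  measurable ([set chi | bad (c chi)] : set (borel_dual R G)) /\
  nsq nu (E [set chi | bad (c chi)] w) <= delta.
Proof.
move=> mA cN Lw delta0 badle.
have mc k : measurable (c @^-1` [set k] : set (borel_dual R G)) by exact: cN.2.
have mB : measurable ([set chi | bad (c chi)] : set (borel_dual R G)).
  rewrite (_ : [set _ | _] = \bigcup_(k in [set k | bad k]) (c @^-1` [set k])).
    by apply: bigcup_measurable => k _; exact: mc.
  apply/seteqP; split => [chi /= b|chi [k /= bk ck]]; last by rewrite ck.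
  by exists (c chi).
split => //; rewrite (nsq_pvm PE)// (ip_pvm_code PE cN)//.
apply: (@le_trans _ _ (delta * \sum_(k <- iota 0 N) mean_energy m nu E A (c @^-1` [set k]))); last first.
  by rewrite -[leRHS]mulr1 ler_wpM2l//; exact: sum_mean_energy.
rewrite mulr_sumr; apply: ler_sum => k _.
have [bk|nbk] := boolP (bad k).
  rewrite (_ : _ `&` _ = c @^-1` [set k]); first by rewrite -(nsq_pvm PE)//; exact: badle.
  by apply/seteqP; split => [chi []//|chi /= ck]; split => //=; rewrite ck.
rewrite (_ : _ `&` _ = set0).
  rewrite (ip_ae0 (pvm_L2 PE measurable0 Lw) (L20_L2 Lw) (pvm0 PE Lw)).
  by rewrite mulr_ge0// mean_energy_ge0.
by apply/seteqP; split => // chi [/= ck]; rewrite ck (negbTE nbk).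
Qed.

(* The set of points eventually in all [B n] has mass at most [delta]. *)
Lemma exists_recurrent_point d' (Z : measurableType d') (s : {measure set Z -> \bar R})
    (B : nat -> set Z) (N : set Z) (delta : R) :
  (forall n, measurable (B n)) -> measurable N -> s N = 0%E ->
  (forall n, (s (B n) <= delta%:E)%E) -> (delta%:E < s setT)%E ->
  exists2 z, ~ N z & forall n, exists2 k, (n <= k)%N & ~ B k z.
Proof.
move=> mB mN N0 Bd sT; apply: contrapT => nex.
pose D n := \bigcap_(k in [set k | (n <= k)%N]) B k.
have mD n : measurable (D n) by apply: bigcap_measurableType => k _; exact: mB.
have mL : measurable (\bigcup_n D n) by exact: bigcupT_measurable.
have ndD : {homo D : i j / (i <= j)%N >-> (i <= j)%O}.
  move=> i j ij; apply/subsetPset => z Dz k /= jk; apply: Dz.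
  exact: leq_trans jk.
have sL : (s (\bigcup_n D n) <= delta%:E)%E.
  apply: (cvge_le _ (nondecreasing_cvg_mu mD mL ndD)); apply: nearW => n /=.
  apply: le_trans (Bd n); apply: le_measure; rewrite ?inE//.
  by move=> z; apply => /=.
have : (s setT <= delta%:E)%E; last by rewrite leNgt sT.
apply: (@le_trans _ _ (s ((\bigcup_n D n) `|` N))).
  apply: le_measure; rewrite ?inE//; first exact: measurableU.
  move=> z _; apply: contrapT => /not_orP[nL nN]; apply: nex; exists z => // n.
  apply: contrapT => nk; apply: nL; exists n => // k /= nk'.
  by apply: contrapT => nB; apply: nk; exists k.
apply: (le_trans (measureU2 s mL mN)).
by rewrite [X in (_ + X)%E]N0 adde0.
Qed.

Theorem null_eigenvalues_ergodic_product :
  measurable (eigenvalues m T : set (borel_dual R G)) ->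
  (forall h, L20 nu h -> {ae nu, forall y, E (eigenvalues m T) h y = 0}) ->
  ergodic mn (fun g => prod_nst (T g) (S g)).
Proof.
move=> mev ev0 A mA invA; apply: contrapT => /not_orP[A0 AC0].
have inv g := ae_invariant_indic mA (invA g).
have [C mC w0] := exists_section_average mA inv A0 AC0.
have Finv g : {ae m, forall x, {ae nu, forall y,
    centered_section nu A (T g x) (S g y) = centered_section nu A x y}}.
  by have := centered_section_invariant mA (inv g); apply: filterS => x [].
set w := section_average m nu A C in w0.
have Lw : L20 nu w by exact: L20_section_average.
(* Bad cells will carry mass at most [delta], strictly less than the total mass [delta + delta] of
   [w]. *)
pose delta : R := nsq nu w / 2.
have delta0 : 0 < delta by rewrite divr_gt0.
have [s sE] := spectral_measure_exists PE Lw.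
(* Opposites, because the Koopman operator of [g] acts as evaluation at [- g]. *)
pose Phi n := [seq - q i | i <- iota 0 n].
have eps0 n : 0 < n.+1%:R^-1 :> R by [].
pose Hc n := finite_code_close (Phi n) (eps0 n).
pose c n := sval (cid (Hc n)).
have [N cN cE] : exists2 N, forall n, finite_code (c n) (N n) &
    forall n (chi chi' : dual R G), c n chi = c n chi' ->
      forall g, g \in Phi n -> csq (chi g - chi' g) <= n.+1%:R^-1.
  exists (fun n => s2val (cid2 (svalP (cid (Hc n))))) => n.
    exact: (s2valP (cid2 (svalP (cid (Hc n))))).
  exact: (s2valP' (cid2 (svalP (cid (Hc n))))).
pose V n k : set (borel_dual R G) := c n @^-1` [set k].
have mV n k : measurable (V n k) by exact: (cN n).2.
(* Cells without mass, where no normalisation is possible, count as bad too; they satisfy the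
   inequality of [bad_cells_mass] trivially. *)
pose bad n k := ~~ ((0 < nsq nu (E (V n k) w)) &&
  (delta * mean_energy m nu E A (V n k) <= nsq nu (E (V n k) w))).
have badP n := @bad_cells_mass A (c n) (N n) w delta (bad n) mA (cN n) Lw (ltW delta0).
have badle n k : bad n k -> nsq nu (E (V n k) w) <= delta * mean_energy m nu E A (V n k).
  rewrite /bad negb_and -leNgt -ltNge => /orP[h|/ltW//].
  by apply: (le_trans h); rewrite mulr_ge0 ?(ltW delta0)// mean_energy_ge0.
have [|||chi0 nev rec] := @exists_recurrent_point _ _ s
  (fun n => [set chi | bad n (c n chi)]) (eigenvalues m T) delta
  (fun n => (badP n (badle n)).1) mev.
- rewrite sE//; congr EFin; apply: ip_ae0; [exact: (pvm_L2 PE)|exact: (pvm_L2 PE)|exact: ev0].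
- by move=> n; rewrite sE ?lee_fin; [exact: (badP n (badle n)).2|exact: (badP n (badle n)).1].
- rewrite sE// lte_fin (_ : nsq nu (E setT w) = nsq nu w).
    by rewrite ltr_pdivrMr// mulr_natr mulr2n ltrDl.
  apply: ip_ae; try exact: (pvm_L2 PE); try exact: L20_L2; exact: pvmT.
(* The contradiction: the chosen character outside the eigenvalue set is shown to be an
   eigenvalue. *)
apply: nev.
(* Reindexing: for each [n], a partition of index at least [n] in which the cell of [chi0] is
   good. *)
pose k n := s2val (cid2 (rec n)).
have nk n : (n <= k n)%N by exact: (s2valP (cid2 (rec n))).
have good n : 0 < nsq nu (E (V (k n) (c (k n) chi0)) w) /\
    delta * mean_energy m nu E A (V (k n) (c (k n) chi0)) <= nsq nu (E (V (k n) (c (k n) chi0)) w).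
  have /negP := s2valP' (cid2 (rec n)); rewrite -/(k n) /bad negbK.
  by move/andP.
have /choice[f fP] := fun n => approximate_eigenfunction S_mp SE mA Finv chi0 mC
  (mV (k n) (c (k n) chi0)) delta0 (good n).1 (good n).2.
have Lf n : L2 m (f n) by have [] := fP n.
have fr n : Int m (fun x => complex.Re (f n x) ^+ 2) <= delta^-1.
  have [_ h _ _ _] := fP n; apply: le_trans h.
  by rewrite nsq_Re_Im// lerDl; apply: Int_ge0 => x; exact: sqr_ge0.
have fi n : Int m (fun x => complex.Im (f n x) ^+ 2) <= delta^-1.
  have [_ h _ _ _] := fP n; apply: le_trans h.
  by rewrite nsq_Re_Im// lerDr; apply: Int_ge0 => x; exact: sqr_ge0.
have [U [UF sU]] := ultraFilterLemma (@eventually_filter : ProperFilter \oo).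
have [H [LH _ _ wr wi]] := complex_weak_limit UF Lf fr fi.
have mI := @measurable_fun_indic R _ _ _ mC.
have bI x : `|\1_C x| <= 1 :> R by exact: normr_indic_le1.
have H1 : Int m (fun x => complex.Re (H x) * \1_C x) = 1.
  have := wr _ _ mI bI.
  have -> : (fun n => Int m (fun x => complex.Re (f n x) * \1_C x)) = fun=> 1.
    by apply/funext => n; have [] := fP n.
  by move=> h1; apply: (cvg_unique _ h1 (cvg_cst (1 : R))); exact: norm_hausdorff.
exists H; split => //.
- move=> H0; have : Int m (fun x => complex.Re (H x) * \1_C x) = 0.
    rewrite -[RHS](Int_cst m 0); apply: Int_ae => //.
      exact: intg_measurable (intgM_indic (sqi_intg (L2Re LH)) mC).
    by move: H0; apply: filterS => x ->; rewrite mul0r.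
  by rewrite H1 => /eqP; rewrite oner_eq0.
apply: (eigen_dense T_action q_dense LH) => i.
have /choice[r rP] := fun n => let: And5 _ _ _ _ hr := fP n in hr (q i).
have Lr n : L2 m (r n) by have [] := rP n.
apply: (complex_weak_limit_equivariant UF (T := T (q i)) Lf Lr LH wr wi).
  by move=> n; have [_ h _] := rP n; exact: h.
apply/cvgr0Pnorm_lt => e e0.
(* The error at stage [n] is at most [(k n).+1%:R^-1 * delta^-1] once [i < n], and [k n >= n]. *)
have e'0 : 0 < e * delta by rewrite mulr_gt0.
have := near_infty_natSinv_lt (PosNum e'0) => /= near_n.
apply: sU.
have near_i : \forall n \near \oo, (i < n)%N by exact: nbhs_infty_gt.
move: near_n near_i; apply: filterS2 => n hn ni.
have [_ _ rn] := rP n.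
rewrite ger0_norm ?nsq_ge0//.
apply: (@le_lt_trans _ _ ((k n).+1%:R^-1 * delta^-1)).
  apply: rn => // chi Vchi; apply: cE; first exact: Vchi.
  by apply/mapP; exists i => //; rewrite mem_iota add0n leq0n /= (leq_trans ni).
rewrite ltr_pdivrMr//; apply: le_lt_trans hn.
by rewrite lef_pV2 ?posrE// ler_nat ltnS.
Qed.

End null_eigenvalues_imply_ergodic.

Theorem theorem2p10 (R : realType)
  (G : topologicalZmodType)
  (G_polish : polish R G)
  (G_locally_compact : locally_compact [set: G])
  (dX : measure_display) (X : measurableType dX)
  (X_standard : standard_borel R X) (m : probability X R)
  (T : G -> nst m)
  (T_action : nonsingular_action T)
  (T_properly_ergodic : properly_ergodic m T)
  (dY : measure_display) (Y : measurableType dY)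
  (Y_standard : standard_borel R Y) (nu : probability Y R)
  (S : G -> nst nu)
  (S_action : probability_preserving_action S)
  (S_ergodic : ergodic nu S)
  (sigma0 : {measure set (borel_dual R G) -> \bar R})
  (sigma0_spectral_type : is_spectral_type nu S sigma0) :
  ergodic (m \x nu)%E (fun g (p : X * Y) => (T g p.1, S g p.2)) <->
  sigma0 (eigenvalues m T) = 0%E.
Proof.
have S_mp := S_action.2.
have [E SE sE] := sigma0_spectral_type.
have [C sepC] := standard_borel_separating m X_standard.
have [q q_dense] := polish_dense_sequence G_polish.
have mC n : measurable (C n) by case: sepC.
pose P n k : set (borel_dual R G) := eigenset T (C n) k%:R.
have mP n k : measurable (P n k) by exact: measurable_eigenset.
have eE : eigenvalues m T = \bigcup_n \bigcup_k P n k by exact: eigenvaluesE.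
have mev : measurable (eigenvalues m T : set (borel_dual R G)).
  by rewrite eE; apply: bigcupT_measurable => n; exact: bigcupT_measurable.
split => [erg|/(sE _ mev) ev0]; last first.
  (* By conversion, [prod_nst (T g) (S g)] is the product map of the statement. *)
  exact: (null_eigenvalues_ergodic_product T_action T_properly_ergodic.1 S_mp SE
    q_dense mev ev0).
apply/(negligibleP sigma0 mev); rewrite eE.
apply: negligible_bigcup => n; apply: negligible_bigcup => k.
apply/(negligibleP sigma0 (mP n k))/(sE _ (mP n k)) => h Lh.
exact: (ergodic_product_pvm_eigenset S_mp SE _ erg (mC n) Lh).
Qed.
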